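(* The function $\kappa(v):=\rho_\infty\left(\frac12+\frac{v+1}{v-1}\right)$ on the unit circle belongs to $C^\infty(S^1)+H^\infty(\mathcal{U})$.
   Context: $\rho_\infty(z):=\dfrac{\pi^{-z/2}\Gamma(z/2)}{\pi^{-(1-z)/2}\Gamma((1-z)/2)}$. $\mathcal{U}=\{v\in\mathbb{C}\mid|v|<1\}$ is the open unit disk, $S^1=\partial\mathcal{U}$; the function $\kappa$ is defined on $S^1\setminus\{1\}$ (hence almost everywhere on $S^1$), where it has modulus $1$. $H^\infty(\mathcal{U})$ is the space of bounded holomorphic functions on $\mathcal{U}$, identified with the subspace of $L^\infty(S^1)$ of their boundary values; $C^\infty(S^1)$ is the space of smooth complex valued functions on $S^1$. The sum is taken in $L^\infty(S^1)$. *)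

(* Defs.v *)
From mathcomp Require Import all_boot all_order all_algebra.
From mathcomp Require Import all_classical all_reals all_analysis.
From mathcomp Require Import complex.

Set Implicit Arguments.
Unset Strict Implicit.
Unset Printing Implicit Defensive.

Import Order.TTheory GRing.Theory Num.Theory.
Import numFieldNormedType.Exports.

Local Open Scope classical_set_scope.
Local Open Scope ring_scope.
Local Open Scope complex_scope.

Section LocalFactor.
Variable R : realType.
Implicit Types (z v : R[i]) (t : R).

Definition cis t : R[i] := cos t +i* sin t.

Definition cexp z : R[i] := (expR (complex.Re z))%:C * cis (complex.Im z).

(* Principal power [t ^ z], meant for [0 < t]. *)
Definition cpow t z : R[i] := cexp (z * (ln t)%:C).

Definition Gamma_integrand z t : R[i] := cpow t (z - 1) * (expR (- t))%:C.

(* Euler's integral, absolutely convergent for [0 < Re z]. *)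
Definition Gamma_integral z : R[i] :=
  (\int[lebesgue_measure]_(t in `]0, +oo[) complex.Re (Gamma_integrand z t)) +i*
  (\int[lebesgue_measure]_(t in `]0, +oo[) complex.Im (Gamma_integrand z t)).

Definition Gamma_shift z : nat :=
  if 0 < complex.Re z then 0%N else (absz (Num.floor (complex.Re z))).+1.

(* Meromorphic continuation of Euler's integral through Gamma (z + 1) = z * Gamma z; since
   [x / 0 = 0], the value at the poles 0, -1, -2, ... is 0. *)
Definition Gamma z : R[i] :=
  let n := Gamma_shift z in
  Gamma_integral (z + n%:R) / \prod_(k < n) (z + k%:R).

Definition rho_infty z : R[i] :=
  (cpow pi (- (z / 2)) * Gamma (z / 2)) /
  (cpow pi (- ((1 - z) / 2)) * Gamma ((1 - z) / 2)).

(* On the unit circle the argument of [rho_infty] is undefined at [v = 1] only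
   (a null set); there [x / 0 = 0] gives an irrelevant value. *)
Definition kappa v : R[i] := rho_infty (1 / 2 + (v + 1) / (v - 1)).

End LocalFactor.

(* Functions on the unit circle are represented by functions [R[i] -> R[i]] of
   which only the values at the points [cis t] matter.  The arc length on the
   circle is read off the parametrization [cis]: by periodicity, null sets,
   measurability and essential boundedness can be tested on the whole line. *)
Section Circle.
Variable R : realType.
Implicit Types f g h b : R[i] -> R[i].

Definition circle_ae_eq f g : Prop :=
  {ae lebesgue_measure, forall t : R, f (cis t) = g (cis t)}.

Definition circle_Linfty f : Prop :=
  ((fun t : R => complex.Re (f (cis t))) \in Lfun lebesgue_measure +oo%E) /\
  ((fun t : R => complex.Im (f (cis t))) \in Lfun lebesgue_measure +oo%E).

Definition real_smooth (u : R -> R) : Prop :=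
  forall (n : nat) (t : R), derivable (derive1n n u) t 1.

Definition circle_smooth g : Prop :=
  real_smooth (fun t => complex.Re (g (cis t))) /\
  real_smooth (fun t => complex.Im (g (cis t))).

(* The scalars of [derivable] are the complex numbers here, so this is
   complex differentiability. *)
Definition disk_holomorphic h : Prop :=
  forall z : R[i], `|z| < 1 -> derivable (h : R[i]^o -> R[i]^o) z 1.

Definition disk_bounded h : Prop :=
  exists M : R, forall z : R[i], `|z| < 1 -> `|h z| <= M%:C.

Definition disk_Hinfty h : Prop := disk_holomorphic h /\ disk_bounded h.

(* [b] represents the class in L^infty of the boundary values of [h], taken as
   radial limits (which exist almost everywhere by Fatou's theorem). *)
Definition boundary_values h b : Prop :=
  circle_Linfty b /\
  {ae lebesgue_measure, forall t : R,
    (h (r%:C * cis t) : R[i]^o) @[r --> (1 : R)^'-] --> (b (cis t) : R[i]^o)}.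

(* Membership of the class of [f] in the subspace C^infty + H^infty. *)
Definition in_smooth_add_Hinfty f : Prop :=
  circle_Linfty f /\
  exists g h b : R[i] -> R[i],
    [/\ circle_smooth g, disk_Hinfty h, boundary_values h b &
        circle_ae_eq f (fun v => g v + b v)].

End Circle.

(* Main.v *)
Require Import Defs.
From HB Require Import structures.
From mathcomp Require Import all_boot all_order all_algebra.
From mathcomp Require Import all_classical all_reals all_analysis.
From mathcomp Require Import measurable_realfun ess_sup_inf.
From mathcomp Require Import complex ring lra.
Import ComplexField.Normc.

(** Put [a = 1/4 + (v + 1) / (2 (v - 1))], which maps the open disk into
    [Re a < 1/4] and the circle without 1 into the line [Re a = 1/4].  Then
    [kappa v] is the ratio of [pi^(-a) Gamma(a)] to
    [pi^(-(1/2 - a)) Gamma(1/2 - a)].  On the line, [1/2 - a] is the conjugate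
    of [a], so this ratio has modulus 1.

    On the line the ratio equals [c (1/2 - a) M(a)], where [c] is a nonzero
    constant and
    [M(a) = int_0^oo sin(2 pi sqrt q) q^(a - 3/2) dq]
    ([mellin_sine_Gamma], [Gamma_ratio_mellin_sine]): this is the local
    functional equation, obtained by integrating
    [exp(-t) t^-1 sin(2 sqrt(t p)) p^(a - 3/2)] over the quadrant in both
    orders.  Dividing by [Gamma(1/2 - a)] requires that the Gamma integral has
    no zero ([Gamma_integral_neq0]).  The decomposition of [kappa] comes from
    cutting [M(a)] at [q = 1].

    The part over [q <= 1].  Expanding the sine gives
    [sum_n c_n / (n + a)] with [c_n] of factorial decay, and in the variable
    [v] one has
    [(1/2 - a) / (n + a) = - (v + 3) / ((4n + 3) v - (4n - 1))].
    The poles [(4n - 1)/(4n + 3)] accumulate at 1, but on the circle the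
    denominators have modulus at least 2; each derivative of a term costs only
    a polynomial factor in [n], which the factorial decay absorbs.  The sum is
    smooth on the whole circle, including the point 1
    ([denom_sum_smooth_part]).

    The part over [q > 1].  This integral converges absolutely for
    [Re a <= 1/4], where it is bounded and holomorphic ([taylor2_tail],
    [tail_bounded]).  The factor [1/2 - a] introduces linear growth; on the
    line, however, the product is the difference of two bounded functions, the
    Gamma ratio and the first part.  The Phragmen-Lindelof principle
    ([phragmen_lindelof]) therefore bounds it in the half plane
    ([tail_part_bounded]), and its pullback to the disk is in [H^infty].  As
    the integral is continuous up to the line, its radial limits at points of
    the circle other than 1 are its values there. *)

Set Implicit Arguments.
Unset Strict Implicit.
Unset Printing Implicit Defensive.

Import Order.TTheory GRing.Theory Num.Theory.
Import numFieldNormedType.Exports.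

Local Open Scope classical_set_scope.
Local Open Scope ring_scope.
Local Open Scope complex_scope.

Local Notation Re := complex.Re.
Local Notation Im := complex.Im.

(** * Complex exponentials and powers *)

Section ComplexBasics.
Variable R : realType.
Implicit Types (z w : R[i]) (t x y : R).

Lemma complex_ext z w : Re z = Re w -> Im z = Im w -> z = w.
Proof. by case: z w => [a b] [c d] /= -> ->. Qed.

Lemma Re_add z w : Re (z + w) = Re z + Re w. Proof. by case: z w => [a b] [c d]. Qed.
Lemma Im_add z w : Im (z + w) = Im z + Im w. Proof. by case: z w => [a b] [c d]. Qed.
Lemma Re_opp z : Re (- z) = - Re z. Proof. by case: z. Qed.
Lemma Im_opp z : Im (- z) = - Im z. Proof. by case: z. Qed.
Lemma Re_sub z w : Re (z - w) = Re z - Re w. Proof. by rewrite Re_add Re_opp. Qed.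
Lemma Im_sub z w : Im (z - w) = Im z - Im w. Proof. by rewrite Im_add Im_opp. Qed.
Lemma Re_mul z w : Re (z * w) = Re z * Re w - Im z * Im w.
Proof. by case: z w => [a b] [c d]. Qed.
Lemma Im_mul z w : Im (z * w) = Re z * Im w + Im z * Re w.
Proof. by case: z w => [a b] [c d]. Qed.
Lemma Re_realC x : Re x%:C = x. Proof. by []. Qed.
Lemma Im_realC x : Im x%:C = 0. Proof. by []. Qed.
Lemma Re_mulr z x : Re (z * x%:C) = Re z * x.
Proof. by rewrite Re_mul /= mulr0 subr0. Qed.
Lemma Im_mulr z x : Im (z * x%:C) = Im z * x.
Proof. by rewrite Im_mul /= mulr0 add0r. Qed.
Lemma Re_natC n : Re (n%:R : R[i]) = n%:R.
Proof. by rewrite -(rmorph_nat (real_complex R)). Qed.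
Lemma Im_natC n : Im (n%:R : R[i]) = 0.
Proof. by rewrite -(rmorph_nat (real_complex R)). Qed.
Lemma Re_1 : Re (1 : R[i]) = 1. Proof. by []. Qed.
Lemma Im_1 : Im (1 : R[i]) = 0. Proof. by []. Qed.

Definition ReImE := (Re_sub, Im_sub, Re_mulr, Im_mulr, Re_add, Im_add, Re_opp, Im_opp, Re_mul, Im_mul,
  Re_realC, Im_realC, Re_natC, Im_natC, Re_1, Im_1).

Lemma normcE' z : `|z| = (normc z)%:C. Proof. by case: z. Qed.
Lemma normc_sqr z : normc z ^+ 2 = Re z ^+ 2 + Im z ^+ 2.
Proof. by case: z => a b /=; rewrite sqr_sqrtr// addr_ge0 ?sqr_ge0. Qed.
Lemma normc_ge0 z : 0 <= normc z. Proof. by case: z => a b; exact: sqrtr_ge0. Qed.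
Hint Resolve normc_ge0 : core.
Lemma normc_real x : normc x%:C = `|x|.
Proof. by rewrite /= expr0n/= addr0 sqrtr_sqr. Qed.
Lemma normc_eq0 z : (normc z == 0) = (z == 0).
Proof. by apply/eqP/eqP => [/eq0_normc//|->]; exact: normc0. Qed.
Lemma normc_gt0 z : (0 < normc z) = (z != 0).
Proof. by rewrite lt_def normc_eq0 normc_ge0 andbT. Qed.
Lemma normc_nat n : normc (n%:R : R[i]) = n%:R.
Proof. by rewrite -(rmorph_nat (real_complex R)) normc_real ger0_norm. Qed.
Lemma normcD z w : normc (z + w) <= normc z + normc w.
Proof. exact: le_normcD. Qed.
Lemma normcNC z : normc (- z) = normc z.
Proof. exact: normcN. Qed.
Lemma normcB z w : normc (z - w) <= normc z + normc w.
Proof. by rewrite (le_trans (normcD _ _))// normcNC. Qed.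
Lemma normc_distC z w : normc (z - w) = normc (w - z).
Proof. by rewrite -normcNC opprB. Qed.
Lemma normcX z n : normc (z ^+ n) = normc z ^+ n.
Proof. by elim: n => [|n IH]; rewrite ?expr0 ?normc1// !exprS normcM IH. Qed.
Lemma Re_le_normc z : `|Re z| <= normc z.
Proof. by rewrite -lecR -normcE'; exact: normc_ge_Re. Qed.
Lemma Im_le_normc z : `|Im z| <= normc z.
Proof.
rewrite -(@ler_pXn2r _ 2) ?nnegrE//.
by rewrite normc_sqr real_normK ?num_real// lerDr sqr_ge0.
Qed.
Lemma normc_le_ReIm z : normc z <= `|Re z| + `|Im z|.
Proof.
rewrite -(@ler_pXn2r _ 2) ?nnegrE ?addr_ge0//.
rewrite normc_sqr sqrrD !real_normK ?num_real//.
by rewrite -addrA lerD2l lerDr pmulrn_lge0// mulr_ge0.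
Qed.
Lemma normc_le2 z (m : R) : `|Re z| <= m -> `|Im z| <= m -> normc z <= 2 * m.
Proof.
by move=> ? ?; rewrite (le_trans (normc_le_ReIm _))// mulr_natl mulr2n lerD.
Qed.
Lemma ler_normcD_sub z w : normc z - normc w <= normc (z + w).
Proof.
by rewrite lerBlDr; have := normcB (z + w) w; rewrite addrK.
Qed.

Lemma cisD x y : cis (x + y) = cis x * cis y :> R[i].
Proof. by apply: complex_ext; rewrite /cis ?ReImE/= ?cosD ?sinD//; ring. Qed.
Lemma cis0 : cis 0 = 1 :> R[i]. Proof. by rewrite /cis cos0 sin0. Qed.
Lemma normc_cis x : normc (cis x) = 1.
Proof. by rewrite /= cos2Dsin2 sqrtr1. Qed.

Lemma cexpD z w : cexp (z + w) = cexp z * cexp w.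
Proof. by rewrite /cexp Re_add Im_add expRD cisD rmorphM/=; ring. Qed.
Lemma cexp0 : cexp 0 = 1 :> R[i].
Proof. by rewrite /cexp/= expR0 cis0 mulr1. Qed.
Lemma normc_cexp z : normc (cexp z) = expR (Re z).
Proof. by rewrite /cexp normcM normc_cis mulr1 normc_real ger0_norm// expR_ge0. Qed.
Lemma cexp_neq0 z : cexp z != 0.
Proof. by rewrite -normc_gt0 normc_cexp expR_gt0. Qed.
Lemma cexpN z : cexp (- z) = (cexp z)^-1.
Proof.
by apply: (mulfI (cexp_neq0 z)); rewrite -cexpD subrr cexp0 divff// cexp_neq0.
Qed.
Lemma cexp_conj z : cexp (z^*) = (cexp z)^*.
Proof.
case: z => a b; rewrite /cexp/cis/= cosN sinN.
by apply: complex_ext => /=; ring.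
Qed.

Lemma cpowD t z w : cpow t (z + w) = cpow t z * cpow t w.
Proof. by rewrite /cpow mulrDl cexpD. Qed.
Lemma cpowN t z : cpow t (- z) = (cpow t z)^-1.
Proof. by rewrite /cpow mulNr cexpN. Qed.
Lemma cpow0 t : cpow t 0 = 1.
Proof. by rewrite /cpow mul0r cexp0. Qed.
Lemma cpow_neq0 t z : cpow t z != 0. Proof. exact: cexp_neq0. Qed.
Lemma normc_cpow t z : normc (cpow t z) = expR (Re z * ln t).
Proof. by rewrite /cpow normc_cexp Re_mulr. Qed.
Lemma cpow_mul t x z : 0 < t -> 0 < x -> cpow (t * x) z = cpow t z * cpow x z.
Proof.
by move=> t0 x0; rewrite /cpow lnM// rmorphD mulrDr cexpD.
Qed.
Lemma cpow_real t x : cpow t x%:C = (expR (x * ln t))%:C.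
Proof. by rewrite /cpow /cexp Re_mulr Im_mulr/= mul0r cis0 mulr1. Qed.
Lemma cpow1 t : 0 < t -> cpow t 1 = t%:C.
Proof. by move=> t0; rewrite cpow_real mul1r lnK. Qed.
Lemma cpow_nat t n : 0 < t -> cpow t n%:R = (t ^+ n)%:C.
Proof.
move=> t0; elim: n => [|n IH]; first by rewrite cpow0.
by rewrite -natr1 cpowD IH cpow1// exprSr rmorphM.
Qed.
Lemma cpow_conj t z : cpow t (z^*) = (cpow t z)^*.
Proof. by rewrite /cpow -cexp_conj rmorphM/= oppr0. Qed.

Lemma Re_cpow t z : Re (cpow t z) = expR (Re z * ln t) * cos (Im z * ln t).
Proof. by rewrite /cpow/cexp Re_mulr Im_mulr Re_mul/=; ring. Qed.
Lemma Im_cpow t z : Im (cpow t z) = expR (Re z * ln t) * sin (Im z * ln t).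
Proof. by rewrite /cpow/cexp Re_mulr Im_mulr Im_mul/=; ring. Qed.

End ComplexBasics.
#[export] Hint Resolve normc_ge0 : core.
Arguments normc {R} x : simpl never.
Arguments cexp {R} z : simpl never.
Arguments cpow {R} t z : simpl never.
Arguments Gamma_integrand {R} z t : simpl never.

(** * Complex-valued functions of a real variable *)

Section RealVariable.
Variable R : realType.
Implicit Types (f g : R -> R) (t a b : R).

Lemma is_derive_addE f g t a b : is_derive t (1 : R) f a ->
  is_derive t (1 : R) g b -> is_derive t (1 : R) (fun x => f x + g x) (a + b).
Proof. by move=> fa gb; exact: (is_deriveD fa gb). Qed.

Lemma is_derive_oppE f t a : is_derive t (1 : R) f a ->
  is_derive t (1 : R) (fun x => - f x) (- a).
Proof. by move=> fa; exact: (is_deriveN fa). Qed.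

Lemma is_derive_mulE f g t a b : is_derive t (1 : R) f a ->
  is_derive t (1 : R) g b ->
  is_derive t (1 : R) (fun x => f x * g x) (f t * b + a * g t).
Proof.
by move=> fa gb; apply: (is_derive_eq (is_deriveM fa gb)); rewrite /GRing.scale/= [a * _]mulrC.
Qed.

Lemma is_derive_compE f g t a b : is_derive (g t) (1 : R) f a ->
  is_derive t (1 : R) g b -> is_derive t (1 : R) (fun x => f (g x)) (a * b).
Proof. by move=> fa gb; exact: (is_derive1_comp fa gb). Qed.

Definition cderive (F : R -> R[i]) t (d : R[i]) : Prop :=
  is_derive t (1 : R) (fun x => Re (F x)) (Re d) /\
  is_derive t (1 : R) (fun x => Im (F x)) (Im d).

Implicit Types (F G : R -> R[i]) (c d e z : R[i]).

Lemma cderive_eq F t d e : d = e -> cderive F t d -> cderive F t e.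
Proof. by move=> ->. Qed.

Lemma cderive_cst c t : cderive (fun=> c) t 0.
Proof. by split; exact: is_derive_cst. Qed.

Lemma cderive_real f t a : is_derive t (1 : R) f a ->
  cderive (fun x => (f x)%:C) t a%:C.
Proof. by split => //; exact: is_derive_cst. Qed.

Lemma cderiveD F G t d e : cderive F t d -> cderive G t e ->
  cderive (fun x => F x + G x) t (d + e).
Proof.
move=> [F1 F2] [G1 G2]; split.
  by under eq_fun do rewrite Re_add; rewrite Re_add; exact: is_derive_addE.
by under eq_fun do rewrite Im_add; rewrite Im_add; exact: is_derive_addE.
Qed.

Lemma cderiveM F G t d e : cderive F t d -> cderive G t e ->
  cderive (fun x => F x * G x) t (F t * e + d * G t).
Proof.
move=> [F1 F2] [G1 G2]; split.
  under eq_fun do rewrite Re_mul.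
  have D := is_derive_addE (is_derive_mulE F1 G1)
    (is_derive_oppE (is_derive_mulE F2 G2)).
  by apply: (is_derive_eq D); rewrite !ReImE; ring.
under eq_fun do rewrite Im_mul.
have D := is_derive_addE (is_derive_mulE F1 G2) (is_derive_mulE F2 G1).
by apply: (is_derive_eq D); rewrite !ReImE; ring.
Qed.

Lemma cderiveZ c F t d : cderive F t d -> cderive (fun x => c * F x) t (c * d).
Proof.
move=> Fd; have := cderiveM (cderive_cst c t) Fd.
by rewrite mul0r addr0.
Qed.

Lemma cderive_cis t : cderive (@cis R) t (cis t * 'i).
Proof.
by split => /=; rewrite mulr0 mulr1 ?sub0r ?addr0; [exact: is_derive_cos|exact: is_derive_sin].
Qed.

Lemma cderive_comp F f t a d : cderive F (f t) d -> is_derive t (1 : R) f a ->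
  cderive (fun x => F (f x)) t (d * a%:C).
Proof.
move=> [F1 F2] fa; split; rewrite ?Re_mulr ?Im_mulr.
  exact: (is_derive_compE (f := fun x => Re (F x))).
exact: (is_derive_compE (f := fun x => Im (F x))).
Qed.

Lemma cderive_cexp F t d : cderive F t d ->
  cderive (fun x => cexp (F x)) t (d * cexp (F t)).
Proof.
move=> [F1 F2]; rewrite /cexp.
have E := cderive_real (is_derive_compE (is_derive_expR (Re (F t))) F1).
have C := cderive_comp (cderive_cis (Im (F t))) F2.
apply: cderive_eq (cderiveM E C).
rewrite rmorphM/= [d in RHS]complexE -complexiE; ring.
Qed.

Lemma cderive_cpow z t : 0 < t -> cderive (fun x : R => cpow x z) t (z * cpow t (z - 1)).
Proof.
move=> t0; have L := cderiveZ z (cderive_real (is_derive1_ln t0)).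
apply: cderive_eq (cderive_cexp L).
rewrite -/(cpow t z) cpowD cpowN cpow1// fmorphV; ring.
Qed.

Lemma cderive_expcpow z t : cderive (fun s : R => cexp (s%:C * z)) t (z * cexp (t%:C * z)).
Proof.
have L := cderiveM (cderive_real (@is_derive_id R R t 1)) (cderive_cst z t).
apply: cderive_eq (cderive_cexp L).
by rewrite mulr0 add0r rmorph1 mul1r.
Qed.

Lemma continuous_is_derive f t a : is_derive t (1 : R) f a -> {for t, continuous f}.
Proof.
by move=> fa; apply/differentiable_continuous/derivable1_diffP; exact: ex_derive.
Qed.

(** The mean value theorem fails for complex values; applied to the real and to
    the imaginary part it costs a factor 2. *)
Lemma cderive_mvt F (D : R -> R[i]) (M : R) :
  (forall t, 0 <= t <= 1 -> cderive F t (D t)) ->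
  (forall t, 0 <= t <= 1 -> normc (D t) <= M) ->
  normc (F 1 - F 0) <= 2 * M.
Proof.
move=> dF DM; apply: normc_le2.
- have [||c c01 e] := @MVT_segment R (fun x => Re (F x)) (fun x => Re (D x)) 0 1 ler01.
  + by move=> x /subset_itv_oo_cc; rewrite in_itv/= => /dF[].
  + apply: continuous_in_subspaceT => x; rewrite inE/= in_itv/= => /dF[d _].
    exact: continuous_is_derive d.
  + rewrite Re_sub e subr0 mulr1 (le_trans (Re_le_normc _))// DM//.
- have [||c c01 e] := @MVT_segment R (fun x => Im (F x)) (fun x => Im (D x)) 0 1 ler01.
  + by move=> x /subset_itv_oo_cc; rewrite in_itv/= => /dF[].
  + apply: continuous_in_subspaceT => x; rewrite inE/= in_itv/= => /dF[_ d].
    exact: continuous_is_derive d.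
  + rewrite Im_sub e subr0 mulr1 (le_trans (Im_le_normc _))// DM//.
Qed.

Lemma normc_cexp_le z t : 0 <= t <= 1 -> normc (cexp (t%:C * z)) <= expR (normc z).
Proof.
move=> /andP[t0 t1]; rewrite normc_cexp ler_expR mulrC Re_mulr.
rewrite (le_trans (ler_norm _))// normrM (ger0_norm t0).
by rewrite (le_trans (ler_piMr _ t1))// Re_le_normc.
Qed.

(** The three Taylor bounds follow from one another by [cderive_mvt] along the
    segment from 0 to [z]; the constant doubles each time. *)
Lemma cexp_taylor1 z t : 0 <= t <= 1 ->
  normc (cexp (t%:C * z) - 1) <= 2 * (normc z * expR (normc z)).
Proof.
move=> t01; have /andP[t0 t1] := t01.
have := @cderive_mvt (fun s => cexp ((s * t)%:C * z)) (fun s => t%:C * z * cexp ((s * t)%:C * z)) (normc z * expR (normc z)).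
rewrite mul1r mul0r mul0r cexp0; apply.
  move=> s s01.
  have := @cderive_expcpow (t%:C * z) s.
  by under eq_fun do rewrite mulrA -rmorphM; rewrite mulrA -rmorphM.
move=> s /andP[s0 s1]; rewrite normcM ler_pM//.
  by rewrite normcM normc_real ger0_norm// ler_piMl.
by apply: normc_cexp_le; rewrite mulr_ge0//= mulr_ile1.
Qed.

Lemma cexp_taylor2 z t : 0 <= t <= 1 ->
  normc (cexp (t%:C * z) - 1 - t%:C * z) <= 4 * (normc z ^+ 2 * expR (normc z)).
Proof.
move=> t01; have /andP[t0 t1] := t01.
have := @cderive_mvt (fun s => cexp ((s * t)%:C * z) - 1 - (s * t)%:C * z)
  (fun s => t%:C * z * (cexp ((s * t)%:C * z) - 1)) (2 * (normc z ^+ 2 * expR (normc z))).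
rewrite mul1r mul0r mul0r cexp0 !subrr !subr0 => H.
have -> x : 4 * x = 2 * (2 * x) :> R by ring.
apply: H.
  move=> s s01.
  have E := @cderive_expcpow (t%:C * z) s.
  have E1 := cderive_cst (-1) s.
  have E2 := cderiveZ (- (t%:C * z)) (cderive_real (@is_derive_id R R s 1)).
  have := cderiveD (cderiveD E E1) E2.
  under eq_fun do rewrite mulNr [t%:C * z * _]mulrC mulrA -rmorphM.
  by apply: cderive_eq; rewrite mulrA -rmorphM rmorph1; ring.
move=> s /andP[s0 s1]; rewrite normcM expr2 -mulrA mulrCA ler_pM//.
  by rewrite normcM normc_real ger0_norm// ler_piMl.
by apply: cexp_taylor1; rewrite mulr_ge0//= mulr_ile1.
Qed.

Lemma cexp_taylor3 z :
  normc (cexp z - 1 - z - z ^+ 2 / 2) <= 8 * (normc z ^+ 3 * expR (normc z)).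
Proof.
have := @cderive_mvt (fun s => cexp (s%:C * z) - 1 - s%:C * z - (s%:C * z) ^+ 2 / 2)
  (fun s => z * (cexp (s%:C * z) - 1 - s%:C * z)) (4 * (normc z ^+ 3 * expR (normc z))).
rewrite mul1r mul0r cexp0 expr0n/= mul0r !subrr !subr0 => H.
have -> x : 8 * x = 2 * (4 * x) :> R by ring.
apply: H.
  move=> s s01.
  have E := @cderive_expcpow z s.
  have E1 := cderive_cst (-1) s.
  have E2 := cderiveZ (- z) (cderive_real (@is_derive_id R R s 1)).
  have I := cderive_real (@is_derive_id R R s 1).
  have E3 := cderiveZ (- z ^+ 2 / 2) (cderiveM I I).
  have := cderiveD (cderiveD (cderiveD E E1) E2) E3.
  rewrite (_ : (fun x : R => _) = (fun s : R => cexp (s%:C * z) - 1 - s%:C * z - (s%:C * z) ^+ 2 / 2)); last first.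
    by apply/funext => x /=; ring.
  by apply: cderive_eq; rewrite rmorph1; field.
move=> s s01; rewrite normcM exprS -mulrA mulrCA ler_pM//.
exact: cexp_taylor2.
Qed.

End RealVariable.

(** * Improper integrals of derivatives *)

Section ImproperFTC.
Variable R : realType.
Local Notation mu := (@lebesgue_measure R).
Implicit Types (f F : R -> R) (I : set R) (u v : R^nat).

Lemma integral_FTC_segment f F (a b : R) : a < b ->
  (forall x, x \in `[a, b] -> is_derive x (1 : R) F (f x)) ->
  (forall x, x \in `[a, b] -> {for x, continuous f}) ->
  (\int[mu]_(x in `[a, b]) (f x)%:E = (F b - F a)%:E)%E.
Proof.
move=> ab dF cf; rewrite (@continuous_FTC2 _ f F a b)//.
- by apply: continuous_in_subspaceT => x; rewrite inE => /cf.
- split.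
  + by move=> x /subset_itv_oo_cc /dF d; exact: ex_derive.
  + apply: cvg_at_right_filter; apply: continuous_is_derive (dF a _).
    by rewrite in_itv/= lexx ltW.
  + apply: cvg_at_left_filter; apply: continuous_is_derive (dF b _).
    by rewrite in_itv/= lexx ltW.
- by move=> x /subset_itv_oo_cc /dF d; rewrite derive1E derive_val.
Qed.

(** Improper integrals over intervals that may be open or unbounded are reached
    through such an exhaustion by compact intervals. *)
Definition exhausts I u v := [/\ measurable I, (forall n, u n < v n),
  (forall n, `[u n, v n]%classic `<=` I) &
  (forall x, I x -> \forall n \near \oo, u n <= x <= v n)].

Lemma exhausts_cvg I u v f : exhausts I u v -> forall x, I x ->
  (f \_ `[u n, v n]) x @[n --> \oo] --> f x.
Proof.
move=> [_ _ _ ex] x Ix; apply: cvg_near_cst; near=> n.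
rewrite patchE mem_set//= in_itv/=; near: n; exact: ex.
Unshelve. all: end_near. Qed.

Lemma exhausts_integral I u v f n : exhausts I u v ->
  (\int[mu]_(x in I) ((f \_ `[u n, v n]) x)%:E =
   \int[mu]_(x in `[u n, v n]) (f x)%:E)%E.
Proof.
move=> [_ _ uvI _]; rewrite -[in RHS](_ : I `&` `[u n, v n] = `[u n, v n]%classic).
  rewrite integral_mkcondr; apply: eq_integral => x _.
  by rewrite [RHS]patchE [in LHS]patchE; case: ifP.
by rewrite setIC; apply/setIidl/uvI.
Qed.

(** A nonnegative derivative of a bounded function is integrable: by Fatou, its
    integral is at most the bound [2 M] on the increments of the primitive. *)
Lemma ge0_integrable_exhausts f F I u v (M : R) : exhausts I u v ->
  (forall x, I x -> is_derive x (1 : R) F (f x)) ->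
  (forall x, I x -> {for x, continuous f}) ->
  measurable_fun I f ->
  (forall x, I x -> 0 <= f x) ->
  (forall x, I x -> `|F x| <= M) -> mu.-integrable I (EFin \o f).
Proof.
move=> e dF cf mf f0 FM; have [mI uv uvI ex] := e.
apply/integrableP; split; first exact/measurable_EFinP.
have -> : (\int[mu]_(x in I) `|(EFin \o f) x| = \int[mu]_(x in I) (limn_einf (fun n => ((f \_ `[u n, v n]) x)%:E)))%E.
  apply: eq_integral => x; rewrite inE => Ix /=.
  have H : ((f \_ `[u n, v n]) x)%:E @[n --> \oo] --> (f x)%:E.
    apply: cvg_EFin; first exact: nearW.
    exact: (exhausts_cvg e Ix).
  have [-> _] := cvg_limn_einf_sup H.
  by rewrite ger0_norm// f0.
apply: le_lt_trans.
  apply: fatou => //.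
  - move=> n; apply/measurable_EFinP; apply/measurable_restrict => //.
    by apply: measurable_funS mf => //; exact: subIsetl.
  - move=> n x Ix; rewrite lee_fin patchE; case: ifP => // _; exact: f0.
rewrite limn_einf_lim; apply: (@le_lt_trans _ _ (2 * M)%:E); last exact: ltry.
apply: lime_le; first exact: is_cvg_einfs.
apply: nearW => n.
apply: (@le_trans _ _ (\int[mu]_(x in I) ((f \_ `[u n, v n]) x)%:E)%E).
  by apply: ereal_inf_lbound; exists n => /=.
have S : (\int[mu]_(x in `[u n, v n]) (f x)%:E = (F (v n) - F (u n))%:E)%E.
  apply: integral_FTC_segment => // x xuv.
    by apply: dF; exact: (uvI n).
  by apply: cf; exact: (uvI n).
rewrite (exhausts_integral f n e) S.
rewrite lee_fin (le_trans (ler_norm _))// (le_trans (ler_normB _ _))//.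
  rewrite mulr_natl mulr2n lerD// FM//; apply: (uvI n); rewrite /= in_itv/= lexx ltW//.
Qed.

(** Dominated convergence, the integrable function dominating its own truncations. *)
Lemma cvg_integral_exhausts f I u v : exhausts I u v ->
  mu.-integrable I (EFin \o f) ->
  (\int[mu]_(x in `[u n, v n]) (f x)%:E)%E @[n --> \oo] -->
  (\int[mu]_(x in I) (f x)%:E)%E.
Proof.
move=> e intf; have [mI uv uvI ex] := e.
have /integrableP[/measurable_EFinP mf _] := intf.
have C : (\int[mu]_(x in I) ((f \_ `[u n, v n]) x)%:E)%E @[n --> \oo] -->
    (\int[mu]_(x in I) (f x)%:E)%E.
  apply: (@dominated_cvg _ _ _ mu I mI _ _ (fun x => `|f x|%:E)) => //.
  - move=> n; apply/measurable_EFinP; apply/measurable_restrict => //.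
    by apply: measurable_funS mf => //; exact: subIsetl.
  - move=> x Ix; apply: cvg_EFin; first exact: nearW.
    exact: (exhausts_cvg e Ix).
  - exact: integrable_norm intf.
  - move=> n x Ix; rewrite lee_fin patchE; case: ifP => // _.
    by rewrite normr0.
by under eq_fun do rewrite -(exhausts_integral f _ e).
Qed.

Lemma integral_FTC_exhausts f F I u v (l0 l1 : R) : exhausts I u v ->
  (forall x, I x -> is_derive x (1 : R) F (f x)) ->
  (forall x, I x -> {for x, continuous f}) ->
  mu.-integrable I (EFin \o f) ->
  F (u n) @[n --> \oo] --> l0 -> F (v n) @[n --> \oo] --> l1 ->
  \int[mu]_(x in I) f x = l1 - l0.
Proof.
move=> e dF cf intf Fl0 Fl1; have [mI uv uvI ex] := e.
have /integrableP[/measurable_EFinP mf _] := intf.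
have C := cvg_integral_exhausts e intf.
rewrite /Rintegral -(cvg_lim _ C)//.
suff -> : lim ((\int[mu]_(x in `[u n, v n]) (f x)%:E)%E @[n --> \oo]) = (l1 - l0)%:E by [].
apply/cvg_lim => //.
have S n : (\int[mu]_(x in `[u n, v n]) (f x)%:E = (F (v n) - F (u n))%:E)%E.
  apply: integral_FTC_segment => // x xuv.
    by apply: dF; exact: (uvI n).
  by apply: cf; exact: (uvI n).
under eq_fun do rewrite S.
by apply: cvg_EFin; [exact: nearW|exact: cvgB].
Qed.

End ImproperFTC.

Section HalfLine.
Variable R : realType.
Local Notation mu := (@lebesgue_measure R).
Implicit Types (f F : R -> R) (a b t x : R).

Let u (n : nat) : R := n.+2%:R^-1.
Let v (n : nat) : R := n.+2%:R.

Let u_gt0 n : 0 < u n. Proof. by rewrite invr_gt0. Qed.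
Let u_lt1 n : u n < 1. Proof. by rewrite invf_lt1// ltr1n. Qed.
Let v_gt1 n : 1 < v n. Proof. by rewrite ltr1n. Qed.
Let cvg_u : u n @[n --> \oo] --> (0 : R).
Proof.
have -> : u = (fun n => @harmonic R (n + 1)%N) by apply/funext => n; rewrite addn1.
by rewrite (cvg_shiftn 1 (@harmonic R)); exact: cvg_harmonic.
Qed.
Let cvg_v : v n @[n --> \oo] --> +oo.
Proof.
apply/cvgryPge => A; near=> n; rewrite /v (@le_trans _ _ n%:R)//; last first.
  by rewrite ler_nat -addn2 leq_addr.
by near: n; exact: nbhs_infty_ger.
Unshelve. all: end_near. Qed.
Let near_u x : 0 < x -> \forall n \near \oo, u n <= x.
Proof. by move=> x0; near do apply/ltW; apply: (cvgr_lt _ cvg_u).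
Unshelve. all: end_near. Qed.
Let near_v x : \forall n \near \oo, x <= v n.
Proof. by move/cvgryPge : cvg_v => /(_ x). Qed.

Lemma itv0y_gt0 t : `]0, +oo[%classic t -> 0 < t.
Proof. by rewrite /= in_itv/= andbT. Qed.

Lemma exhausts_0y : exhausts `]0, +oo[ u v.
Proof.
split => //.
- by move=> n; rewrite (lt_trans (u_lt1 _)).
- move=> n x /=; rewrite !in_itv/= andbT => /andP[ux _].
  exact: lt_le_trans ux.
- move=> x/=; rewrite in_itv/= andbT => x0.
  by near=> n; apply/andP; split; near: n; [exact: near_u|exact: near_v].
Unshelve. all: end_near. Qed.

Lemma exhausts_0y_scale (c : R) : 0 < c ->
  exhausts `]0, +oo[ (fun n => c * u n) (fun n => c * v n).
Proof.
move=> c0; split => //.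
- by move=> n; rewrite ltr_pM2l// (lt_trans (u_lt1 _)).
- move=> n x /=; rewrite !in_itv/= andbT => /andP[ux _].
  by apply: lt_le_trans ux; rewrite mulr_gt0.
- move=> x/=; rewrite in_itv/= andbT => x0.
  near=> n; apply/andP; split.
    by rewrite -ler_pdivlMl//; near: n; apply: near_u; rewrite mulr_gt0// invr_gt0.
  by rewrite -ler_pdivrMl//; near: n; exact: near_v.
Unshelve. all: end_near. Qed.

(** Substitution on the compact intervals of an exhaustion of the half line and
    on their dilates, which form another exhaustion. *)
Lemma integral_0y_scale f (c : R) : 0 < c ->
  (forall x, 0 < x -> {for x, continuous f}) ->
  mu.-integrable `]0, +oo[ (fun x => (f x)%:E) ->
  mu.-integrable `]0, +oo[ (fun x => (f (c * x))%:E) ->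
  \int[mu]_(x in `]0, +oo[) f x = c * \int[mu]_(x in `]0, +oo[) f (c * x).
Proof.
move=> c0 cf if1 if2.
have H1 := cvg_integral_exhausts (exhausts_0y_scale c0) if1.
have H2 := cvg_integral_exhausts exhausts_0y if2.
have dM x : is_derive x (1 : R) (fun y => c * y) c.
  by apply: (is_derive_eq (is_deriveZ c (@is_derive_id R R x 1))); exact: mulr1.
have dE : derive1 (fun y : R => c * y) = cst c.
  by apply/funext => x; rewrite derive1E; apply: derive_val.
have S n : (\int[mu]_(x in `[(c * u n)%R, (c * v n)%R]) (f x)%:E =
    c%:E * \int[mu]_(x in `[u n, v n]) (f (c * x))%:E)%E.
  have uvn : u n < v n by rewrite (lt_trans (u_lt1 _)).
  rewrite (@integration_by_substitution_increasing _ (fun y => c * y))//; first last.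
  - apply: continuous_in_subspaceT => x; rewrite inE/= in_itv/= => /andP[ux _].
    by apply: cf; apply: lt_le_trans ux; rewrite mulr_gt0.
  - split.
    + by move=> x _; have D := dM x; exact: ex_derive.
    + by apply: cvg_at_right_filter; apply: continuous_is_derive (dM _).
    + by apply: cvg_at_left_filter; apply: continuous_is_derive (dM _).
  - by rewrite dE; exact: is_cvg_cst.
  - by rewrite dE; exact: is_cvg_cst.
  - by rewrite dE => x _; exact: cst_continuous.
  - by move=> x y _ _ xy; rewrite ltr_pM2l.
  - exact: ltW.
  rewrite dE -integralZl//.
    by apply: eq_integral => x _; rewrite -EFinM mulrC.
  apply: integrableS if2 => // x /=; rewrite !in_itv/= andbT => /andP[ux _].
  exact: lt_le_trans ux.
rewrite /Rintegral -(cvg_lim _ H1)//.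
rewrite (_ : lim _ = (c%:E * \int[mu]_(x in `]0%R, +oo[) (f (c * x))%:E)%E).
  by rewrite fineM//; exact: integrable_fin_num.
apply/cvg_lim => //; under eq_fun do rewrite S.
by apply: cvgeZl.
Qed.

Lemma exhausts_01 : exhausts `]0, 1] u (fun=> 1).
Proof.
split => //.
- move=> n x /=; rewrite !in_itv/= => /andP[ux ->].
  by rewrite andbT; exact: lt_le_trans ux.
- move=> x/=; rewrite in_itv/= => /andP[x0 x1].
  by near=> n; apply/andP; split => //; near: n; exact: near_u.
Unshelve. all: end_near. Qed.

Lemma exhausts_1y : exhausts `[1, +oo[ (fun=> 1) v.
Proof.
split => //.
- by move=> n x /=; rewrite !in_itv/= => /andP[-> _].
- move=> x/=; rewrite in_itv/= andbT => x1.
  by near=> n; apply/andP; split => //; near: n; exact: near_v.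
Unshelve. all: end_near. Qed.

Lemma integral_FTC_0y f F (l0 l1 : R) :
  (forall x, 0 < x -> is_derive x (1 : R) F (f x)) ->
  (forall x, 0 < x -> {for x, continuous f}) ->
  mu.-integrable `]0, +oo[ (EFin \o f) ->
  F x @[x --> 0^'+] --> l0 -> F x @[x --> +oo] --> l1 ->
  \int[mu]_(x in `]0, +oo[) f x = l1 - l0.
Proof.
move=> dF cf intf F0 F1; apply: (integral_FTC_exhausts exhausts_0y (F := F)) => //.
- by move=> x /=; rewrite in_itv/= andbT; exact: dF.
- by move=> x /=; rewrite in_itv/= andbT; exact: cf.
- by move/cvg_at_rightP : F0; apply; split => // n; exact: u_gt0.
- exact: (cvg_comp _ _ cvg_v F1).
Qed.

Lemma integral_FTC_01 f F (l0 : R) :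
  (forall x, 0 < x -> is_derive x (1 : R) F (f x)) ->
  (forall x, 0 < x -> {for x, continuous f}) ->
  mu.-integrable `]0, 1] (EFin \o f) ->
  F x @[x --> 0^'+] --> l0 ->
  \int[mu]_(x in `]0, 1]) f x = F 1 - l0.
Proof.
move=> dF cf intf F0; apply: (integral_FTC_exhausts exhausts_01 (F := F)) => //.
- by move=> x /=; rewrite in_itv/= => /andP[+ _]; exact: dF.
- by move=> x /=; rewrite in_itv/= => /andP[+ _]; exact: cf.
- by move/cvg_at_rightP : F0; apply; split => // n; exact: u_gt0.
- exact: cvg_cst.
Qed.

Lemma continuous_powR_gt0 a t : 0 < t -> {for t, continuous (fun x : R => x `^ a)}.
Proof. by move=> t0; exact: continuous_is_derive (is_derive1_powR a t0). Qed.

Lemma is_derive_powR_primitive a t : a != -1 -> 0 < t ->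
  is_derive t (1 : R) (fun x => x `^ (a + 1) / (a + 1)) (t `^ a).
Proof.
move=> a1 t0; have a10 : a + 1 != 0 by rewrite addr_eq0.
have D := is_derive_mulE (is_derive1_powR (a + 1) t0) (is_derive_cst (a + 1)^-1 t 1).
by apply: (is_derive_eq D); rewrite mulr0 add0r addrK /cst; field.
Qed.

Lemma integrable_powR_01 a : -1 < a -> mu.-integrable `]0, 1] (fun t => (t `^ a)%:E).
Proof.
move=> a1; have a10 : 0 < a + 1 by rewrite -ltrBlDr sub0r.
apply: (ge0_integrable_exhausts (F := fun x => x `^ (a + 1) / (a + 1))
    (M := (a + 1)^-1) exhausts_01).
- move=> x /=; rewrite in_itv/= => /andP[x0 _].
  by apply: is_derive_powR_primitive => //; rewrite gt_eqF.
- by move=> x /=; rewrite in_itv/= => /andP[+ _]; exact: continuous_powR_gt0.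
- exact: measurable_funTS.
- by move=> x _; exact: powR_ge0.
- move=> x /=; rewrite in_itv/= => /andP[x0 x1].
  rewrite ger0_norm; last by rewrite divr_ge0 ?powR_ge0 ?ltW.
  rewrite ler_piMl//; first by rewrite invr_ge0 ltW.
  by rewrite -[leRHS](powRr0 x); apply: ger_powR; [rewrite x0|exact: ltW].
Qed.

Lemma integrable_powR_1y b : b < -1 -> mu.-integrable `[1, +oo[ (fun t => (t `^ b)%:E).
Proof.
move=> b1; have b10 : b + 1 < 0 by rewrite -ltrBrDr sub0r.
apply: (ge0_integrable_exhausts (F := fun x => x `^ (b + 1) / (b + 1))
    (M := `|(b + 1)^-1|) exhausts_1y).
- move=> x /=; rewrite in_itv/= andbT => x1.
  by apply: is_derive_powR_primitive; [rewrite lt_eqF|exact: lt_le_trans x1].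
- move=> x /=; rewrite in_itv/= andbT => x1.
  by apply: continuous_powR_gt0; exact: lt_le_trans x1.
- exact: measurable_funTS.
- by move=> x _; exact: powR_ge0.
- move=> x /=; rewrite in_itv/= andbT => x1.
  rewrite normrM ger0_norm ?powR_ge0// ler_piMl//.
  by rewrite -[leRHS](powRr0 x) ler_powR// ltW.
Qed.

(** Majorants on the half line are taken of this form: [a] is the exponent at 0
    and [b] the one at infinity, and [-1 < a], [b < -1] make it integrable. *)
Definition weight a b t : R := if t <= 1 then t `^ a else t `^ b.

Lemma measurable_weight a b : measurable_fun setT (weight a b).
Proof.
apply: measurable_fun_ifT; [|exact: measurable_powR|exact: measurable_powR].
by apply: measurable_fun_ler.
Qed.

Lemma itv0y_split : `]0%R, +oo[%classic = `]0, 1] `|` `]1, +oo[ :> set R.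
Proof.
by rewrite -itv_bndbnd_setU//= bnd_simp.
Qed.

Lemma integrable_weight a b : -1 < a -> b < -1 ->
  mu.-integrable `]0, +oo[ (EFin \o weight a b).
Proof.
move=> a1 b1; rewrite itv0y_split.
have mw D : measurable_fun D (EFin \o weight a b).
  by apply/measurable_EFinP; apply: measurable_funTS; exact: measurable_weight.
apply/integrableP; split; first exact: mw.
rewrite ge0_integral_setU//=; last 2 first.
  apply/measurable_EFinP; apply: measurableT_comp => //.
  by apply: measurable_funTS; exact: measurable_weight.
  rewrite disj_set2E; apply/eqP/seteqP; split => // x [] /=; rewrite !in_itv/= andbT.
  by move=> /andP[_ x1]; rewrite ltNge x1.
apply: lte_add_pinfty.
  have /integrableP[_] := integrable_powR_01 a1; apply: le_lt_trans.
  rewrite le_eqVlt; apply/orP; left; apply/eqP/eq_integral => x.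
  by rewrite inE/= in_itv/= => /andP[x0 x1]; rewrite /weight x1.
have I : mu.-integrable `]1, +oo[ (fun t : R => (t `^ b)%:E).
  apply: integrableS (integrable_powR_1y b1) => // x /=.
  by rewrite !in_itv/= !andbT => /ltW.
have /integrableP[_] := I; apply: le_lt_trans.
rewrite le_eqVlt; apply/orP; left; apply/eqP/eq_integral => x.
by rewrite inE/= in_itv/= andbT => x1; rewrite /weight leNgt x1.
Qed.

End HalfLine.

(** * Integrals of complex-valued functions *)

Section ComplexIntegral.
Context d (T : measurableType d) (R : realType).
Variable mu : {measure set T -> \bar R}.
Implicit Types (D : set T) (F G : T -> R[i]) (f g : T -> R) (c : R[i]).

Definition cmeas D F :=
  measurable_fun D (fun x => Re (F x)) /\ measurable_fun D (fun x => Im (F x)).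

Lemma cmeas_real D f : measurable_fun D f -> cmeas D (fun x => (f x)%:C).
Proof. by split => //; exact: measurable_cst. Qed.

Lemma cmeasM D F G : cmeas D F -> cmeas D G -> cmeas D (fun x => F x * G x).
Proof.
move=> [F1 F2] [G1 G2]; split.
  under eq_fun do rewrite Re_mul.
  by apply: measurable_funB; exact: measurable_funM.
under eq_fun do rewrite Im_mul.
by apply: measurable_funD; exact: measurable_funM.
Qed.

Lemma cmeasB D F G : cmeas D F -> cmeas D G -> cmeas D (fun x => F x - G x).
Proof.
move=> [F1 F2] [G1 G2]; split.
  by under eq_fun do rewrite Re_sub; exact: measurable_funB.
by under eq_fun do rewrite Im_sub; exact: measurable_funB.
Qed.

Lemma cmeas_cst D c : cmeas D (fun=> c).
Proof. by split; exact: measurable_cst. Qed.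

Lemma cmeas_cpow (f : T -> R) D z : measurable_fun D f ->
  cmeas D (fun x => cpow (f x) z).
Proof.
move=> mf; have ml : measurable_fun D (fun x => ln (f x)).
  by apply: measurableT_comp mf; exact: measurable_ln.
have mm (k : R) : measurable_fun D (fun x => k * ln (f x)).
  by apply: measurable_funM => //; exact: measurable_cst.
split.
  under eq_fun do rewrite Re_cpow.
  apply: measurable_funM.
    by apply: measurableT_comp (mm _); exact: measurable_expR.
  apply: measurableT_comp (mm _).
  by apply: continuous_measurable_fun; exact: continuous_cos.
under eq_fun do rewrite Im_cpow.
apply: measurable_funM.
  by apply: measurableT_comp (mm _); exact: measurable_expR.
apply: measurableT_comp (mm _).
by apply: continuous_measurable_fun; exact: continuous_sin.
Qed.

Definition cintegrable D F :=
  mu.-integrable D (fun x => (Re (F x))%:E) /\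
  mu.-integrable D (fun x => (Im (F x))%:E).

Definition cint D F : R[i] :=
  (\int[mu]_(x in D) Re (F x)) +i* (\int[mu]_(x in D) Im (F x)).

Lemma integrable_le D f g : measurable D -> measurable_fun D f ->
  mu.-integrable D (fun x => (g x)%:E) -> (forall x, D x -> `|f x| <= g x) ->
  mu.-integrable D (fun x => (f x)%:E).
Proof.
move=> mD mf ig fg; apply: le_integrable ig => //.
  exact/measurable_EFinP.
by move=> x Dx /=; rewrite lee_fin (le_trans (fg _ Dx))// ler_norm.
Qed.

Lemma cintegrable_le D F g : measurable D -> cmeas D F ->
  mu.-integrable D (fun x => (g x)%:E) ->
  (forall x, D x -> normc (F x) <= g x) -> cintegrable D F.
Proof.
move=> mD [F1 F2] ig Fg; split; apply: integrable_le ig _ => // x Dx.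
  by rewrite (le_trans (Re_le_normc _))// Fg.
by rewrite (le_trans (Im_le_normc _))// Fg.
Qed.

Lemma eq_cint D F G : (forall x, D x -> F x = G x) -> cint D F = cint D G.
Proof.
by move=> FG; congr Complex; apply: eq_Rintegral => x; rewrite inE => /FG ->.
Qed.

Lemma eq_cintegrable D F G : measurable D -> (forall x, D x -> F x = G x) ->
  cintegrable D F -> cintegrable D G.
Proof.
move=> mD FG [F1 F2]; split.
  by apply: eq_integrable F1 => // x /set_mem /FG ->.
by apply: eq_integrable F2 => // x /set_mem /FG ->.
Qed.

Lemma normc_cint_le D F g : measurable D -> cintegrable D F ->
  mu.-integrable D (fun x => (g x)%:E) ->
  (forall x, D x -> normc (F x) <= g x) ->
  normc (cint D F) <= 2 * \int[mu]_(x in D) g x.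
Proof.
move=> mD [F1 F2] ig Fg; apply: normc_le2.
  rewrite (le_trans (le_normr_Rintegral mD F1))//; apply: le_Rintegral => //.
    exact: integrable_norm F1.
  by move=> x Dx; rewrite (le_trans (Re_le_normc _))// Fg.
rewrite (le_trans (le_normr_Rintegral mD F2))//; apply: le_Rintegral => //.
  exact: integrable_norm F2.
by move=> x Dx; rewrite (le_trans (Im_le_normc _))// Fg.
Qed.

Lemma cintegrableD D F G : measurable D -> cintegrable D F -> cintegrable D G ->
  cintegrable D (fun x => F x + G x).
Proof.
move=> mD [F1 F2] [G1 G2]; split.
  by under eq_fun do rewrite Re_add EFinD; exact: integrableD.
by under eq_fun do rewrite Im_add EFinD; exact: integrableD.
Qed.

Lemma cintD D F G : measurable D -> cintegrable D F -> cintegrable D G ->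
  cint D (fun x => F x + G x) = cint D F + cint D G.
Proof.
move=> mD [F1 F2] [G1 G2]; rewrite /cint; congr Complex.
  by under eq_Rintegral do rewrite Re_add; exact: RintegralD.
by under eq_Rintegral do rewrite Im_add; exact: RintegralD.
Qed.

Lemma integrable_scale D f (k : R) : measurable D -> mu.-integrable D (fun x => (f x)%:E) ->
  mu.-integrable D (fun x => (k * f x)%:E).
Proof. by move=> mD fi; under eq_fun do rewrite EFinM; exact: integrableZl. Qed.

Lemma integrable_add D f g : measurable D ->
  mu.-integrable D (fun x => (f x)%:E) -> mu.-integrable D (fun x => (g x)%:E) ->
  mu.-integrable D (fun x => (f x + g x)%:E).
Proof. by move=> mD fi gi; under eq_fun do rewrite EFinD; exact: integrableD. Qed.

Lemma cintegrableZ D c F : measurable D -> cintegrable D F ->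
  cintegrable D (fun x => c * F x).
Proof.
move=> mD [F1 F2]; split.
  under eq_fun do rewrite Re_mul EFinB.
  by apply: integrableB => //; exact: integrable_scale.
under eq_fun do rewrite Im_mul EFinD.
by apply: integrableD => //; exact: integrable_scale.
Qed.

Lemma cintZ D c F : measurable D -> cintegrable D F ->
  cint D (fun x => c * F x) = c * cint D F.
Proof.
move=> mD [F1 F2]; rewrite [c in RHS](_ : c = Re c +i* Im c); last by case: (c).
rewrite /cint; congr Complex.
  under eq_Rintegral do rewrite Re_mul.
  by rewrite RintegralB ?RintegralZl//; exact: integrable_scale.
under eq_Rintegral do rewrite Im_mul.
by rewrite RintegralD ?RintegralZl//; exact: integrable_scale.
Qed.

Lemma cintegrableN D F : measurable D -> cintegrable D F ->
  cintegrable D (fun x => - F x).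
Proof.
move=> mD Fi; rewrite (_ : (fun x => _) = (fun x => -1 * F x)).
  exact: cintegrableZ.
by apply/funext => x; rewrite mulN1r.
Qed.

Lemma cintegrableB D F G : measurable D -> cintegrable D F -> cintegrable D G ->
  cintegrable D (fun x => F x - G x).
Proof. by move=> mD Fi Gi; apply: cintegrableD => //; exact: cintegrableN. Qed.

Lemma cintB D F G : measurable D -> cintegrable D F -> cintegrable D G ->
  cint D (fun x => F x - G x) = cint D F - cint D G.
Proof.
move=> mD Fi Gi; rewrite cintD//; last exact: cintegrableN.
congr (_ + _); rewrite -mulN1r -cintZ//; apply: eq_cint => x _.
by rewrite mulN1r.
Qed.

Lemma cintegrable_real D f : mu.-integrable D (fun x => (f x)%:E) ->
  cintegrable D (fun x => (f x)%:C).
Proof. by split => //; exact: integrable0. Qed.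

Lemma cint_real D f : cint D (fun x => (f x)%:C) = (\int[mu]_(x in D) f x)%:C.
Proof.
congr Complex; rewrite /Rintegral.
by rewrite (_ : (fun x => (Im (f x)%:C)%:E) = cst 0%E) ?integral0.
Qed.

Lemma cint_setU D E F : measurable D -> measurable E ->
  cintegrable (D `|` E) F -> [disjoint D & E] ->
  cint (D `|` E) F = cint D F + cint E F.
Proof.
move=> mD mE [F1 F2] DE; rewrite /cint !Rintegral_setU//.
Qed.

End ComplexIntegral.

Section DifferentiationUnderIntegral.
Context d (T : measurableType d) (R : realType).
Variable mu : {measure set T -> \bar R}.

(** A domination of the derivative that is uniform in the parameter suffices for
    all the integrals and series below. *)
Lemma is_derive_under_integral (D : set T) (f df : R -> T -> R) (g : T -> R) (s : R) :
  measurable D ->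
  (forall x, mu.-integrable D (fun y => (f x y)%:E)) ->
  (forall x y, D y -> is_derive x (1 : R) (f ^~ y) (df x y)) ->
  mu.-integrable D (fun y => (g y)%:E) ->
  (forall x y, D y -> `|df x y| <= g y) ->
  is_derive s (1 : R) (fun x => \int[mu]_(y in D) f x y)
    (\int[mu]_(y in D) df s y).
Proof.
move=> mD fi fd gi dfg.
have Is : s \in (`]s - 1, s + 1[ : interval R).
  by rewrite in_itv/= ltrDl ltrBlDr ltrDl ltr01.
have d1E x y : D y -> partial1of2 f x y = df x y.
  by move=> Dy; rewrite partial1of2E; have H := fd x y Dy; exact: derive_val.
have fd' (x : R) y : (x \in `]s - 1, s + 1[) -> D y -> derivable (f ^~ y) x 1.
  by move=> _ Dy; have H := fd x y Dy; exact: ex_derive.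
have G0 y : 0 <= `|g y| by [].
have Gi : mu.-integrable D (EFin \o (fun y => `|g y|)).
  exact: (integrable_norm (f := g)).
have Gub (x : R) y : (x \in `]s - 1, s + 1[) -> D y -> `|partial1of2 f x y| <= `|g y|.
  by move=> _ Dy; rewrite d1E// (le_trans (dfg _ _ Dy))// ler_norm.
apply: DeriveDef.
  exact: (@derivable_under_integral R _ T mu f D mD s (s - 1) (s + 1) Is (fun x _ => fi x) fd' _ G0 Gi Gub).
rewrite -derive1E.
rewrite (@differentiation_under_integral R _ T mu f D mD s (s - 1) (s + 1) Is (fun x _ => fi x) fd' _ G0 Gi Gub).
by apply: eq_Rintegral => y; rewrite inE => Dy; rewrite d1E.
Qed.

End DifferentiationUnderIntegral.

Section RealFubini.
Context d1 d2 (X : measurableType d1) (Y : measurableType d2) (R : realType).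
Variable m1 : {sigma_finite_measure set X -> \bar R}.
Variable m2 : {sigma_finite_measure set Y -> \bar R}.

(** A product majorant gives the absolute convergence on the product space at once. *)
Lemma Rintegral_Fubini (D : set X) (E : set Y) (K : X -> Y -> R)
    (g : X -> R) (h : Y -> R) : measurable D -> measurable E ->
  measurable_fun setT (fun p : X * Y => K p.1 p.2) ->
  m1.-integrable D (fun x => (g x)%:E) -> m2.-integrable E (fun y => (h y)%:E) ->
  (forall x y, D x -> E y -> `|K x y| <= g x * h y) ->
  \int[m1]_(x in D) \int[m2]_(y in E) K x y =
  \int[m2]_(y in E) \int[m1]_(x in D) K x y.
Proof.
move=> mD mE mK ig ih Kgh.
pose f (p : X * Y) : R := (\1_D p.1 * \1_E p.2) * K p.1 p.2.
have mf : measurable_fun setT (EFin \o f).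
  apply/measurable_EFinP; apply: measurable_funM => //; apply: measurable_funM.
    exact: (measurableT_comp (measurable_indic mD) measurable_fst).
  exact: (measurableT_comp (measurable_indic mE) measurable_snd).
have mKx x : measurable_fun setT (K x).
  exact: (measurableT_comp mK (measurable_pair1 x)).
have mKy y : measurable_fun setT (K ^~ y).
  exact: (measurableT_comp mK (measurable_pair2 y)).
have iKx x : D x -> m2.-integrable E (fun y => (K x y)%:E).
  move=> Dx; apply: (integrable_le (g := fun y => g x * h y)) => //.
  - exact: measurable_funTS.
  - by under eq_fun do rewrite EFinM; exact: integrableZl.
  - by move=> y; exact: Kgh.
have iKy y : E y -> m1.-integrable D (fun x => (K x y)%:E).
  move=> Ey; apply: (integrable_le (g := fun x => h y * g x)) => //.
  - exact: measurable_funTS.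
  - by under eq_fun do rewrite EFinM; exact: integrableZl.
  - by move=> x Dx; rewrite mulrC; exact: Kgh.
have innerx x : (\int[m2]_y (f (x, y))%:E =
    (((fun x => \int[m2]_(y in E) K x y) \_ D) x)%:E)%E.
  rewrite patchE; case: ifPn => xD; last first.
    by apply: integral0_eq => y _; rewrite /f indicE (negbTE xD) !mul0r.
  have Dx : D x by move: xD; rewrite inE.
  rewrite /Rintegral fineK; last exact/integrable_fin_num/iKx.
  rewrite [RHS]integral_mkcond; apply: eq_integral => y _.
  by rewrite /f patchE /= !indicE xD mul1r; case: ifP; rewrite ?mul1r ?mul0r.
have innery y : (\int[m1]_x (f (x, y))%:E =
    (((fun y => \int[m1]_(x in D) K x y) \_ E) y)%:E)%E.
  rewrite patchE; case: ifPn => yE; last first.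
    by apply: integral0_eq => x _; rewrite /f /= [\1_E _]indicE (negbTE yE) mulr0 mul0r.
  have Ey : E y by move: yE; rewrite inE.
  rewrite /Rintegral fineK; last exact/integrable_fin_num/iKy.
  rewrite [RHS]integral_mkcond; apply: eq_integral => x _.
  by rewrite /f patchE /= !indicE yE mulr1; case: ifP; rewrite ?mul1r ?mul0r.
have H := Fubini (m1 := m1) (m2 := m2) (f := EFin \o f).
rewrite (Rintegral_mkcond m1 D) (Rintegral_mkcond m2 E) /Rintegral; congr fine.
transitivity (\int[m1]_x \int[m2]_y (f (x, y))%:E)%E.
  by apply: eq_integral => x _; rewrite innerx.
rewrite H; first by apply: eq_integral => x _; rewrite innery.
apply/(integrable12ltyP _ _ mf).
pose G x : R := `|g x| * \1_D x; pose H' y : R := `|h y| * \1_E y.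
have GE : (fun x => (G x)%:E) = ((fun x => `|g x|%:E) \_ D)%E.
  by apply/funext => x; rewrite patchE /G indicE; case: ifP; rewrite ?mulr1 ?mulr0.
have HE : (fun y => (H' y)%:E) = ((fun y => `|h y|%:E) \_ E)%E.
  by apply/funext => x; rewrite patchE /H' indicE; case: ifP; rewrite ?mulr1 ?mulr0.
have iG : m1.-integrable setT (fun x => (G x)%:E).
  by rewrite GE; apply/(integrable_mkcond _ mD).1; exact: (integrable_norm (f := g)).
have iH : m2.-integrable setT (fun y => (H' y)%:E).
  by rewrite HE; apply/(integrable_mkcond _ mE).1; exact: (integrable_norm (f := h)).
have fGH x y : `|f (x, y)| <= G x * H' y.
  rewrite /f /G /H' /= !indicE.
  have [xD|] := boolP (x \in D); last by rewrite mulr0 !mul0r normr0.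
  have [yE|] := boolP (y \in E); last by rewrite !mulr0 mul0r normr0.
  by rewrite !mul1r !mulr1 -normrM (le_trans (Kgh _ _ (set_mem xD) (set_mem yE)))// ler_norm.
apply: (@le_lt_trans _ _ (\int[m1]_x ((\int[m2]_y H' y)%:E * (G x)%:E))%E).
  apply: ge0_le_integral => //.
  - by move=> x _; exact: integral_ge0.
  - apply: (measurable_fun_fubini_tonelli_F (abse \o (EFin \o f))) => //=.
    exact: measurableT_comp.
  - by apply: measurable_funeM; exact: (measurable_int m1 iG).
  move=> x _; rewrite muleC /Rintegral fineK; last exact: integrable_fin_num.
  rewrite -integralZl//; apply: ge0_le_integral => //.
  - apply: measurableT_comp => //.
    exact: (measurableT_comp mf (measurable_pair1 x)).
  - by apply: measurable_funeM; exact: (measurable_int m2 iH).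
  - by move=> y _; rewrite lee_fin.
rewrite integralZl//.
by rewrite lte_mul_pinfty// ?lee_fin ?Rintegral_ge0// => [y _|]; [rewrite mulr_ge0|exact: integrable_lty].
Qed.

Lemma cint_Fubini (D : set X) (E : set Y) (K : X -> Y -> R[i])
    (g : X -> R) (h : Y -> R) : measurable D -> measurable E ->
  cmeas setT (fun p : X * Y => K p.1 p.2) ->
  m1.-integrable D (fun x => (g x)%:E) -> m2.-integrable E (fun y => (h y)%:E) ->
  (forall x y, D x -> E y -> normc (K x y) <= g x * h y) ->
  cint m1 D (fun x => cint m2 E (K x)) =
  cint m2 E (fun y => cint m1 D (K ^~ y)).
Proof.
move=> mD mE [K1 K2] ig ih Kgh; congr Complex.
  apply: (Rintegral_Fubini (K := fun x y => Re (K x y))) ig ih _ => // x y Dx Ey.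
  by rewrite (le_trans (Re_le_normc _))// Kgh.
apply: (Rintegral_Fubini (K := fun x y => Im (K x y))) ig ih _ => // x y Dx Ey.
by rewrite (le_trans (Im_le_normc _))// Kgh.
Qed.

End RealFubini.

(** * The Gamma integral *)

Section HalfLineComplex.
Variable R : realType.
Local Notation mu := (@lebesgue_measure R).
Local Notation cint := (cint (@lebesgue_measure R)).
Local Notation cintegrable := (cintegrable (@lebesgue_measure R)).
Implicit Types (F f : R -> R[i]) (t x : R) (z a : R[i]).

Lemma normc_cpowR t z : 0 < t -> normc (cpow t z) = t `^ Re z.
Proof. by move=> t0; rewrite normc_cpow /powR gt_eqF. Qed.

Lemma Re_cvg0 {T : Type} {B : set_system T} {FB : ProperFilter B} (f : T -> R[i]) :
  normc (f x) @[x --> B] --> (0 : R) -> Re (f x) @[x --> B] --> (0 : R).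
Proof.
move=> f0; apply: norm_cvg0; apply: (squeeze_cvgr _ (cvg_cst 0) f0).
by apply: nearW => x; rewrite normr_ge0 Re_le_normc.
Qed.

Lemma Im_cvg0 {T : Type} {B : set_system T} {FB : ProperFilter B} (f : T -> R[i]) :
  normc (f x) @[x --> B] --> (0 : R) -> Im (f x) @[x --> B] --> (0 : R).
Proof.
move=> f0; apply: norm_cvg0; apply: (squeeze_cvgr _ (cvg_cst 0) f0).
by apply: nearW => x; rewrite normr_ge0 Im_le_normc.
Qed.

Lemma continuous_cderive F t a : cderive F t a ->
  {for t, continuous (fun x => Re (F x))} /\ {for t, continuous (fun x => Im (F x))}.
Proof. by move=> [/continuous_is_derive ? /continuous_is_derive]. Qed.

Lemma cint_FTC_0y F f :
  (forall x, 0 < x -> cderive F x (f x)) ->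
  (forall x, 0 < x -> exists d, cderive f x d) ->
  cintegrable `]0, +oo[ f ->
  normc (F x) @[x --> 0^'+] --> (0 : R) -> normc (F x) @[x --> +oo] --> (0 : R) ->
  cint `]0, +oo[ f = 0.
Proof.
move=> dF cf [f1 f2] F0 Fy; apply: complex_ext => /=.
- rewrite -[RHS](subrr 0); apply: (integral_FTC_0y (F := fun x => Re (F x))) => //.
  + by move=> x /dF[].
  + by move=> x /cf[d /continuous_cderive[]].
  + exact: Re_cvg0.
  + exact: Re_cvg0.
- rewrite -[RHS](subrr 0); apply: (integral_FTC_0y (F := fun x => Im (F x))) => //.
  + by move=> x /dF[].
  + by move=> x /cf[d /continuous_cderive[]].
  + exact: Im_cvg0.
  + exact: Im_cvg0.
Qed.

Lemma cint_FTC_01 F f :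
  (forall x, 0 < x -> cderive F x (f x)) ->
  (forall x, 0 < x -> exists d, cderive f x d) ->
  cintegrable `]0, 1] f ->
  normc (F x) @[x --> 0^'+] --> (0 : R) ->
  cint `]0, 1] f = F 1.
Proof.
move=> dF cf [f1 f2] F0; apply: complex_ext => /=.
- rewrite -[RHS]subr0; apply: (integral_FTC_01 (F := fun x => Re (F x))) => //.
  + by move=> x /dF[].
  + by move=> x /cf[d /continuous_cderive[]].
  + exact: Re_cvg0.
- rewrite -[RHS]subr0; apply: (integral_FTC_01 (F := fun x => Im (F x))) => //.
  + by move=> x /dF[].
  + by move=> x /cf[d /continuous_cderive[]].
  + exact: Im_cvg0.
Qed.

Lemma cvg0_at0 (g : R -> R) (C s : R) : 0 < s ->
  (forall t, 0 < t <= 1 -> 0 <= g t <= C * t `^ s) -> g t @[t --> 0^'+] --> (0 : R).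
Proof.
move=> s0 gC.
have H : C * t `^ s @[t --> 0^'+] --> (0 : R).
  by rewrite -[X in _ --> X](mulr0 C); apply: cvgMr => //; exact: powR_cvg0.
apply: (squeeze_cvgr _ (cvg_cst 0) H); near=> t; apply: gC; apply/andP; split.
  by near: t; exact: nbhs_right_gt.
by near: t; apply: nbhs_right_le.
Unshelve. all: end_near. Qed.

Lemma cvg_powR_neg s : s < 0 -> t `^ s @[t --> +oo] --> (0 : R).
Proof.
move=> s0; apply/cvgr0Pnorm_le => e e0; near=> t.
have t0 : 0 < t by near: t; exact: nbhs_pinfty_gt.
rewrite ger0_norm ?powR_ge0//.
rewrite -[s]opprK powRN invf_ple ?posrE ?powR_gt0//.
have -> : e^-1 = (e^-1 `^ (- s)^-1) `^ (- s).
  by rewrite -powRrM mulVf ?powRr1 ?invr_ge0 ?(ltW e0)// oppr_eq0 lt_eqF.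
rewrite ge0_ler_powR ?nnegrE ?powR_ge0 ?oppr_ge0 ?(ltW s0) ?(ltW t0)//.
Unshelve. all: end_near. Qed.

Lemma cvg0_aty (g : R -> R) (C s : R) : s < 0 ->
  (forall t, 1 < t -> 0 <= g t <= C * t `^ s) -> g t @[t --> +oo] --> (0 : R).
Proof.
move=> s0 gC.
have H : C * t `^ s @[t --> +oo] --> (0 : R).
  by rewrite -[X in _ --> X](mulr0 C); apply: cvgMr => //; exact: cvg_powR_neg.
apply: (squeeze_cvgr _ (cvg_cst 0) H); near=> t; apply: gC.
by near: t; exact: nbhs_pinfty_gt.
Unshelve. all: end_near. Qed.

End HalfLineComplex.

Section GammaFunction.
Variable R : realType.
Local Notation mu := (@lebesgue_measure R).
Local Notation cint := (cint (@lebesgue_measure R)).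
Local Notation cintegrable := (cintegrable (@lebesgue_measure R)).
Implicit Types (F f : R -> R[i]) (t x : R) (z a : R[i]).

(** Bound [exp t] from below by one term of its series, of order at least [x + 2]. *)
Lemma powR_expRN_le (x : R) : exists2 C : R, 0 <= C &
  forall t, 1 < t -> t `^ x * expR (- t) <= C * t `^ (-2).
Proof.
pose n := Num.truncn (`|x| + 2); exists n.+1`!%:R => // t t1.
have t0 : 0 < t by exact: lt_trans t1.
have -> : x = (x + 2) + (-2) by ring.
rewrite powRD; last by rewrite (gt_eqF t0) implybT.
rewrite mulrAC ler_wpM2r ?powR_ge0//.
have xn : x + 2 <= n.+1%:R.
  rewrite (@le_trans _ _ (`|x| + 2))//; first by rewrite lerD2r ler_norm.
  by rewrite ltW// truncnS_gt// addr_ge0.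
rewrite (@le_trans _ _ (t `^ n.+1%:R * expR (- t)))//.
  by rewrite ler_wpM2r ?expR_ge0// ler_powR// ltW.
rewrite (powR_mulrn _ (ltW t0)) expRN ler_pdivrMr ?expR_gt0//.
have := expR_ge1Dxn n (ltW t0).
have f0 : 0 < n.+1`!%:R :> R by rewrite ltr0n fact_gt0.
move=> H; rewrite -ler_pdivrMl//; apply: le_trans H.
by rewrite mulrC lerDr.
Qed.

Lemma expRN_weight (x : R) : exists2 C : R, 0 <= C &
  forall t, 0 < t -> t `^ x * expR (- t) <= C * weight x (-2) t.
Proof.
have [C C0 HC] := powR_expRN_le x.
exists (C + 1); first by rewrite addr_ge0.
move=> t t0; rewrite /weight; case: ifPn => t1.
  rewrite mulrC ler_wpM2r ?powR_ge0// -[leLHS]add0r lerD//.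
  by rewrite -expR0 ler_expR oppr_le0 ltW.
rewrite -ltNge in t1.
by rewrite (le_trans (HC _ t1))// ler_wpM2r ?powR_ge0// lerDl.
Qed.

Lemma cmeas_Gamma_integrand a D : cmeas D (@Gamma_integrand R a).
Proof.
rewrite /Gamma_integrand; apply: cmeasM; first exact: cmeas_cpow.
apply: cmeas_real; apply: measurable_funTS; apply: measurableT_comp => //.
Qed.

Lemma normc_Gamma_integrand a t : 0 < t ->
  normc (Gamma_integrand a t) = t `^ (Re a - 1) * expR (- t).
Proof.
move=> t0; rewrite normcM normc_cpowR// normc_real ger0_norm ?expR_ge0//.
by rewrite Re_sub Re_1.
Qed.

Lemma integrable_weightZ (C a b : R) : -1 < a -> b < -1 ->
  mu.-integrable `]0, +oo[ (fun t => (C * weight a b t)%:E).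
Proof.
move=> a1 b1; apply: integrable_scale => //; exact: integrable_weight.
Qed.

Lemma cintegrable_Gamma a : 0 < Re a -> cintegrable `]0, +oo[ (Gamma_integrand a).
Proof.
move=> a0; have [C C0 HC] := expRN_weight (Re a - 1).
apply: (@cintegrable_le _ _ R mu _ _ (fun t => C * weight (Re a - 1) (-2) t)) => //.
- exact: cmeas_Gamma_integrand.
- by apply: integrable_weightZ; rewrite ?ltrBrDr ?addNr// ltrN2 ltr1n.
- move=> t /=; rewrite in_itv/= andbT => t0.
  by rewrite normc_Gamma_integrand// HC.
Qed.

Lemma Gamma_integral_cint a : Gamma_integral a = cint `]0, +oo[ (Gamma_integrand a).
Proof. by []. Qed.

Lemma cderive_Gamma_integrand a t : 0 < t ->
  cderive (Gamma_integrand a) t ((a - 1) * Gamma_integrand (a - 1) t - Gamma_integrand a t).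
Proof.
move=> t0; have E := cderive_real (is_derive_compE (is_derive_expR (- t)) (is_derive_oppE (@is_derive_id R R t 1))).
apply: cderive_eq (cderiveM (cderive_cpow (a - 1) t0) E).
by rewrite /Gamma_integrand rmorphM/= rmorphN rmorph1; ring.
Qed.

(** The difference of the two sides is the integral of the derivative of
    [t^a exp(-t)], which vanishes at both ends. *)
Lemma Gamma_integralS a : 0 < Re a -> Gamma_integral (a + 1) = a * Gamma_integral a.
Proof.
move=> a0; rewrite !Gamma_integral_cint.
have a10 : 0 < Re (a + 1) by rewrite Re_add Re_1 addr_gt0.
have i0 := cintegrable_Gamma a0; have i1 := cintegrable_Gamma a10.
apply/esym/eqP; rewrite -subr_eq0 -cintZ// -cintB//; last exact: cintegrableZ.
apply/eqP.
apply: (cint_FTC_0y (F := Gamma_integrand (a + 1))).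
- move=> t t0; apply: cderive_eq (cderive_Gamma_integrand (a + 1) t0).
  by rewrite addrK.
- move=> t t0; eexists.
  have := cderiveD (cderiveZ a (cderive_Gamma_integrand a t0))
    (cderiveZ (-1) (cderive_Gamma_integrand (a + 1) t0)).
  under eq_fun do rewrite mulN1r.
  exact.
- by apply: cintegrableB => //; exact: cintegrableZ.
- apply: (cvg0_at0 (C := 1) a0) => t /andP[t0 t1]; rewrite normc_ge0/= mul1r.
  rewrite normc_Gamma_integrand// Re_add Re_1 addrK ler_piMr ?powR_ge0//.
  by rewrite -expR0 ler_expR oppr_le0 ltW.
- have [C C0 HC] := powR_expRN_le (Re a).
  apply: (cvg0_aty (C := C) (s := -2)) => [|t t1]; first by rewrite oppr_lt0.
  rewrite normc_ge0/= normc_Gamma_integrand ?(lt_trans _ t1)//.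
  by rewrite Re_add Re_1 addrK HC.
Qed.

End GammaFunction.

(** * The Gamma integral has no zero *)

Section ElementaryInequalities.
Variable R : realType.
Implicit Types x y u : R.

Lemma ler_norm_sin x : `|sin x| <= `|x|.
Proof.
wlog x0 : x / 0 <= x.
  move=> H; have [/H//|/ltW x0] := leP 0 x.
  by rewrite -normrN -sinN -[leRHS]normrN; apply: H; rewrite oppr_ge0.
have [|c _] := @MVT_segment R sin cos 0 x x0 (fun y _ => is_derive_sin y).
  by apply: continuous_subspaceT => y; exact: continuous_sin.
rewrite sin0 !subr0 => ->; rewrite normrM ler_piMl//; exact: cos_max.
Qed.

Lemma cos_ge_quadratic x : 1 - x ^+ 2 / 2 <= cos x.
Proof.
have -> : cos x = 1 - 2 * sin (x / 2) ^+ 2.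
  rewrite -[in LHS](_ : x / 2 + x / 2 = x); last by field.
  by have := cos2Dsin2 (x / 2); rewrite cosD -!expr2; lra.
rewrite lerD2l lerN2 (_ : x ^+ 2 / 2 = 2 * (x / 2) ^+ 2); last by field.
rewrite ler_pM2l// -[leLHS]real_normK ?num_real// -[leRHS]real_normK ?num_real//.
by rewrite ler_pXn2r ?nnegrE// ler_norm_sin.
Qed.

(** [ln u <= u - 1] applied to [u] or to its inverse, according to the sign of
    [ln u]. *)
Lemma sqr_ln_le u : 0 < u -> ln u ^+ 2 <= (u - 1) ^+ 2 + (u^-1 - 1) ^+ 2.
Proof.
have H (v : R) : 0 < v -> ln v <= v - 1.
  move=> v0; have := @le_ln1Dx R (v - 1); rewrite [1 + _]addrC subrK; apply.
  by rewrite ltrBrDr addNr.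
move=> u0; have [u1|u1] := leP 0 (ln u).
  rewrite (@le_trans _ _ ((u - 1) ^+ 2))// ?lerDl ?sqr_ge0//.
  by rewrite ler_pXn2r ?nnegrE// ?H// (le_trans u1)// H.
have ui : 0 < u^-1 by rewrite invr_gt0.
rewrite (@le_trans _ _ ((u^-1 - 1) ^+ 2))// ?lerDr ?sqr_ge0//.
have := H _ ui; rewrite lnV// -sqrrN => Hu.
have u1n : 0 <= - ln u by rewrite oppr_ge0 ltW.
by rewrite ler_pXn2r ?nnegrE // (le_trans u1n).
Qed.

End ElementaryInequalities.

Section GammaNonvanishing.
Variable R : realType.
Local Notation mu := (@lebesgue_measure R).
Local Notation cint := (cint (@lebesgue_measure R)).
Local Notation cintegrable := (cintegrable (@lebesgue_measure R)).
Implicit Types (t x y X : R) (z a : R[i]).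

Definition GammaR x : R := \int[mu]_(t in `]0, +oo[) (t `^ (x - 1) * expR (- t)).

Let Gamma_integrand_real x t : 0 < t ->
  Gamma_integrand x%:C t = (t `^ (x - 1) * expR (- t))%:C.
Proof.
move=> t0; rewrite /Gamma_integrand -(rmorph1 (real_complex R)) -rmorphB cpow_real -rmorphM.
by rewrite /powR gt_eqF.
Qed.

Let Gamma_GammaR x : Gamma_integral x%:C = (GammaR x)%:C.
Proof.
rewrite Gamma_integral_cint -[RHS]/(Complex (GammaR x) 0); congr Complex.
  apply: eq_Rintegral => t /set_mem/itv0y_gt0 t0.
  by rewrite Gamma_integrand_real.
rewrite [RHS](_ : 0 = \int[mu]_(x in `]0%R, +oo[) 0).
  apply: eq_Rintegral => t /set_mem/itv0y_gt0 t0.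
  by rewrite Gamma_integrand_real.
by rewrite Rintegral_cst// mul0r.
Qed.

Lemma integrable_GammaR x : 0 < x ->
  mu.-integrable `]0, +oo[ (fun t => (t `^ (x - 1) * expR (- t))%:E).
Proof.
move=> x0; have [+ _] := @cintegrable_Gamma R x%:C x0.
apply: eq_integrable => // t /set_mem/itv0y_gt0 t0.
by rewrite Gamma_integrand_real.
Qed.

Let GammaRS x : 0 < x -> GammaR (x + 1) = x * GammaR x.
Proof.
move=> x0; apply: complexI; rewrite rmorphM/= -!Gamma_GammaR -Gamma_integralS//.
by rewrite rmorphD rmorph1.
Qed.

Lemma GammaR_gt0 x : 0 < x -> 0 < GammaR x.
Proof.
move=> x0; have ix := integrable_GammaR x0.
rewrite /GammaR itv0y_split Rintegral_setU//=; last 2 first.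
- by rewrite -itv0y_split.
- rewrite disj_set2E; apply/eqP/seteqP; split => // t [] /=; rewrite !in_itv/= andbT.
  by move=> /andP[_ t1]; rewrite ltNge t1.
rewrite ltr_pwDl//; last first.
  by apply: Rintegral_ge0 => t _; rewrite mulr_ge0// ?powR_ge0// expR_ge0.
have s01 : `]0 : R, 1]%classic `<=` `]0, +oo[.
  by move=> t /=; rewrite !in_itv/= andbT => /andP[].
have xx : -1 < x - 1 by rewrite ltrBrDr addNr.
apply: (@lt_le_trans _ _ (\int[mu]_(t in `]0, 1]) (expR (-1) * t `^ (x - 1)))).
  rewrite RintegralZl//; last exact: integrable_powR_01.
  have -> : \int[mu]_(t in `]0, 1]) t `^ (x - 1) =
      1 `^ (x - 1 + 1) / (x - 1 + 1) - 0.
    apply: (@integral_FTC_01 R _ (fun t => t `^ (x - 1 + 1) / (x - 1 + 1))).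
    - by move=> t t0; apply: is_derive_powR_primitive; rewrite ?gt_eqF.
    - by move=> t; exact: continuous_powR_gt0.
    - exact: integrable_powR_01.
    - rewrite subrK; apply: (@cvg0_at0 _ _ x^-1 x) => // t /andP[t0 t1].
      by rewrite divr_ge0 ?powR_ge0 ?(ltW x0)//= mulrC.
  by rewrite mulr_gt0 ?expR_gt0// subr0 subrK powR1 mul1r invr_gt0.
apply: le_Rintegral => //.
- by apply: integrable_scale => //; exact: integrable_powR_01.
- exact: integrableS ix.
- move=> t /=; rewrite in_itv/= => /andP[t0 t1].
  by rewrite mulrC ler_wpM2l ?powR_ge0// ler_expR lerN2.
Qed.

(** After division by [X^(iy)] the integrand of [Gamma(X + iy)] has phase
    [y ln(t / X)], which is small where the density [t^(X-1) exp(-t)] has its mass. *)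
Let kernel_bound X y t : 0 < X -> 0 < t ->
  t `^ (X - 1) * expR (- t) *
    (1 - y ^+ 2 / 2 * ((t / X - 1) ^+ 2 + (X / t - 1) ^+ 2)) <=
  Re (cpow X (0 -i* y) * Gamma_integrand (X +i* y) t).
Proof.
move=> X0 t0.
have E : cpow X (0 -i* y) * Gamma_integrand (X +i* y) t =
   (t `^ (X - 1) * expR (- t))%:C * cis (y * ln (t / X)).
  rewrite /Gamma_integrand (_ : X +i* y - 1 = (X - 1)%:C + (0 +i* y)); last first.
    by apply: complex_ext; rewrite !ReImE /= ?addr0 ?subr0 ?add0r.
  rewrite cpowD cpow_real.
  have -> : cpow X (0 -i* y) = cis (- (y * ln X)).
    by rewrite /cpow/cexp !ReImE/= mul0r expR0 mul1r mulNr.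
  have -> : cpow t (0 +i* y) = cis (y * ln t).
    by rewrite /cpow/cexp !ReImE/= mul0r expR0 mul1r.
  have -> : y * ln (t / X) = - (y * ln X) + y * ln t.
    by rewrite lnM ?posrE ?invr_gt0// lnV ?posrE//; ring.
  by rewrite cisD /powR gt_eqF// rmorphM/=; ring.
rewrite E Re_mul/= mul0r subr0 ler_wpM2l ?mulr_ge0 ?powR_ge0 ?expR_ge0//.
apply: le_trans (cos_ge_quadratic _).
rewrite lerD2l lerN2 exprMn mulrAC ler_wpM2l ?divr_ge0 ?sqr_ge0//.
by rewrite (le_trans (sqr_ln_le _)) ?divr_gt0// invf_div.
Qed.

Let g x t : R := t `^ (x - 1) * expR (- t).

Let gS x t : 0 < t -> g (x + 1) t = t * g x t.
Proof.
move=> t0; rewrite /g (_ : x + 1 - 1 = 1 + (x - 1)); last by ring.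
by rewrite [t `^ (1 + _)]powRD ?(gt_eqF t0) ?implybT// powRr1 ?(ltW t0)// mulrA.
Qed.

Lemma GammaR_integral x :
  GammaR x = \int[mu]_(t in `]0, +oo[) (t `^ (x - 1) * expR (- t)).
Proof. by []. Qed.

Let GE x : \int[mu]_(t in `]0%R, +oo[) g x t = GammaR x. Proof. by []. Qed.

#[global] Opaque GammaR.

Let far_ineq X (k : R) : 8 < X -> 0 <= k -> 2 * k < X ->
  k / 2 * ((X - 1) * (X - 2) + (X + 2) * X) < (X - 1) * (X - 2) * X.
Proof.
move=> X8 k0 yX; have X0 : 0 < X by lra.
have kX : k / 2 * ((X - 1) * (X - 2) + (X + 2) * X) <= X / 4 * ((X - 1) * (X - 2) + (X + 2) * X).
  rewrite ler_wpM2r//; last by lra.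
  by rewrite addr_ge0// mulr_ge0//; lra.
apply: le_lt_trans kX _.
have -> : X / 4 * ((X - 1) * (X - 2) + (X + 2) * X) = X * (((X - 1) * (X - 2) + (X + 2) * X) / 4) by field.
rewrite [ltRHS]mulrC ltr_pM2l//; nra.
Qed.

(** Integrating [kernel_bound]: the minorant is a combination of five shifted
    densities, so its integral is explicit in values of Gamma at real points. *)
Let lower_bound X y : 8 < X ->
  GammaR X - y ^+ 2 / 2 * (GammaR (X + 2) / X ^+ 2 - 2 * GammaR (X + 1) / X + 2 * GammaR X
     + X ^+ 2 * GammaR (X - 2) - 2 * X * GammaR (X - 1)) <=
  Re (cpow X (0 -i* y) * Gamma_integral (X +i* y)).
Proof.
move=> X8; have X0 : 0 < X by rewrite (lt_trans _ X8).
set k := y ^+ 2 / 2.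
have i0 : mu.-integrable `]0, +oo[ (fun t => (g X t)%:E) by exact: integrable_GammaR.
have i1 : mu.-integrable `]0, +oo[ (fun t => (g (X + 1) t)%:E).
  by apply: integrable_GammaR; rewrite addr_gt0.
have i2 : mu.-integrable `]0, +oo[ (fun t => (g (X + 2) t)%:E).
  by apply: integrable_GammaR; rewrite addr_gt0.
have j1 : mu.-integrable `]0, +oo[ (fun t => (g (X - 1) t)%:E).
  by apply: integrable_GammaR; lra.
have j2 : mu.-integrable `]0, +oo[ (fun t => (g (X - 2) t)%:E).
  by apply: integrable_GammaR; lra.
have iG : cintegrable `]0, +oo[ (Gamma_integrand (X +i* y)).
  exact: cintegrable_Gamma.
rewrite Gamma_integral_cint -cintZ//.
pose lb t := (1 - 2 * k) * g X t + ((- k / X ^+ 2) * g (X + 2) t +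
  ((2 * k / X) * g (X + 1) t + ((- k * X ^+ 2) * g (X - 2) t + (2 * k * X) * g (X - 1) t))).
have e1 (c : R) f : mu.-integrable `]0, +oo[ (fun t => (f t)%:E) ->
  mu.-integrable `]0, +oo[ (fun t => (c * f t)%:E) by exact: integrable_scale.
have e2 f1 f2 : mu.-integrable `]0, +oo[ (fun t => (f1 t)%:E) ->
  mu.-integrable `]0, +oo[ (fun t => (f2 t)%:E) ->
  mu.-integrable `]0, +oo[ (fun t => (f1 t + f2 t)%:E).
  by move=> ? ?; exact: integrable_add.
have ilb : mu.-integrable `]0, +oo[ (fun t => (lb t)%:E).
  do 4 (apply: (e2); first exact: (e1)); exact: e1.
have -> : GammaR X - k * (GammaR (X + 2) / X ^+ 2 - 2 * GammaR (X + 1) / X + 2 * GammaR X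
     + X ^+ 2 * GammaR (X - 2) - 2 * X * GammaR (X - 1)) = \int[mu]_(t in `]0, +oo[) lb t.
  rewrite RintegralD//; [|exact: e1|do 3 (apply: (e2); first exact: (e1)); exact: e1].
  rewrite RintegralD//; [|exact: e1|do 2 (apply: (e2); first exact: (e1)); exact: e1].
  rewrite RintegralD//; [|exact: e1|do 1 (apply: (e2); first exact: (e1)); exact: e1].
  rewrite RintegralD//; [|exact: e1|exact: e1].
  do 5 (rewrite RintegralZl; [|by []|by []]).
  rewrite !GE; move: (GammaR X) (GammaR (X + 1)) (GammaR (X + 2)) (GammaR (X - 1))
    (GammaR (X - 2)) => g0 g1 g2 g3 g4; field; lra.
rewrite -[leRHS]/(\int[mu]_(t in `]0, +oo[) Re (cpow X (0 -i* y) * Gamma_integrand (X +i* y) t)).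
apply: le_Rintegral => //.
  by have [] := @cintegrableZ _ _ _ mu _ (cpow X (0 -i* y)) _ (measurable_itv _) iG.
move=> t /itv0y_gt0 t0; apply: le_trans (kernel_bound y X0 t0).
rewrite -/(g X t) /lb (_ : X + 2 = X + 1 + 1); last by ring.
have -> : g X t = t * g (X - 1) t by rewrite -gS// subrK.
have -> : X + 1 + 1 = X - 2 + 1 + 1 + 1 + 1 by ring.
have -> : X + 1 = X - 2 + 1 + 1 + 1 by ring.
have -> : X - 1 = X - 2 + 1 by ring.
rewrite !gS// le_eqVlt; apply/orP; left; apply/eqP; rewrite -/k; field.
by rewrite !gt_eqF.
Qed.

(** By the functional equation all the real Gamma values in [lower_bound] are
    multiples of [Gamma(X - 2)], which leaves a rational inequality. *)
Let Gamma_neq0_far X y : 8 < X -> 2 * y ^+ 2 < X -> Gamma_integral (X +i* y) != 0.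
Proof.
move=> X8 yX; apply/eqP => G0; have := lower_bound y X8.
rewrite G0 mulr0 /=; apply/negP; rewrite -ltNge.
have X2 : 0 < X - 2 by lra.
have X1 : 0 < X - 1 by lra.
have X0 : 0 < X by lra.
have G := GammaR_gt0 X2.
have E1 : GammaR (X - 1) = (X - 2) * GammaR (X - 2).
  by rewrite -(GammaRS X2); congr GammaR; ring.
have E0 : GammaR X = (X - 1) * GammaR (X - 1) by rewrite -(GammaRS X1) subrK.
have F1 : GammaR (X + 1) = X * GammaR X by rewrite -(GammaRS X0).
have F2 : GammaR (X + 2) = (X + 1) * GammaR (X + 1).
  by rewrite -(GammaRS (addr_gt0 X0 ltr01)); congr GammaR; ring.
move: yX; rewrite F2 F1 E0 E1; set k := y ^+ 2 => yX.
have k0 : 0 <= k by exact: sqr_ge0.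
rewrite (_ : _ - _ = GammaR (X - 2) * (((X - 1) * (X - 2) * X - k / 2 * ((X - 1) * (X - 2) + (X + 2) * X)) / X)); last first.
  by field; rewrite gt_eqF.
rewrite mulr_gt0// divr_gt0// subr_gt0.
exact: far_ineq.
Qed.

(** A zero at [a] propagates to all [a + n], and far to the right
    [Gamma_neq0_far] excludes zeros with imaginary part [Im a]. *)
Lemma Gamma_integral_neq0 a : 0 < Re a -> Gamma_integral a != 0.
Proof.
move=> a0; apply/eqP => Ga0.
have G n : Gamma_integral (a + n%:R) = 0.
  elim: n => [|n IH]; first by rewrite addr0.
  rewrite -natr1 addrA Gamma_integralS ?IH ?mulr0//.
  by rewrite Re_add Re_natC ltr_wpDr.
(* far enough for both hypotheses of [Gamma_neq0_far] *)
pose n := (Num.truncn (8 + 2 * Im a ^+ 2)).+1.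
have nb : 8 + 2 * Im a ^+ 2 < n%:R by exact: truncnS_gt.
have a2 : 0 <= Im a ^+ 2 by exact: sqr_ge0.
have := G n; have -> : a + n%:R = (Re a + n%:R) +i* Im a.
  by apply: complex_ext; rewrite !ReImE/= ?addr0.
by apply/eqP/Gamma_neq0_far; lra.
Qed.

End GammaNonvanishing.

(** * The sine transform of the exponential density *)

Section GaussianSine.
Variable R : realType.
Local Notation mu := (@lebesgue_measure R).
Implicit Types (t s x : R).

Lemma norm_sin_le_powR (th x : R) : 0 <= th <= 1 -> 0 < x -> `|sin x| <= x `^ th.
Proof.
move=> /andP[th0 th1] x0; have [x1|x1] := leP x 1.
  rewrite (le_trans (ler_norm_sin _))// ger0_norm ?(ltW x0)//.
  by rewrite ger1_powR ?x0.
rewrite (le_trans (sin_max _))// -[leLHS](powRr0 x) ler_powR//.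
exact: ltW.
Qed.

(** The Gamma density [t^(x-1) exp(-t)], needed also at the exponent [x = 0],
    where only its product with a sine is integrable. *)
Definition gdens x t : R := t `^ (x - 1) * expR (- t).
Local Notation w := gdens.

Lemma integrable_gdens x : 0 < x -> mu.-integrable `]0, +oo[ (fun t => (w x t)%:E).
Proof. exact: integrable_GammaR. Qed.

Lemma measurable_gdens x : measurable_fun setT (w x).
Proof.
apply: measurable_funM; first exact: measurable_powR.
by apply: measurableT_comp => //; exact: measurable_expR.
Qed.

Lemma gdens_ge0 x t : 0 <= w x t.
Proof. by rewrite mulr_ge0 ?powR_ge0 ?expR_ge0. Qed.

Definition phase s t : R := 2 * s * t `^ 2^-1.
Local Notation ph := phase.

Let mph s : measurable_fun setT (ph s).
Proof. by apply: measurable_funM => //; exact: measurable_powR. Qed.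

Lemma measurable_sin_phase s : measurable_fun setT (fun t => sin (ph s t)).
Proof.
by apply: measurableT_comp => //; apply: continuous_measurable_fun; exact: continuous_sin.
Qed.

Let mcos s : measurable_fun setT (fun t => cos (ph s t)).
Proof.
by apply: measurableT_comp => //; apply: continuous_measurable_fun; exact: continuous_cos.
Qed.

Let C s : R := \int[mu]_(t in `]0, +oo[) (w 2^-1 t * cos (ph s t)).
Let S s : R := \int[mu]_(t in `]0, +oo[) (w 1 t * sin (ph s t)).
(** With [t = u^2] this is twice the integral of [exp(-u^2) sin(2 s u) / u]; up to
    a factor it is a primitive of the Gaussian, by [is_derive_gauss_sine]. *)
Definition gauss_sine s : R := \int[mu]_(t in `]0, +oo[) (w 0 t * sin (ph s t)).
Local Notation E := gauss_sine.

Let half_gt0 : 0 < 2^-1 :> R. Proof. by rewrite invr_gt0. Qed.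

Let iC s : mu.-integrable `]0, +oo[ (fun t => (w 2^-1 t * cos (ph s t))%:E).
Proof.
apply: (@integrable_le _ _ R mu _ _ (w 2^-1)) => //.
- by apply: measurable_funTS; exact: measurable_funM (measurable_gdens _) (mcos _).
- exact: integrable_gdens.
- by move=> t _; rewrite normrM (ger0_norm (gdens_ge0 _ _)) ler_piMr ?gdens_ge0 ?cos_max//.
Qed.

Let iS s : mu.-integrable `]0, +oo[ (fun t => (w 1 t * sin (ph s t))%:E).
Proof.
apply: (@integrable_le _ _ R mu _ _ (w 1)) => //.
- by apply: measurable_funTS; exact: measurable_funM (measurable_gdens _) (measurable_sin_phase _).
- exact: integrable_gdens.
- by move=> t _; rewrite normrM (ger0_norm (gdens_ge0 _ _)) ler_piMr ?gdens_ge0 ?sin_max//.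
Qed.

Lemma gdens_powR x y t : 0 < t -> w x t * t `^ y = w (x + y) t.
Proof.
move=> t0; rewrite /gdens mulrAC -powRD; last by rewrite (gt_eqF t0) implybT.
by congr (_ `^ _ * _); ring.
Qed.

Lemma gauss_sine_integrand_le s t (th : R) : 0 < s -> 0 < t -> 0 <= th <= 1 ->
  `|w 0 t * sin (ph s t)| <= (2 * s) `^ th * w (th / 2) t.
Proof.
move=> s0 t0 th01; rewrite normrM (ger0_norm (gdens_ge0 _ _)).
have p0 : 0 < ph s t by rewrite !mulr_gt0// powR_gt0.
rewrite -[th / 2]add0r -gdens_powR// mulrCA ler_wpM2l ?gdens_ge0//.
apply: le_trans (norm_sin_le_powR th01 p0) _.
rewrite /phase powRM ?powR_ge0 ?mulr_ge0 ?(ltW s0)//.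
by rewrite -powRrM [th / 2]mulrC.
Qed.

Lemma integrable_gauss_sine s : mu.-integrable `]0, +oo[ (fun t => (w 0 t * sin (ph s t))%:E).
Proof.
apply: (@integrable_le _ _ R mu _ _ (fun t => (2 * `|s|) * w 2^-1 t)) => //.
- by apply: measurable_funTS; exact: measurable_funM (measurable_gdens _) (measurable_sin_phase _).
- by apply: integrable_scale => //; exact: integrable_gdens.
- move=> t /itv0y_gt0 t0; rewrite normrM (ger0_norm (gdens_ge0 _ _)).
  rewrite -[2^-1]add0r -gdens_powR// mulrCA ler_wpM2l ?gdens_ge0//.
  rewrite (le_trans (ler_norm_sin _))// /phase !normrM.
  by rewrite (ger0_norm (powR_ge0 _ _)) ger0_norm.
Qed.

Let dph_s s t : is_derive s (1 : R) (ph ^~ t) (2 * t `^ 2^-1).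
Proof.
have D := is_deriveZ (2 * t `^ 2^-1) (@is_derive_id R R s 1).
rewrite (_ : ph ^~ t = (2 * t `^ 2^-1) \*: id); last first.
  by apply/funext => x; rewrite /phase /= /GRing.scale/=; ring.
by apply: (is_derive_eq D); exact: mulr1.
Qed.

Let dC s : is_derive s (1 : R) C (- 2 * S s).
Proof.
have -> : - 2 * S s = \int[mu]_(t in `]0, +oo[) (- 2 * (w 1 t * sin (ph s t))).
  by rewrite RintegralZl//; exact: iS.
apply: (@is_derive_under_integral _ _ R mu `]0, +oo[
  (fun s t => w 2^-1 t * cos (ph s t)) (fun s t => - 2 * (w 1 t * sin (ph s t)))
  (fun t => 2 * w 1 t)) => //.
- move=> x t /itv0y_gt0 t0.
  have D := is_derive_mulE (is_derive_cst (w 2^-1 t) x 1)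
    (is_derive_compE (g := ph ^~ t) (is_derive_cos (ph x t)) (dph_s x t)).
  apply: (is_derive_eq D); rewrite mul0r addr0 /cst.
  have -> : w 1 t = w 2^-1 t * t `^ 2^-1.
    by rewrite gdens_powR//; congr (w _ _); field.
  by ring.
- by apply: integrable_scale => //; exact: integrable_gdens.
- move=> x t _; rewrite 2!normrM normrN (ger0_norm (gdens_ge0 _ _)) (@ger0_norm _ 2)//.
  by rewrite ler_pM2l// ler_piMr ?gdens_ge0 ?sin_max//.
Qed.

Let dE s : is_derive s (1 : R) E (2 * C s).
Proof.
have -> : 2 * C s = \int[mu]_(t in `]0, +oo[) (2 * (w 2^-1 t * cos (ph s t))).
  by rewrite RintegralZl//; exact: iC.
apply: (@is_derive_under_integral _ _ R mu `]0, +oo[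
  (fun s t => w 0 t * sin (ph s t)) (fun s t => 2 * (w 2^-1 t * cos (ph s t)))
  (fun t => 2 * w 2^-1 t)) => //.
- by move=> x; exact: integrable_gauss_sine.
- move=> x t /itv0y_gt0 t0.
  have D := is_derive_mulE (is_derive_cst (w 0 t) x 1)
    (is_derive_compE (g := ph ^~ t) (is_derive_sin (ph x t)) (dph_s x t)).
  apply: (is_derive_eq D); rewrite mul0r addr0 /cst.
  have -> : w 2^-1 t = w 0 t * t `^ 2^-1 by rewrite gdens_powR// add0r.
  by ring.
- by apply: integrable_scale => //; exact: integrable_gdens.
- move=> x t _; rewrite 2!normrM (ger0_norm (gdens_ge0 _ _)) (@ger0_norm _ 2)//.
  by rewrite ler_pM2l// ler_piMr ?gdens_ge0 ?cos_max//.
Qed.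

Let dph_t s t : 0 < t -> is_derive t (1 : R) (ph s) (s * t `^ (2^-1 - 1)).
Proof.
move=> t0.
have D := is_derive_mulE (is_derive_cst (2 * s) t 1) (is_derive1_powR 2^-1 t0).
by apply: (is_derive_eq D); rewrite mul0r addr0 /cst; field.
Qed.

Let dw x t : 0 < t -> is_derive t (1 : R) (w x) ((x - 1) * w (x - 1) t - w x t).
Proof.
move=> t0.
have D := is_derive_mulE (is_derive1_powR (x - 1) t0)
  (is_derive_compE (is_derive_expR (- t)) (is_derive_oppE (@is_derive_id R R t 1))).
by apply: (is_derive_eq D); rewrite /gdens; ring.
Qed.

(** Integration by parts: differentiate [exp(-t) sin(2 s sqrt t)]. *)
Let SC s : S s = s * C s.
Proof.
have H : \int[mu]_(t in `]0, +oo[) (s * (w 2^-1 t * cos (ph s t)) + - 1 * (w 1 t * sin (ph s t))) = 0 - 0.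
  apply: (integral_FTC_0y (F := fun t => w 1 t * sin (ph s t))).
  - move=> t t0.
    have D := is_derive_mulE (dw 1 t0) (is_derive_compE (g := ph s) (is_derive_sin _) (dph_t s t0)).
    apply: (is_derive_eq D); rewrite subrr mul0r sub0r.
    have <- : w 1 t * t `^ (2^-1 - 1) = w 2^-1 t.
      by rewrite gdens_powR//; congr (w _ _); ring.
    by ring.
  - move=> t t0.
    have D1 := is_derive_mulE (dw 2^-1 t0)
      (is_derive_compE (g := ph s) (is_derive_cos _) (dph_t s t0)).
    have D2 := is_derive_mulE (dw 1 t0)
      (is_derive_compE (g := ph s) (is_derive_sin _) (dph_t s t0)).
    have D := is_derive_addE (is_derive_mulE (is_derive_cst s t 1) D1)
      (is_derive_mulE (is_derive_cst (-1 : R) t 1) D2).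
    exact: (continuous_is_derive D).
  - apply: integrable_add => //.
      by apply: integrable_scale => //; exact: iC.
    by apply: integrable_scale => //; exact: iS.
  - apply: norm_cvg0; apply: (@cvg0_at0 _ _ (2 * `|s|) 2^-1) => // t /andP[t0 t1].
    rewrite normr_ge0/= normrM (ger0_norm (gdens_ge0 _ _)) -[leRHS]mul1r ler_pM ?gdens_ge0//.
      rewrite /gdens subrr powRr0 mul1r -expR0 ler_expR oppr_le0 ltW//.
    rewrite (le_trans (ler_norm_sin _))// /phase !normrM (@ger0_norm _ 2)//.
    by rewrite (ger0_norm (powR_ge0 _ _)).
  - have [c c0 wc] := powR_expRN_le (1 - 1 : R).
    apply: norm_cvg0; apply: (@cvg0_aty _ _ c (-2)) => [|t t1]; first by rewrite oppr_lt0.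
    rewrite normr_ge0/= normrM (ger0_norm (gdens_ge0 _ _)).
    by apply: le_trans (wc t t1); rewrite ler_piMr ?gdens_ge0 ?sin_max//.
move: H; rewrite subrr RintegralD//; last 2 first.
- by apply: integrable_scale => //; exact: iC.
- by apply: integrable_scale => //; exact: iS.
rewrite RintegralZl//; last exact: iC.
rewrite RintegralZl//; last exact: iS.
by rewrite -/(C s) -/(S s); lra.
Qed.

(** The Gaussian is its own cosine transform: [SC] turns the formula for [C'] into
    the differential equation [C' = - 2 s C]. *)
Let C_gauss s : C s = GammaR 2^-1 * expR (- s ^+ 2).
Proof.
have D x : is_derive x (1 : R) (fun y => C y * expR (y ^+ 2)) 0.
  have I := @is_derive_id R R x 1.
  have D := is_derive_mulE (dC x) (is_derive_compE (g := fun y => y ^+ 2) (is_derive_expR (x ^+ 2)) (is_deriveX 2 I)).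
  by apply: (is_derive_eq D); rewrite SC /GRing.scale/= expr1; ring.
have := is_derive_0_is_cst s 0 D; rewrite expr0n/= expR0 mulr1.
have -> : C 0 = GammaR 2^-1.
  rewrite GammaR_integral; apply: eq_Rintegral => t _.
  by rewrite /phase mulr0 mul0r cos0 mulr1.
by move=> <-; rewrite -mulrA -expRD subrr expR0 mulr1.
Qed.

Lemma is_derive_gauss_sine s :
  is_derive s (1 : R) gauss_sine (2 * GammaR 2^-1 * expR (- s ^+ 2)).
Proof. by apply: (is_derive_eq (dE s)); rewrite C_gauss mulrA. Qed.

Lemma gauss_sine_le s (th : R) : 0 < s -> 0 < th <= 1 ->
  `|gauss_sine s| <= (2 * s) `^ th * GammaR (th / 2).
Proof.
move=> s0 /andP[th0 th1].
have i2 : mu.-integrable `]0, +oo[ (fun t => (w (th / 2) t)%:E).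
  by apply: integrable_gdens; rewrite divr_gt0.
rewrite /gauss_sine (le_trans (le_normr_Rintegral _ (integrable_gauss_sine s)))//.
rewrite GammaR_integral -RintegralZl//.
apply: le_Rintegral => //.
- exact: (integrable_norm (integrable_gauss_sine s)).
- exact: integrable_scale.
- move=> t /itv0y_gt0 t0; apply: gauss_sine_integrand_le => //.
  by rewrite ltW.
Qed.

End GaussianSine.

(** * The local functional equation *)

Section FunctionalEquation.
Variable R : realType.
Local Notation mu := (@lebesgue_measure R).
Local Notation cint := (cint (@lebesgue_measure R)).
Local Notation cintegrable := (cintegrable (@lebesgue_measure R)).
Implicit Types (t s x p q c : R) (a z : R[i]).
Local Notation h := (2^-1 : R).

(** The exponent is [a - 3/2]; [phase pi q] is [2 pi sqrt q]. *)
Definition osc c a q : R[i] := (sin (phase c q))%:C * cpow q (a - h%:C - 1).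

Lemma phase_scale c s q : 0 <= s -> 0 <= q -> phase c (s * q) = phase (c * s `^ h) q.
Proof. by move=> s0 q0; rewrite /phase powRM//; ring. Qed.

Lemma cmeas_osc c a D : cmeas D (osc c a).
Proof.
apply: cmeasM; last exact: cmeas_cpow.
by apply: cmeas_real; apply: measurable_funTS; exact: measurable_sin_phase.
Qed.

(** The exponent [th] is chosen as 1 near [q = 0] and as a small number near
    infinity: the sine is bounded by any such power of its argument. *)
Lemma norm_osc_le c a q (th : R) : 0 < c -> 0 < q -> 0 <= th <= 1 ->
  normc (osc c a q) <= (2 * c) `^ th * q `^ (th / 2 + Re a - h - 1).
Proof.
move=> c0 q0 th01; rewrite normcM normc_real normc_cpowR// !ReImE.
have p0 : 0 < phase c q by rewrite !mulr_gt0// powR_gt0.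
have -> : th / 2 + Re a - h - 1 = th * h + (Re a - h - 1) by ring.
rewrite [q `^ (th * h + _)]powRD ?(gt_eqF q0) ?implybT// mulrA ler_wpM2r ?powR_ge0//.
apply: le_trans (norm_sin_le_powR th01 p0) _.
rewrite /phase powRM ?powR_ge0 ?mulr_ge0 ?(ltW c0)//.
by rewrite -powRrM [th * h]mulrC.
Qed.

Let wt := @weight R (- (3 / 4)) (- (9 / 8)).

Let iwt : mu.-integrable `]0, +oo[ (fun t => (wt t)%:E).
Proof. by apply: integrable_weight; lra. Qed.

Lemma norm_osc_weight c a q : 0 < c -> 0 < q -> Re a = 4^-1 ->
  normc (osc c a q) <= (2 * c + (2 * c) `^ 4^-1) * wt q.
Proof.
move=> c0 q0 ha; rewrite /wt/weight; case: ifPn => q1.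
  have := @norm_osc_le c a q 1 c0 q0; rewrite ha.
  rewrite (_ : 1 / 2 + 4^-1 - h - 1 = - (3 / 4)); last by field.
  rewrite powRr1; last by rewrite mulr_ge0// ltW.
  move=> /(_ _)/le_trans; apply; first by rewrite ler01 lexx.
  by rewrite ler_wpM2r ?powR_ge0// lerDl powR_ge0.
have := @norm_osc_le c a q 4^-1 c0 q0; rewrite ha.
rewrite (_ : 4^-1 / 2 + 4^-1 - h - 1 = - (9 / 8)); last by field.
move=> /(_ _)/le_trans; apply; first by lra.
by rewrite ler_wpM2r ?powR_ge0// lerDr mulr_ge0// ltW.
Qed.

Lemma cintegrable_osc c a : 0 < c -> Re a = 4^-1 -> cintegrable `]0, +oo[ (osc c a).
Proof.
move=> c0 ha.
apply: (@cintegrable_le _ _ R mu _ _ (fun q => (2 * c + (2 * c) `^ 4^-1) * wt q)) => //.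
- exact: cmeas_osc.
- exact: integrable_scale.
- by move=> q /itv0y_gt0 q0; exact: norm_osc_weight.
Qed.

Let dphase c q : 0 < q -> is_derive q (1 : R) (phase c) (c * q `^ (h - 1)).
Proof.
move=> q0.
have D := is_derive_mulE (is_derive_cst (2 * c) q 1) (is_derive1_powR h q0).
by apply: (is_derive_eq D); rewrite mul0r addr0 /cst; field.
Qed.

Lemma cderive_osc c a q : 0 < q -> exists d, cderive (osc c a) q d.
Proof.
move=> q0; eexists; apply: cderiveM; last exact: cderive_cpow.
apply: cderive_real.
exact: (is_derive_compE (g := phase c) (is_derive_sin _) (dphase c q0)).
Qed.

Lemma cint_0y_scale (F : R -> R[i]) c : 0 < c ->
  (forall x, 0 < x -> exists d, cderive F x d) ->
  cintegrable `]0, +oo[ F -> cintegrable `]0, +oo[ (fun x => F (c * x)) ->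
  cint `]0, +oo[ F = c%:C * cint `]0, +oo[ (fun x => F (c * x)).
Proof.
move=> c0 dF [F1 F2] [G1 G2]; apply: complex_ext; rewrite !ReImE.
  rewrite mul0r subr0; apply: (integral_0y_scale (f := fun x => Re (F x))) => //.
  by move=> x /dF[d /continuous_cderive[]].
rewrite mul0r addr0; apply: (integral_0y_scale (f := fun x => Im (F x))) => //.
by move=> x /dF[d /continuous_cderive[]].
Qed.

(** Changing the frequency of the sine amounts to rescaling [q], as the phase is
    homogeneous of degree 1/2 in [q]. *)
Lemma cint_osc_scale a c t : 0 < c -> 0 < t -> Re a = 4^-1 ->
  cint `]0, +oo[ (osc c a) =
  cpow (t / c ^+ 2) (a - h%:C) * cint `]0, +oo[ (osc (t `^ h) a).
Proof.
move=> c0 t0 ha; set s := t / c ^+ 2.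
have s0 : 0 < s by rewrite divr_gt0// exprn_gt0.
have cs : c * s `^ h = t `^ h.
  rewrite /s powRM ?(ltW t0)// ?invr_ge0 ?exprn_ge0 ?(ltW c0)//.
  rewrite -exprVn -powR_mulrn ?invr_ge0 ?(ltW c0)// -powRrM mulfV// powRr1 ?invr_ge0 ?(ltW c0)//.
  by rewrite mulrCA divff ?mulr1// gt_eqF.
have E q : 0 < q -> osc c a (s * q) = cpow s (a - h%:C - 1) * osc (t `^ h) a q.
  by move=> q0; rewrite /osc phase_scale ?ltW// cs cpow_mul// mulrCA.
have th0 : 0 < t `^ h by rewrite powR_gt0.
have i2 := cintegrable_osc th0 ha.
have i3 : cintegrable `]0, +oo[ (fun q => cpow s (a - h%:C - 1) * osc (t `^ h) a q).
  exact: cintegrableZ.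
rewrite (cint_0y_scale s0).
- rewrite (@eq_cint _ _ R mu _ _ (fun q => cpow s (a - h%:C - 1) * osc (t `^ h) a q)); last first.
    by move=> q /itv0y_gt0; exact: E.
  rewrite cintZ// mulrA cpowD cpowN cpow1// mulrCA divff ?mulr1//.
  by rewrite -normc_eq0 normc_real normr_eq0 gt_eqF.
- by move=> x; exact: cderive_osc.
- exact: cintegrable_osc.
- by apply: eq_cintegrable i3 => // q /itv0y_gt0 q0; rewrite E.
Qed.

Definition mellin_sine a : R[i] := cint `]0, +oo[ (osc pi a).

(** Symmetric in the phase, [2 sqrt(t p)]: integrated in [p] it is a rescaled
    Mellin transform of the sine, integrated in [t] a Gaussian sine transform. *)
Let K a t p : R[i] := (gdens 0 t * sin (phase (p `^ h) t))%:C * cpow p (a - h%:C - 1).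

Let phase_sym t p : phase (p `^ h) t = phase (t `^ h) p.
Proof. by rewrite /phase mulrAC. Qed.

Let KE a t p : K a t p = (gdens 0 t)%:C * osc (t `^ h) a p.
Proof. by rewrite /K /osc phase_sym rmorphM/= mulrA. Qed.

Let mK a : cmeas setT (fun x : R * R => K a x.1 x.2).
Proof.
apply: cmeasM; last first.
  exact: cmeas_cpow measurable_snd.
apply: cmeas_real; apply: measurable_funM.
  exact: (measurableT_comp (@measurable_gdens R 0) measurable_fst).
apply: (measurableT_comp (f := sin)).
  by apply: continuous_measurable_fun; exact: continuous_sin.
apply: measurable_funM; last first.
  exact: (measurableT_comp (measurable_powR h) measurable_fst).
apply: measurable_funM; first exact: measurable_cst.
exact: (measurableT_comp (measurable_powR h) measurable_snd).
Qed.

(** The sine is bounded by its argument for [p <= 1], and by the power 1/4 of its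
    argument for [p > 1]; this makes the kernel absolutely integrable. *)
Let norm_K_le a t p : 0 < t -> 0 < p -> Re a = 4^-1 ->
  normc (K a t p) <= (2 * (gdens h t + gdens 8^-1 t)) * wt p.
Proof.
move=> t0 p0 ha; rewrite /K normcM normc_real normc_cpowR// !ReImE ha.
have ph0 : 0 < p `^ h by rewrite powR_gt0.
rewrite /wt/weight; case: ifPn => p1.
  have := @gauss_sine_integrand_le R (p `^ h) t 1 ph0 t0; rewrite ler01 lexx => /(_ isT).
  rewrite mul1r powRr1 ?mulr_ge0 ?powR_ge0// => H.
  rewrite (le_trans (ler_wpM2r (powR_ge0 _ _) H))//.
  have -> : 2 * p `^ h * gdens h t * p `^ (4^-1 - h - 1) = 2 * gdens h t * p `^ (- (3 / 4)).
    have -> : - (3 / 4) = h + (4^-1 - h - 1) by field.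
    by rewrite [p `^ (h + _)]powRD ?(gt_eqF p0) ?implybT//; ring.
  by rewrite ler_wpM2r ?powR_ge0// ler_pM2l// lerDl gdens_ge0.
have := @gauss_sine_integrand_le R (p `^ h) t 4^-1 ph0 t0.
have q01 : (0 : R) <= (4^-1 : R) <= (1 : R) by apply/andP; split; lra.
move=> /(_ q01) H; rewrite (le_trans (ler_wpM2r (powR_ge0 _ _) H))//.
rewrite powRM ?powR_ge0//.
have -> : 2 `^ 4^-1 * p `^ h `^ 4^-1 * gdens (4^-1 / 2) t * p `^ (4^-1 - h - 1) =
    2 `^ 4^-1 * gdens 8^-1 t * p `^ (- (9 / 8)).
  have -> : - (9 / 8) = h * 4^-1 + (4^-1 - h - 1) by field.
  rewrite [p `^ (h * _ + _)]powRD ?(gt_eqF p0) ?implybT// powRrM.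
  have -> : 4^-1 / 2 = 8^-1 :> R by field.
  by ring.
rewrite ler_wpM2r ?powR_ge0// ler_pM ?powR_ge0 ?gdens_ge0//.
  by rewrite ler1_powR//; lra.
by rewrite lerDr gdens_ge0.
Qed.

Let inner_p a t : 0 < t -> Re a = 4^-1 ->
  cint `]0, +oo[ (K a t) =
  cpow (pi ^+ 2) (a - h%:C) * Gamma_integrand (h%:C - a) t * mellin_sine a.
Proof.
move=> t0 ha; have th0 : 0 < t `^ h by rewrite powR_gt0.
rewrite (@eq_cint _ _ R mu _ _ (fun p => (gdens 0 t)%:C * osc (t `^ h) a p)); last first.
  by move=> p _; rewrite KE.
rewrite cintZ//; last exact: cintegrable_osc.
rewrite /mellin_sine (cint_osc_scale (pi_gt0 R) t0 ha) mulrA; congr (_ * _).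
have p2 : 0 < pi ^+ 2 :> R by rewrite exprn_gt0// pi_gt0.
have : cpow (t / pi ^+ 2) (a - h%:C) * cpow (pi ^+ 2) (a - h%:C) = cpow t (a - h%:C).
  by rewrite -cpow_mul ?divr_gt0// divfK// gt_eqF.
have G : cpow t (h%:C - a - 1) = (cpow t (a - h%:C))^-1 * t%:C^-1.
  by rewrite -cpowN -(cpow1 t0) -cpowN -cpowD; congr cpow; ring.
move=> E; rewrite /Gamma_integrand G -[in RHS]E.
rewrite /gdens sub0r powR_inv1 ?(ltW t0)// rmorphM/= fmorphV.
by field; rewrite !cpow_neq0/= -normc_eq0 normc_real normr_eq0 gt_eqF.
Qed.

Let inner_t a p : cint `]0, +oo[ (fun t => K a t p) =
  (gauss_sine (p `^ h))%:C * cpow p (a - h%:C - 1).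
Proof.
have iE := @integrable_gauss_sine R (p `^ h).
rewrite (@eq_cint _ _ R mu _ _ (fun t => cpow p (a - h%:C - 1) *
  (gdens 0 t * sin (phase (p `^ h) t))%:C)); last by move=> t _; rewrite mulrC.
rewrite cintZ//; last exact: cintegrable_real.
by rewrite cint_real mulrC.
Qed.

Let cG a p : R[i] := (gauss_sine (p `^ h))%:C * cpow p (a - h%:C - 1).

Let norm_cG_le a p (th : R) : 0 < p -> 0 < th <= 1 ->
  normc (cG a p) <= 2 `^ th * GammaR (th / 2) * p `^ (th / 2 + Re a - h - 1).
Proof.
move=> p0 th01; rewrite normcM normc_real normc_cpowR// !ReImE.
have ph0 : 0 < p `^ h by rewrite powR_gt0.
have -> : th / 2 + Re a - h - 1 = h * th + (Re a - h - 1) by ring.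
rewrite [p `^ (h * th + _)]powRD ?(gt_eqF p0) ?implybT// mulrA ler_wpM2r ?powR_ge0//.
rewrite (le_trans (gauss_sine_le ph0 th01))//.
by rewrite powRM ?powR_ge0// powRrM mulrAC.
Qed.

Let iG a : Re a = 4^-1 -> cintegrable `]0, +oo[ (cG a).
Proof.
move=> ha.
apply: (@cintegrable_le _ _ R mu _ _
  (fun p => (2 `^ 1 * GammaR (1 / 2) + 2 `^ 4^-1 * GammaR (4^-1 / 2)) * wt p)) => //.
- apply: cmeasM; last exact: cmeas_cpow.
  apply: cmeas_real; apply: measurable_funTS.
  apply: (measurableT_comp (f := @gauss_sine R)); last exact: measurable_powR.
  apply: continuous_measurable_fun => s.
  exact: continuous_is_derive (is_derive_gauss_sine s).
- exact: integrable_scale.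
- have G2 : 0 <= GammaR (1 / 2) :> R by rewrite ltW// GammaR_gt0//; lra.
  have G8 : 0 <= GammaR (4^-1 / 2) :> R by rewrite ltW// GammaR_gt0//; lra.
  move=> p /itv0y_gt0 p0; rewrite /wt/weight; case: ifPn => p1.
    have := @norm_cG_le a p 1 p0; rewrite ha.
    rewrite (_ : 1 / 2 + 4^-1 - h - 1 = - (3 / 4)); last by field.
    move=> /(_ _)/le_trans; apply; first by rewrite ltr01 lexx.
    by rewrite ler_wpM2r ?powR_ge0// lerDl mulr_ge0// powR_ge0.
  have := @norm_cG_le a p 4^-1 p0; rewrite ha.
  rewrite (_ : 4^-1 / 2 + 4^-1 - h - 1 = - (9 / 8)); last by field.
  move=> /(_ _)/le_trans; apply; first by lra.
  by rewrite ler_wpM2r ?powR_ge0// lerDr mulr_ge0// powR_ge0.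
Qed.

(** Integration by parts in [p]: the derivative of [gauss_sine (sqrt p)] is a
    constant times [exp(-p) p^(-1/2)], which produces the integrand of [Gamma(a)]. *)
Let int_cG a : Re a = 4^-1 ->
  (h%:C - a) * cint `]0, +oo[ (cG a) = (GammaR h)%:C * Gamma_integral a.
Proof.
move=> ha.
have a0 : 0 < Re a by rewrite ha invr_gt0.
have iGm := cintegrable_Gamma a0.
have dG p : 0 < p -> is_derive p (1 : R) (fun p => gauss_sine (p `^ h))
    (GammaR h * expR (- p) * p `^ (h - 1)).
  move=> p0.
  have D := is_derive_compE (g := fun p => p `^ h)
    (is_derive_gauss_sine (p `^ h)) (is_derive1_powR h p0).
  apply: (is_derive_eq D).
  rewrite -powR_mulrn ?powR_ge0// -powRrM mulVf// powRr1 ?(ltW p0)//.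
  by field.
have Z : cint `]0, +oo[ (fun p => (a - h%:C) * cG a p + (GammaR h)%:C * Gamma_integrand a p) = 0.
  pose F p : R[i] := (gauss_sine (p `^ h))%:C * cpow p (a - h%:C).
  have dF p : 0 < p -> cderive F p ((a - h%:C) * cG a p + (GammaR h)%:C * Gamma_integrand a p).
    move=> p0.
    apply: cderive_eq (cderiveM (cderive_real (dG _ p0)) (cderive_cpow _ p0)).
    rewrite /cG /Gamma_integrand -/h.
    have -> : cpow p (a - 1) = cpow p (a - h%:C) * (p `^ (h - 1))%:C.
      have <- : cpow p (h - 1)%:C = (p `^ (h - 1))%:C.
        by rewrite cpow_real /powR gt_eqF.
      by rewrite -cpowD rmorphB/= rmorph1; congr cpow; ring.
    by rewrite !rmorphM/=; ring.
  have nF p (th : R) : 0 < p -> 0 < th <= 1 ->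
      normc (F p) <= 2 `^ th * GammaR (th / 2) * p `^ (th / 2 - 4^-1).
    move=> p0 th01; have -> : F p = cG a p * p%:C.
      by rewrite -(cpow1 p0) /cG -mulrA -cpowD subrK.
    rewrite normcM normc_real (ger0_norm (ltW p0)).
    apply: le_trans (ler_wpM2r (ltW p0) (norm_cG_le a p0 th01)) _.
    have pS (e : R) : p `^ e * p = p `^ (e + 1).
      by rewrite powRD ?(gt_eqF p0) ?implybT// powRr1// ltW.
    rewrite -[leLHS]mulrA pS ha (_ : th / 2 + 4^-1 - h - 1 + 1 = th / 2 - 4^-1)//.
    by field.
  have ddf p : 0 < p -> exists d, cderive (fun p => (a - h%:C) * cG a p + (GammaR h)%:C * Gamma_integrand a p) p d.
    move=> p0; eexists; apply: cderiveD.
      apply: cderiveZ; apply: cderiveM; last exact: cderive_cpow.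
      exact: cderive_real (dG _ p0).
    by apply: cderiveZ; exact: cderive_Gamma_integrand.
  apply: (cint_FTC_0y (F := F)) => //.
  - apply: cintegrableD => //; last exact: cintegrableZ.
    by apply: cintegrableZ => //; exact: iG.
  - apply: (@cvg0_at0 _ _ (2 `^ 1 * GammaR (1 / 2)) 4^-1) => [|p /andP[p0 p1]]; first by rewrite invr_gt0.
    rewrite normc_ge0/= (_ : 4^-1 = 1 / 2 - 4^-1); last by field.
    by apply: nF => //; rewrite ltr01 lexx.
  - apply: (@cvg0_aty _ _ (2 `^ 4^-1 * GammaR (4^-1 / 2)) (- 8^-1)) => [|p p1]; first by rewrite oppr_lt0 invr_gt0.
    rewrite normc_ge0/= (_ : - 8^-1 = 4^-1 / 2 - 4^-1); last by field.
    by apply: nF; [exact: lt_trans p1|lra].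
have iG1 : cintegrable `]0, +oo[ (fun p => (a - h%:C) * cG a p).
  by apply: cintegrableZ => //; exact: iG.
have iG2 : cintegrable `]0, +oo[ (fun p => (GammaR h)%:C * Gamma_integrand a p).
  exact: cintegrableZ.
move: Z; rewrite cintD// cintZ//; last exact: iG.
rewrite cintZ// -Gamma_integral_cint => /eqP; rewrite addr_eq0 => /eqP E.
by rewrite -[h%:C - a]opprB mulNr E opprK.
Qed.

(** Both iterated integrals of the kernel [K] agree. *)
Lemma mellin_sine_Gamma a : Re a = 4^-1 ->
  (h%:C - a) * mellin_sine a * Gamma_integral (h%:C - a) =
  cpow (pi ^+ 2) (h%:C - a) * (GammaR h)%:C * Gamma_integral a.
Proof.
move=> ha.
have b0 : 0 < Re (h%:C - a) by rewrite !ReImE ha; lra.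
have ig : mu.-integrable `]0, +oo[ (fun t => (2 * (gdens h t + gdens 8^-1 t))%:E).
  apply: integrable_scale => //; apply: integrable_add => //.
    by apply: integrable_gdens; rewrite invr_gt0.
  by apply: integrable_gdens; rewrite invr_gt0.
have F : cint `]0, +oo[ (fun t => cint `]0, +oo[ (K a t)) =
         cint `]0, +oo[ (fun p => cint `]0, +oo[ (fun t => K a t p)).
  apply: (@cint_Fubini _ _ _ _ R mu mu _ _ (K a)
    (fun t => 2 * (gdens h t + gdens 8^-1 t)) wt) => //.
    exact: mK.
  by move=> t p /itv0y_gt0 t0 /itv0y_gt0 p0; exact: norm_K_le.
have L : cint `]0, +oo[ (fun t => cint `]0, +oo[ (K a t)) =
    cpow (pi ^+ 2) (a - h%:C) * mellin_sine a * Gamma_integral (h%:C - a).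
  set c := cpow _ _ * mellin_sine a; rewrite Gamma_integral_cint.
  rewrite -(@cintZ _ _ R mu _ c _ (measurable_itv _) (cintegrable_Gamma b0)) /c.
  by apply: eq_cint => t /itv0y_gt0 t0; rewrite (inner_p t0 ha) mulrAC.
have RR : cint `]0, +oo[ (fun p => cint `]0, +oo[ (fun t => K a t p)) = cint `]0, +oo[ (cG a).
  by apply: eq_cint => p _; rewrite inner_t.
have p2 : cpow (pi ^+ 2) (h%:C - a) * cpow (pi ^+ 2) (a - h%:C) = 1 :> R[i].
  by rewrite -cpowD -[h%:C - a]opprB addNr cpow0.
rewrite -[RHS]mulrA -(int_cG ha) -RR -F L.
move: p2; move: (cpow (pi ^+ 2) (h%:C - a)) (cpow (pi ^+ 2) (a - h%:C)) => P Q.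
move: (mellin_sine a) (Gamma_integral (h%:C - a)) (h%:C - a) => M G d PQ.
by rewrite -[LHS]mul1r -PQ; ring.
Qed.

End FunctionalEquation.

(** * Complex differentiability and the maximum principle *)

Section SecondOrderExpansion.
Variable R : realType.
Implicit Types (F G : R[i] -> R[i]) (z w : R[i]).

Lemma cvg0_normcP (f : R[i] -> R[i]) :
  ((f w : R[i]^o) @[w --> (0 : R[i]^o)] --> (0 : R[i]^o)) <->
  (forall e : R, 0 < e -> exists2 d : R, 0 < d & forall w, normc w < d -> normc (f w) < e).
Proof.
split.
- move=> /(@cvgr0Pnorm_lt R[i] R[i]^o _ (nbhs (0 : R[i]^o)) _ f).1 H e e0; have e0' : 0 < e%:C :> R[i] by rewrite ltcR.
  have /nbhs_ballP[d /= d0 Hd] := H _ e0'.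
  exists (Re d); first by move: d0; rewrite ltcE => /andP[].
  move=> w wd; have := Hd w; rewrite /= /ball/= sub0r normrN normcE' normcE' ltcR; apply.
  move: d0; rewrite ltcE => /andP[/eqP /= d0 _].
  by rewrite ltcE/= wd d0 eqxx.
- move=> H; apply: (@cvgr0Pnorm_lt R[i] R[i]^o _ (nbhs (0 : R[i]^o)) _ f).2 => e e0.
  have [e1 e2] : Im e = 0 /\ 0 < Re e.
    by move: e0; rewrite ltcE => /andP[/eqP -> /= ].
  have [d d0 Hd] := H _ e2.
  apply/nbhs_ballP; exists d%:C => /=; first by rewrite ltcR.
  move=> w; rewrite /ball/= sub0r normrN normcE' ltcR => wd.
  by rewrite normcE' ltcE/= e1 eqxx Hd.
Qed.

Definition clim (B : set_system R[i]) (f : R[i] -> R[i]) (l : R[i]) : Prop :=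
  (f x : R[i]^o) @[x --> B] --> (l : R[i]^o).

Lemma climD B (FB : Filter B) f g l m :
  clim B f l -> clim B g m -> clim B (fun w => f w + g w) (l + m).
Proof. by move=> fl gm; exact: (@cvgD _ R[i]^o _ B FB _ _ _ _ fl gm). Qed.

Lemma climM B (FB : Filter B) f g l m :
  clim B f l -> clim B g m -> clim B (fun w => f w * g w) (l * m).
Proof. by move=> fl gm; exact: (@cvgM _ _ B FB _ _ _ _ fl gm). Qed.

Lemma clim_cst B (FB : Filter B) l : clim B (fun=> l) l.
Proof. exact: (@cvg_cst R[i]^o l _ B FB). Qed.

Local Notation nbhs0 := (nbhs (0 : R[i]^o)).
Let FN : Filter nbhs0 := nbhs_filter (0 : R[i]^o).

(** Used in place of holomorphy: two complex derivatives at a point are what the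
    maximum principle needs, and such expansions are stable under products and can
    be obtained under an integral sign, even at boundary points. *)
Definition taylor2 F z : Prop := exists (F1 F2 : R[i]) (rho : R[i] -> R[i]),
  ((rho w : R[i]^o) @[w --> (0 : R[i]^o)] --> (0 : R[i]^o)) /\
  forall w, F (z + w) = F z + F1 * w + (F2 + rho w) * w ^+ 2.

Lemma taylor2_bound F z (F1 F2 : R[i]) (A d : R) : 0 < d ->
  (forall w, normc w <= d -> normc (F (z + w) - F z - F1 * w - F2 * w ^+ 2) <= A * normc w ^+ 3) ->
  taylor2 F z.
Proof.
move=> d0 HA; exists F1, F2, (fun w => (F (z + w) - F z - F1 * w - F2 * w ^+ 2) / w ^+ 2).
split; last first.
  move=> w; have [->|w0] := eqVneq w 0; first by rewrite expr0n/= !mulr0 !addr0.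
  by rewrite mulrDl divfK ?expf_neq0//; ring.
apply/cvg0_normcP => e e0.
have A0 : 0 <= A.
  have := HA d%:C; rewrite normc_real (ger0_norm (ltW d0)) lexx => /(_ isT).
  by move=> /(le_trans (normc_ge0 _)); rewrite pmulr_lge0// exprn_gt0.
exists (Num.min d (e / (A + 1))); first by rewrite lt_min d0 divr_gt0// ltr_wpDl.
move=> w; rewrite lt_min => /andP[wd we].
have [->|w0] := eqVneq w 0; first by rewrite expr0n/= invr0 mulr0 normc0.
have nw : 0 < normc w by rewrite normc_gt0.
rewrite normcM normcV normcX ltr_pdivrMr ?exprn_gt0//.
apply: le_lt_trans (HA _ (ltW wd)) _.
rewrite exprS mulrA ltr_pM2r ?exprn_gt0//.
have H1 : A * normc w <= (A + 1) * normc w.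
  by rewrite ler_wpM2r ?normc_ge0 ?lerDl.
apply: le_lt_trans H1 _.
by rewrite mulrC -ltr_pdivlMr// ltr_wpDl.
Qed.

Lemma taylor2_affine (p q : R[i]) z : taylor2 (fun a => p + q * a) z.
Proof.
exists q, 0, (fun=> 0); split.
  by apply/cvg0_normcP => e e0; exists 1 => // w _; rewrite normc0.
by move=> w; rewrite addr0 mul0r; ring.
Qed.

Lemma taylor2M F G z : taylor2 F z -> taylor2 G z -> taylor2 (fun a => F a * G a) z.
Proof.
move=> [F1 [F2 [r [r0 rE]]]] [G1 [G2 [s [s0 sE]]]].
exists (F z * G1 + F1 * G z), (F z * G2 + F1 * G1 + F2 * G z),
  (fun w => F z * s w + G z * r w + w * (F1 * (G2 + s w) + G1 * (F2 + r w))
     + w * (w * ((F2 + r w) * (G2 + s w)))).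
split; last by move=> w; rewrite rE sE; ring.
have I : clim nbhs0 id 0 by exact: cvg_id.
have K := clim_cst FN.
have := climD FN (climD FN (climD FN (climM FN (K (F z)) s0) (climM FN (K (G z)) r0))
   (climM FN I (climD FN (climM FN (K F1) (climD FN (K G2) s0))
     (climM FN (K G1) (climD FN (K F2) r0)))))
   (climM FN I (climM FN I (climM FN (climD FN (K F2) r0) (climD FN (K G2) s0)))).
by rewrite !mulr0 !mul0r !addr0.
Qed.

Lemma taylor2_affineV (p q : R[i]) z : p + q * z != 0 ->
  taylor2 (fun a => (p + q * a)^-1) z.
Proof.
set c := p + q * z => c0.
have c2 : 0 < normc c / 2 by rewrite divr_gt0// normc_gt0.
pose d := normc c / 2 / (normc q + 1).
have q1 : 0 < normc q + 1 by rewrite ltr_wpDl ?normc_ge0.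
have d0 : 0 < d by rewrite divr_gt0.
apply: (@taylor2_bound _ _ (- q / c ^+ 2) (q ^+ 2 / c ^+ 3)
  ((normc (q / c)) ^+ 3 * (normc c / 2)^-1) d) => // w wd.
have cw : normc c / 2 <= normc (c + q * w).
  apply: le_trans (ler_normcD_sub _ _).
  rewrite lerBrDr -lerBrDl (_ : normc c - normc c / 2 = normc c / 2); last by field.
  rewrite normcM (@le_trans _ _ ((normc q + 1) * d))//; last first.
    by rewrite mulrC divfK// gt_eqF.
  by rewrite ler_pM ?normc_ge0// lerDl.
have cw0 : c + q * w != 0 by rewrite -normc_gt0 (lt_le_trans c2).
have -> : (p + q * (z + w))^-1 - c^-1 - - q / c ^+ 2 * w - q ^+ 2 / c ^+ 3 * w ^+ 2
    = - ((q / c) ^+ 3 * (c + q * w)^-1) * w ^+ 3.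
  have -> : p + q * (z + w) = c + q * w by rewrite /c; ring.
  by field; rewrite c0 cw0.
rewrite normcM normcNC normcM normcV !normcX ler_wpM2r ?exprn_ge0 ?normc_ge0//.
by rewrite ler_wpM2l ?exprn_ge0 ?normc_ge0// lef_pV2 ?posrE// normc_gt0.
Qed.

Lemma taylor2_continuous F z : taylor2 F z ->
  forall e : R, 0 < e -> exists2 d : R, 0 < d &
    forall w, normc w < d -> normc (F (z + w) - F z) < e.
Proof.
move=> [F1 [F2 [r [r0 rE]]]].
apply/cvg0_normcP.
have I : clim nbhs0 id 0 by exact: cvg_id.
have K := clim_cst FN.
have := climD FN (climM FN (K F1) I) (climM FN (climD FN (K F2) r0) (climM FN I I)).
rewrite !mulr0 addr0; congr (clim _ _ _); apply/funext => w; rewrite rE; ring.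
Qed.

Lemma taylor2_derivable F z : taylor2 F z -> derivable (F : R[i]^o -> R[i]^o) z 1.
Proof.
move=> [F1 [F2 [r [r0 rE]]]]; apply/cvg_ex; exists F1.
pose B : set_system R[i] := dnbhs (0 : R[i]^o).
have FB : Filter B := dnbhs_filter (0 : R[i]^o).
have I : clim B id 0 by exact: cvg_within.
have r0' : clim B r 0 by exact: cvg_within_filter r0.
have K := clim_cst FB.
have := climD FB (K F1) (climM FB (climD FB (K F2) r0') I).
rewrite mulr0 addr0 => H; apply: cvg_trans H.
apply: near_eq_cvg; near=> w.
have w0 : w != 0 by near: w; exact: nbhs_dnbhs_neq.
rewrite /GRing.scale/= mulr1 [w + z]addrC rE; field; exact: w0.
Unshelve. all: end_near. Qed.

(** Averaging the expansion over the four directions [1, -1, i, -i] cancels the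
    terms of orders 1 and 2, so [normc F] is almost subharmonic at [z]. *)
Lemma taylor2_mean F z : taylor2 F z -> forall e : R, 0 < e ->
  exists2 d : R, 0 < d & forall s : R, 0 < s < d ->
   4 * normc (F z) <= normc (F (z + s%:C)) + normc (F (z - s%:C))
     + normc (F (z + s *i)) + normc (F (z - s *i)) + 4 * e * s ^+ 2.
Proof.
move=> [F1 [F2 [r [/cvg0_normcP r0 rE]]]] e e0; have [d d0 Hd] := r0 _ e0.
exists d => // s /andP[s0 sd].
have nr : normc s%:C = s by rewrite normc_real ger0_norm ?ltW.
have ni : normc (s *i) = s by rewrite /normc expr0n/= add0r sqrtr_sqr ger0_norm ?ltW.
have i2 : (s *i) ^+ 2 = - (s%:C ^+ 2) :> R[i].
  by rewrite !expr2; apply: complex_ext => /=; ring.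
have E : 4 * F z = F (z + s%:C) + F (z - s%:C) + F (z + s *i) + F (z - s *i)
   - (r s%:C + r (- s%:C) - r (s *i) - r (- (s *i))) * s%:C ^+ 2.
  by rewrite !rE !sqrrN i2; ring.
have -> : 4 * normc (F z) = normc (4 * F z).
  by rewrite normcM normc_nat.
rewrite E; apply: le_trans (normcB _ _) _; apply: lerD.
  by do 3 (apply: le_trans (normcD _ _) _; apply: lerD => //).
rewrite normcM normcX nr ler_wpM2r ?sqr_ge0//.
have b w : normc w = s -> normc (r w) <= e by move=> ws; rewrite ltW// Hd ?ws.
rewrite (_ : 4 * e = e + e + e + e); last by ring.
apply: le_trans (normcB _ _) _; apply: lerD; last by apply: b; rewrite normcNC.
apply: le_trans (normcB _ _) _; apply: lerD; last exact: b.
by apply: le_trans (normcD _ _) _; apply: lerD; apply: b; rewrite ?normcNC.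
Qed.

End SecondOrderExpansion.

Section MaximumPrinciple.
Variable R : realType.
Implicit Types (F : R[i] -> R[i]) (z w a : R[i]) (x y : R).

Lemma ler_dist_normc z w : `|normc z - normc w| <= normc (w - z).
Proof.
rewrite ler_norml lerNl opprB !lerBlDr; apply/andP; split.
  by rewrite -[in leLHS](subrK z w) normcD.
by rewrite normc_distC -[in leLHS](subrK w z) normcD.
Qed.

Lemma continuous_taylor2 F (x y : R) : taylor2 F (x +i* y) ->
  {for (x, y), continuous (fun p : R * R => normc (F (p.1 +i* p.2)))}.
Proof.
move=> /taylor2_continuous Fc; apply/cvgrPdist_lt => /= e e0.
have [d d0 Hd] := Fc _ e0.
have d2 : 0 < d / 2 by rewrite divr_gt0.
exists (ball x (d / 2), ball y (d / 2)) => /=.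
  by split; exact: nbhsx_ballx.
move=> -[x' y'] [/= xx yy].
move: xx yy; rewrite /ball/= => xx yy.
have w : normc ((x' - x) +i* (y' - y)) < d.
  rewrite (le_lt_trans (normc_le_ReIm _))//= [d]splitr.
  by rewrite ltrD// distrC.
have := Hd _ w.
have -> : x +i* y + ((x' - x) +i* (y' - y)) = x' +i* y'.
  by apply: complex_ext => /=; rewrite ?ReImE/=; ring.
apply: le_lt_trans.
exact: ler_dist_normc.
Qed.

(** Adding [dl |z|^2] with small [dl > 0] makes the modulus strictly subharmonic:
    at an interior maximum [taylor2_mean] with error [dl / 2] would be violated.
    Hence the maximum of the perturbed function is on the boundary. *)
Lemma maximum_principle_rectangle F (x0 x1 y0 y1 M : R) : x0 <= x1 -> y0 <= y1 ->
  (forall x y, x0 <= x <= x1 -> y0 <= y <= y1 -> taylor2 F (x +i* y)) ->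
  (forall x y, x0 <= x <= x1 -> y0 <= y <= y1 ->
     [|| x == x0, x == x1, y == y0 | y == y1] -> normc (F (x +i* y)) <= M) ->
  forall x y, x0 <= x <= x1 -> y0 <= y <= y1 -> normc (F (x +i* y)) <= M.
Proof.
move=> x01 y01 TF FM x y xI yI.
pose B := `|x0| + `|x1| + (`|y0| + `|y1|).
apply/ler_addgt0Pr => e e0.
pose dl := e / (B ^+ 2 + B ^+ 2 + 1).
have B0 : 0 <= B by rewrite !addr_ge0.
have BB : 0 < B ^+ 2 + B ^+ 2 + 1 by rewrite ltr_wpDl// addr_ge0 ?sqr_ge0.
have dl0 : 0 < dl by rewrite divr_gt0.
pose u (p : R * R) := normc (F (p.1 +i* p.2)) + dl * (p.1 ^+ 2 + p.2 ^+ 2).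
have cK : compact (`[x0, x1]%classic `*` `[y0, y1]%classic : set (R * R)).
  by apply: compact_setX; exact: segment_compact.
have K0 : (`[x0, x1]%classic `*` `[y0, y1]%classic : set (R * R)) !=set0.
  by exists (x, y); split; rewrite /= in_itv.
have cu : {within `[x0, x1]%classic `*` `[y0, y1]%classic, continuous u}.
  apply: continuous_in_subspaceT => -[a b] /set_mem[/=]; rewrite !in_itv/= => aI bI.
  have c1 : {for (a, b), continuous (fun p : R * R => p.1 : R)} by exact: cvg_fst.
  have c2 : {for (a, b), continuous (fun p : R * R => p.2 : R)} by exact: cvg_snd.
  apply: cvgD; first exact: continuous_taylor2 (TF _ _ aI bI).
  by apply: cvgMr; apply: cvgD; rewrite expr2; under eq_fun do rewrite expr2; exact: cvgM.
have [[a b] /set_mem[/= aI bI] umax] := compact_EVT_max K0 cK cu.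
rewrite !in_itv/= in aI bI.
have {}umax x' y' : x0 <= x' <= x1 -> y0 <= y' <= y1 -> u (x', y') <= u (a, b).
  by move=> ? ?; apply: umax; rewrite inE; split; rewrite /= in_itv.
have sq_le (l r t : R) : l <= t <= r -> `|l| + `|r| <= B -> t ^+ 2 <= B ^+ 2.
  move=> /andP[lt tr] lrB; rewrite -[t ^+ 2]real_normK ?num_real//.
  rewrite ler_pXn2r ?nnegrE// (le_trans _ lrB)// ler_norml; apply/andP; split.
    by rewrite lerNl (le_trans _ (_ : `|l| <= _))// ?lerDl// ler_normr lerN2 lt orbT.
  by rewrite (le_trans tr)// (le_trans (ler_norm _))// lerDr.
have uab : u (a, b) <= M + e.
  have [bd|] := boolP [|| a == x0, a == x1, b == y0 | b == y1].
    rewrite lerD ?FM//.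
    have ab2 : a ^+ 2 + b ^+ 2 <= B ^+ 2 + B ^+ 2.
      by apply: lerD; [apply: sq_le aI _|apply: sq_le bI _]; rewrite /B ?lerDl ?lerDr addr_ge0.
    rewrite (@le_trans _ _ (dl * (B ^+ 2 + B ^+ 2 + 1)))//.
      by rewrite ler_pM2l// (le_trans ab2)// lerDl.
    by rewrite /dl divfK// gt_eqF.
  rewrite !negb_or => /and4P[ax0 ax1 by0 by1].
  exfalso.
  have [/andP[aI0 aI1] /andP[bI0 bI1]] := (aI, bI).
  have a0 : x0 < a by rewrite lt_def ax0.
  have a1 : a < x1 by rewrite lt_def eq_sym ax1.
  have b0 : y0 < b by rewrite lt_def by0.
  have b1 : b < y1 by rewrite lt_def eq_sym by1.
  have dl2 : 0 < dl / 2 by rewrite divr_gt0.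
  have [d d0 Hd] := taylor2_mean (TF _ _ aI bI) dl2.
  pose s := Num.min (d / 2) (Num.min (Num.min (a - x0) (x1 - a)) (Num.min (b - y0) (y1 - b))).
  have s0 : 0 < s by rewrite !lt_min !subr_gt0 a0 a1 b0 b1 divr_gt0.
  have [sd [sa0 sa1 sb0 sb1]] : s <= d / 2 /\ [/\ s <= a - x0, s <= x1 - a, s <= b - y0 & s <= y1 - b].
    by rewrite /s !ge_min !lexx !orbT.
  have sd' : 0 < s < d by rewrite s0 (le_lt_trans sd)// ltr_pdivrMr// ltr_pMr// ltr1n.
  have := Hd _ sd'.
  have -> : a +i* b + s%:C = (a + s) +i* b by apply: complex_ext; rewrite !ReImE/= ?addr0.
  have -> : a +i* b - s%:C = (a - s) +i* b by apply: complex_ext; rewrite !ReImE/= ?subr0.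
  have -> : a +i* b + s *i = a +i* (b + s) by apply: complex_ext; rewrite !ReImE/= ?addr0.
  have -> : a +i* b - s *i = a +i* (b - s) by apply: complex_ext; rewrite !ReImE/= ?subr0.
  have U1 : u (a + s, b) <= u (a, b) by apply: umax => //; apply/andP; split; lra.
  have U2 : u (a - s, b) <= u (a, b) by apply: umax => //; apply/andP; split; lra.
  have U3 : u (a, b + s) <= u (a, b) by apply: umax => //; apply/andP; split; lra.
  have U4 : u (a, b - s) <= u (a, b) by apply: umax => //; apply/andP; split; lra.
  have s2 : 0 < dl * s ^+ 2 by rewrite mulr_gt0// exprn_gt0.
  move: U1 U2 U3 U4; rewrite /u/=.
  move: (normc _) (normc _) (normc _) (normc _) (normc _) => n1 n2 n3 n4 n5.
  move: s2; set A := dl * s ^+ 2 => s2 U1 U2 U3 U4 H.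
  have E1 : dl * ((a + s) ^+ 2 + b ^+ 2) + dl * ((a - s) ^+ 2 + b ^+ 2)
     + dl * (a ^+ 2 + (b + s) ^+ 2) + dl * (a ^+ 2 + (b - s) ^+ 2)
     = 4 * (dl * (a ^+ 2 + b ^+ 2)) + 4 * A by rewrite /A; ring.
  have E2 : 4 * (dl / 2) * s ^+ 2 = 2 * A by rewrite /A; field.
  by lra.
apply: le_trans (le_trans (umax _ _ xI yI) uab).
by rewrite lerDl mulr_ge0 ?(ltW dl0)// addr_ge0 ?sqr_ge0.
Qed.

End MaximumPrinciple.

(** * A Phragmen-Lindelof principle for half planes *)

Section PhragmenLindelof.
Variable R : realType.
Implicit Types (a : R[i]).

(** Divide by [(1 + ep (c - a))^2], of modulus at least 1 in the half plane; the
    quotient tends to 0 at infinity because [H] grows at most linearly.  The maximum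
    principle on a large rectangle bounds the quotient by [M], and [ep] is small. *)
Lemma phragmen_lindelof (H : R[i] -> R[i]) (c M A : R) : 0 < M -> 0 <= A ->
  (forall a, Re a <= c -> taylor2 H a) ->
  (forall a, Re a = c -> normc (H a) <= M) ->
  (forall a, Re a <= c -> normc (H a) <= A * (1 + normc (c%:C - a))) ->
  forall a, Re a <= c -> normc (H a) <= M.
Proof.
move=> M0 A0 TH HM HA a0 ha0.
set D0 := normc (c%:C - a0).
have D00 : 0 <= D0 by exact: normc_ge0.
apply/ler_addgt0Pr => e e0.
have M3 : 0 < 3 * M + e by rewrite addr_gt0// mulr_gt0.
have D1 : 0 < D0 + 1 by rewrite ltr_wpDl.
have [ep ep0 epE] : exists2 ep, 0 < ep & ep = e / ((3 * M + e) * (D0 + 1)).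
  by eexists; last reflexivity; rewrite divr_gt0// mulr_gt0.
pose v a : R[i] := (1 + ep * c)%:C + (- ep)%:C * a.
have vE a : v a = 1 + ep%:C * (c%:C - a).
  by rewrite /v rmorphD/= rmorphM rmorphN rmorph1/=; ring.
have Rev a : Re (v a) = 1 + ep * (c - Re a).
  by rewrite vE !ReImE/=; ring.
have Imv a : Im (v a) = - (ep * Im a).
  by rewrite vE !ReImE/=; ring.
have v1 a : Re a <= c -> 1 <= normc (v a).
  move=> ac; apply: le_trans (Re_le_normc _); rewrite Rev.
  by rewrite (le_trans _ (ler_norm _))// lerDl mulr_ge0 ?(ltW ep0)// subr_ge0.
have vD a : Re a <= c -> ep * normc (c%:C - a) <= normc (v a).
  move=> ac; rewrite -(@ler_pXn2r _ 2) ?nnegrE ?normc_ge0 ?mulr_ge0 ?(ltW ep0) ?normc_ge0//.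
  rewrite exprMn !normc_sqr Rev Imv !ReImE/= sub0r.
  have : 0 <= ep * (c - Re a) by rewrite mulr_ge0 ?(ltW ep0)// subr_ge0.
  set X := c - Re a; move=> epX.
  have -> : (1 + ep * X) ^+ 2 + (- (ep * Im a)) ^+ 2 =
     ep ^+ 2 * (X ^+ 2 + (- Im a) ^+ 2) + (1 + 2 * (ep * X)) by ring.
  by rewrite lerDl addr_ge0// mulr_ge0.
have vN0 a : Re a <= c -> v a != 0.
  by move=> ac; rewrite -normc_gt0 (lt_le_trans ltr01)// v1.
pose F a := H a * ((v a)^-1 * (v a)^-1).
have TF a : Re a <= c -> taylor2 F a.
  move=> ac; apply: taylor2M; first exact: TH.
  by apply: taylor2M; apply: taylor2_affineV; exact: vN0.
have NF a : normc (F a) = normc (H a) / normc (v a) ^+ 2.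
  by rewrite /F !normcM normcV -invfM -expr2.
(* beyond distance [L] the quadratic denominator beats the linear growth of [H] *)
pose L := Num.max D0 (Num.max 1 (2 * A / (ep ^+ 2 * M))).
have [LD [L1 LA]] : D0 <= L /\ 1 <= L /\ 2 * A / (ep ^+ 2 * M) <= L.
  by rewrite /L !le_max !lexx !orbT.
have L0 : 0 < L by exact: lt_le_trans L1.
have far a : Re a <= c -> L <= normc (c%:C - a) -> normc (F a) <= M.
  move=> ac; rewrite NF; move: (HA _ ac) (vD _ ac); move: (normc (c%:C - a)) => D HD epD La.
  have D_1 : 1 <= D by exact: le_trans La.
  have D_0 : 0 < D by exact: lt_le_trans D_1.
  rewrite ler_pdivrMr ?exprn_gt0 ?normc_gt0 ?vN0//.
  rewrite (le_trans HD)// (@le_trans _ _ (A * (2 * D)))//.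
    by rewrite ler_wpM2l//; lra.
  rewrite (@le_trans _ _ (M * (ep * D) ^+ 2))//; last first.
    rewrite ler_pM2l// ler_pXn2r ?nnegrE ?normc_ge0//.
    by rewrite mulr_ge0// ltW.
  have : 2 * A / (ep ^+ 2 * M) <= D by exact: le_trans LA La.
  rewrite ler_pdivrMr ?mulr_gt0 ?exprn_gt0// => H1.
  have := ler_wpM2r (ltW D_0) H1.
  have -> : A * (2 * D) = 2 * A * D by ring.
  by have -> : M * (ep * D) ^+ 2 = D * (ep ^+ 2 * M) * D by ring.
have Fa0 : normc (F a0) <= M.
  have -> : a0 = Re a0 +i* Im a0 by case: (a0).
  have ReD0 : `|c - Re a0| <= D0 by have := Re_le_normc (c%:C - a0); rewrite !ReImE.
  have ImD0 : `|Im a0| <= D0.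
    by have := Im_le_normc (c%:C - a0); rewrite !ReImE sub0r normrN.
  apply: (@maximum_principle_rectangle _ F (c - L) c (- L) L M).
  - by rewrite lerBlDr lerDl ltW.
  - by rewrite (@le_trans _ _ 0)// ?oppr_le0 ltW.
  - by move=> x y /andP[_ xc] _; exact: TF.
  - move=> x y /andP[xl xc] _ /or4P[] /eqP E.
    + apply: far => //=; apply: le_trans (Re_le_normc _); rewrite !ReImE/= E.
      by rewrite (le_trans _ (ler_norm _))//; lra.
    + rewrite NF ler_pdivrMr ?exprn_gt0 ?normc_gt0 ?vN0//= (le_trans (HM _ _))//.
      by rewrite ler_peMr ?(ltW M0)// exprn_ege1// v1.
    + apply: far => //=; apply: le_trans (Im_le_normc _); rewrite !ReImE/= E.
      by rewrite (le_trans _ (ler_norm _))//; lra.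
    + apply: far => //=; apply: le_trans (Im_le_normc _); rewrite !ReImE/= E sub0r normrN.
      by rewrite (le_trans _ (ler_norm _)).
  - rewrite ha0 andbT; have := le_trans (ler_norm _) (le_trans ReD0 LD); lra.
  - by rewrite -ler_norml (le_trans ImD0).
move: Fa0; rewrite NF ler_pdivrMr ?exprn_gt0 ?normc_gt0 ?vN0// => /le_trans; apply.
have epD : ep * D0 <= e / (3 * M + e).
  rewrite epE invfM mulrA -mulrA ler_piMr ?divr_ge0 ?(ltW e0) ?(ltW M3)//.
  by rewrite mulrC ler_pdivrMr// mul1r lerDl.
have vle : normc (v a0) <= 1 + ep * D0.
  rewrite vE (le_trans (normcD _ _))// normc1 normcM normc_real ger0_norm// ltW//.
have x1 : e / (3 * M + e) <= 1 by rewrite ler_pdivrMr// mul1r lerDr mulr_ge0// ltW.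
have x0 : 0 <= e / (3 * M + e) by rewrite divr_ge0 ?ltW.
set x := e / (3 * M + e) in epD x1 x0.
have v2 : normc (v a0) ^+ 2 <= 1 + 3 * x.
  rewrite (@le_trans _ _ ((1 + x) ^+ 2))//; last by nra.
  rewrite ler_pXn2r ?nnegrE ?normc_ge0 ?addr_ge0//.
  by rewrite (le_trans vle)// lerD2l.
rewrite (le_trans (ler_wpM2l (ltW M0) v2))//.
rewrite mulrDr mulr1 lerD2l /x mulrA mulrA ler_pdivrMr//.
nra.
Qed.

End PhragmenLindelof.

(** * The Mellin integral beyond 1 *)

Section Tail.
Variable R : realType.
Local Notation mu := (@lebesgue_measure R).
Local Notation cint := (cint (@lebesgue_measure R)).
Local Notation cintegrable := (cintegrable (@lebesgue_measure R)).
Implicit Types (q : R) (a w : R[i]).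
Local Notation h := (2^-1 : R).

Lemma itv1y_gt1 q : `]1, +oo[%classic q -> 1 < q.
Proof. by rewrite /= in_itv/= andbT. Qed.

Lemma integrable_powR_tail (b : R) : b < -1 ->
  mu.-integrable `]1, +oo[ (fun q => (q `^ b)%:E).
Proof.
move=> b1; apply: integrableS (integrable_powR_1y b1) => // x /=.
by rewrite !in_itv/= !andbT => /ltW.
Qed.

Let e9 : R := - (9 / 8).

Let ie9 : mu.-integrable `]1, +oo[ (fun q => (q `^ e9)%:E).
Proof. by apply: integrable_powR_tail; rewrite /e9; lra. Qed.

Lemma norm_osc_tail a q : Re a <= 4^-1 -> 1 < q ->
  normc (osc pi a q) <= q `^ (- (5 / 4)).
Proof.
move=> ha q1; have q0 : 0 < q by exact: lt_trans q1.
rewrite normcM normc_real normc_cpowR// !ReImE.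
rewrite -[leRHS]mul1r ler_pM ?powR_ge0// ?sin_max// ler_powR ?(ltW q1)//.
lra.
Qed.

Let root_ln q : 1 < q -> 0 <= ln q <= 32 * q `^ 32^-1.
Proof.
move=> q1; have q0 : 0 < q by exact: lt_trans q1.
rewrite ln_ge0 ?(ltW q1)//= mulrC -ler_pdivrMr// mulrC -ln_powR.
by rewrite ltW// ln_sublinear// powR_gt0.
Qed.

(** Here [q^(1/32)] stands for a logarithm, up to a constant.  The exponent [-5/4]
    of the kernel leaves room for four of them: three from a Taylor remainder, one
    from an exponential factor. *)
Let kernel_ln a q (k : nat) : (k <= 4)%N -> Re a <= 4^-1 -> 1 < q ->
  normc (osc pi a q) * (q `^ 32^-1) ^+ k <= q `^ e9.
Proof.
move=> k4 ha q1; have q0 : 0 < q by exact: lt_trans q1.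
rewrite (@le_trans _ _ (q `^ (- (5 / 4)) * (q `^ 32^-1) ^+ k))//.
  by rewrite ler_wpM2r ?exprn_ge0 ?powR_ge0// norm_osc_tail.
rewrite -powR_mulrn ?powR_ge0// -powRrM -powRD ?(gt_eqF q0) ?implybT//.
rewrite ler_powR ?(ltW q1)// /e9.
have : (k%:R : R) <= 4 by rewrite ler_nat.
lra.
Qed.

Lemma cintegrable_osc_tail a : Re a <= 4^-1 -> cintegrable `]1, +oo[ (osc pi a).
Proof.
move=> ha; apply: (@cintegrable_le _ _ R mu _ _ (fun q => q `^ e9)) => //.
- exact: cmeas_osc.
- by move=> q /itv1y_gt1 q1; have := @kernel_ln a q 0 isT ha q1; rewrite expr0 mulr1.
Qed.

Definition tail a : R[i] := cint `]1, +oo[ (osc pi a).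

Let Bd := 2 * \int[mu]_(q in `]1, +oo[) (q `^ e9).

Let Bd_ge0 : 0 <= Bd.
Proof. by rewrite mulr_ge0// Rintegral_ge0// => q _; exact: powR_ge0. Qed.

Lemma tail_bounded : exists2 B : R, 0 <= B & forall a, Re a <= 4^-1 -> normc (tail a) <= B.
Proof.
exists Bd => // a ha; apply: normc_cint_le => //.
- exact: cintegrable_osc_tail.
- by move=> q /itv1y_gt1 q1; have := @kernel_ln a q 0 isT ha q1; rewrite expr0 mulr1.
Qed.

Let oscD a w q : osc pi (a + w) q = osc pi a q * cexp (w * (ln q)%:C).
Proof.
rewrite /osc -mulrA; congr (_ * _).
by rewrite -/(cpow q w) -cpowD; congr cpow; ring.
Qed.

Let cmeas_ln D : cmeas D (fun q : R => (ln q)%:C).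
Proof. by apply: cmeas_real; apply: measurable_funTS; exact: measurable_ln. Qed.

Let cintegrable_osc_ln a : Re a <= 4^-1 -> cintegrable `]1, +oo[ (fun q => osc pi a q * (ln q)%:C).
Proof.
move=> ha; apply: (@cintegrable_le _ _ R mu _ _ (fun q => 32 * q `^ e9)) => //.
- by apply: cmeasM; [exact: cmeas_osc|exact: cmeas_ln].
- exact: integrable_scale.
- move=> q /itv1y_gt1 q1; have /andP[l0 l1] := root_ln q1.
  rewrite normcM normc_real ger0_norm//.
  rewrite (le_trans (ler_wpM2l (normc_ge0 _) l1))// mulrCA ler_pM2l//.
  by have := @kernel_ln a q 1 isT ha q1; rewrite expr1.
Qed.

Let cintegrable_osc_ln2 a : Re a <= 4^-1 ->
  cintegrable `]1, +oo[ (fun q => osc pi a q * (ln q)%:C * (ln q)%:C).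
Proof.
move=> ha; apply: (@cintegrable_le _ _ R mu _ _ (fun q => 32 ^+ 2 * q `^ e9)) => //.
- by apply: cmeasM; [apply: cmeasM; [exact: cmeas_osc|exact: cmeas_ln]|exact: cmeas_ln].
- exact: integrable_scale.
- move=> q /itv1y_gt1 q1; have /andP[l0 l1] := root_ln q1.
  rewrite -mulrA normcM -rmorphM/= normc_real -expr2 ger0_norm ?sqr_ge0//.
  rewrite (@le_trans _ _ (normc (osc pi a q) * (32 * q `^ 32^-1) ^+ 2))//.
    by rewrite ler_wpM2l ?normc_ge0// ler_pXn2r ?nnegrE// mulr_ge0// powR_ge0.
  by rewrite exprMn mulrCA ler_pM2l ?exprn_gt0// kernel_ln.
Qed.

(** Expand [q^w = exp(w ln q)] under the integral sign; the remainder is bounded by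
    the third power of [w ln q], and [q^(1/32)] absorbs the exponential factor. *)
Lemma taylor2_tail a : Re a <= 4^-1 -> taylor2 tail a.
Proof.
move=> ha.
pose F1 := cint `]1, +oo[ (fun q => osc pi a q * (ln q)%:C).
pose F2 := 2^-1 * cint `]1, +oo[ (fun q => osc pi a q * (ln q)%:C * (ln q)%:C).
have i0 := cintegrable_osc_tail ha.
have i1 := cintegrable_osc_ln ha.
have i2 := cintegrable_osc_ln2 ha.
apply: (@taylor2_bound _ _ _ F1 F2 (8 * 32 ^+ 3 * Bd) 32^-1); first by rewrite invr_gt0.
move=> w wd.
pose rest q := osc pi a q *
  (cexp (w * (ln q)%:C) - 1 - w * (ln q)%:C - (w * (ln q)%:C) ^+ 2 / 2).
have nrest q : 1 < q -> normc (rest q) <= 8 * 32 ^+ 3 * normc w ^+ 3 * q `^ e9.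
  move=> q1; have q0 : 0 < q by exact: lt_trans q1.
  have /andP[l0 l1] := root_ln q1.
  rewrite normcM (le_trans (ler_wpM2l (normc_ge0 _) (cexp_taylor3 _)))//.
  have nL : normc (w * (ln q)%:C) = normc w * ln q by rewrite normcM normc_real ger0_norm.
  rewrite nL exprMn.
  have ex : expR (normc w * ln q) <= q `^ 32^-1.
    by rewrite /powR gt_eqF// ler_expR ler_wpM2r.
  have l3 : ln q ^+ 3 <= 32 ^+ 3 * (q `^ 32^-1) ^+ 3.
    by rewrite -exprMn ler_pXn2r ?nnegrE// mulr_ge0// powR_ge0.
  have K := @kernel_ln a q 4 isT ha q1.
  have w3 : 0 <= normc w ^+ 3 by rewrite exprn_ge0 ?normc_ge0.
  rewrite (@le_trans _ _ (normc (osc pi a q) * (8 * (normc w ^+ 3 * (32 ^+ 3 * (q `^ 32^-1) ^+ 3) * q `^ 32^-1))))//.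
    rewrite ler_wpM2l ?normc_ge0// ler_pM2l// ler_pM ?expR_ge0//.
      by rewrite mulr_ge0// exprn_ge0.
    by rewrite ler_wpM2l.
  rewrite (_ : _ * (8 * _) = 8 * 32 ^+ 3 * normc w ^+ 3 * (normc (osc pi a q) * (q `^ 32^-1) ^+ 4)); last by ring.
  by rewrite ler_wpM2l// mulr_ge0.
have irest : cintegrable `]1, +oo[ rest.
  apply: (@cintegrable_le _ _ R mu _ _ (fun q => 8 * 32 ^+ 3 * normc w ^+ 3 * q `^ e9)) => //.
  - apply: cmeasM; first exact: cmeas_osc.
    pose D1 : set R := `]1, +oo[%classic.
    have ml : cmeas D1 (fun q : R => (ln q)%:C) := @cmeas_ln D1.
    have mw : cmeas D1 (fun q : R => w * (ln q)%:C) by apply: cmeasM => //; exact: cmeas_cst.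
    apply: cmeasB.
      apply: cmeasB => //; apply: cmeasB; last exact: cmeas_cst.
      have me := @cmeas_cpow _ _ R (fun q : R => q) D1 w (@measurable_id _ _ _).
      exact: me.
    apply: cmeasM; last exact: cmeas_cst.
    exact: (cmeasM mw mw).
  - exact: integrable_scale.
  - by move=> q /itv1y_gt1; exact: nrest.
have E : tail (a + w) - tail a - F1 * w - F2 * w ^+ 2 = cint `]1, +oo[ rest.
  have -> : tail (a + w) = cint `]1, +oo[ (fun q => (osc pi a q + w * (osc pi a q * (ln q)%:C))
      + (w ^+ 2 / 2 * (osc pi a q * (ln q)%:C * (ln q)%:C) + rest q)).
    by apply: eq_cint => q _; rewrite oscD /rest; field.
  rewrite cintD//; last 2 first.
  - by apply: cintegrableD => //; exact: cintegrableZ.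
  - by apply: cintegrableD => //; exact: cintegrableZ.
  rewrite cintD//; last exact: cintegrableZ.
  rewrite cintD//; last exact: cintegrableZ.
  by rewrite !cintZ// -/(tail a) /F1 /F2; field.
rewrite E (le_trans (normc_cint_le _ irest _ (fun q qI => nrest q (itv1y_gt1 qI))))//.
  exact: integrable_scale.
rewrite RintegralZl// /Bd le_eqVlt; apply/orP; left; apply/eqP; ring.
Qed.

End Tail.

(** * Series as integrals for the counting measure *)

(** Fubini's theorem asks for a sigma-finite measure in the sense of this structure. *)
HB.instance Definition _ (R : realType) :=
  @Measure_isSigmaFinite.Build _ _ _ (@counting nat R) (sigma_finite_counting R).

Section CountingIntegral.
Variable R : realType.
Local Notation nu := (@counting nat R).
Implicit Types (f : nat -> R) (c : nat -> R[i]).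

(** The product is a countable union of slices. *)
Lemma measurable_fun_prod_nat (f : R -> nat -> R) : (forall n, measurable_fun setT (f ^~ n)) ->
  measurable_fun setT (fun p : R * nat => f p.1 p.2).
Proof.
move=> mf.
have -> : [set: R * nat] = \bigcup_n ([set: R] `*` [set n]).
  by apply/seteqP; split=> // -[x n] _; exists n.
apply/measurable_fun_bigcup.
  by move=> n; apply: measurableX => //.
move=> n; apply: (@eq_measurable_fun _ _ _ _ _ (fun p : R * nat => f p.1 n)).
  by move=> -[x m]; rewrite inE => -[_ /= ->].
apply: measurable_funTS.
exact: (measurableT_comp (mf n) measurable_fst).
Qed.

Lemma integrable_exp_coeff (x : R) : 0 <= x ->
  nu.-integrable setT (fun n => (exp_coeff x n)%:E).
Proof.
move=> x0; apply/integrableP; split=> //.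
rewrite ge0_integral_count; last by move=> k; exact: abse_ge0.
rewrite (@eq_eseriesr _ _ (fun k => (exp_coeff x k)%:E)).
  rewrite (_ : (fun n => _) = EFin \o series (exp_coeff x)); last first.
    by apply/funext => n; rewrite /= -sumEFin.
  by rewrite EFin_lim ?ltry//; exact: is_cvg_series_exp_coeff.
by move=> k _ /=; rewrite ger0_norm// exp_coeff_ge0.
Qed.

Lemma Rintegral_counting f l : nu.-integrable setT (fun n => (f n)%:E) ->
  series f @ \oo --> l -> \int[nu]_n f n = l.
Proof.
move=> /integrableP[_ fi] fl; rewrite /Rintegral integral_count.
  rewrite (_ : (fun n => _) = EFin \o series f); last first.
    by apply/funext => n; rewrite /= -sumEFin.
  by rewrite EFin_lim; [exact: cvg_lim fl|apply/cvg_ex; exists l].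
move: fi; rewrite ge0_integral_count; last by move=> k; exact: abse_ge0.
by rewrite nneseries_esum// => H; rewrite /summable; move: H; rewrite (_ : [set _ | _] = setT)//; apply/seteqP; split.
Qed.

(** Terms of exponential series as majorants: summable, and stable under
    multiplication by polynomials in [n] because [n + 1 <= 2^(n + 1)]. *)
Definition factorial_decay c := exists A x : R, [/\ 0 <= A, 0 <= x &
  forall n, normc (c n) <= A * exp_coeff x n].

Lemma integrable_factorial_decay c : factorial_decay c ->
  nu.-integrable setT (fun n => (normc (c n))%:E).
Proof.
move=> [A [x [A0 x0 cA]]].
apply: (@integrable_le _ _ R nu _ _ (fun n => A * exp_coeff x n)) => //.
  by apply: integrable_scale => //; exact: integrable_exp_coeff.
by move=> n _; rewrite ger0_norm ?normc_ge0.
Qed.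

Lemma factorial_decay_le c d (B : R) : factorial_decay c -> 0 <= B ->
  (forall n, normc (d n) <= B * (n.+1%:R * normc (c n))) -> factorial_decay d.
Proof.
move=> [A [x [A0 x0 cA]]] B0 dc; exists (B * A * 2), (2 * x); split; rewrite ?mulr_ge0//.
move=> n; apply: le_trans (dc n) _; rewrite -!mulrA ler_wpM2l//.
rewrite (@le_trans _ _ (n.+1%:R * (A * exp_coeff x n)))//; first by rewrite ler_wpM2l.
rewrite mulrCA ler_wpM2l// /exp_coeff/= exprMn.
rewrite [leRHS](_ : _ = 2 ^+ n.+1 * (x ^+ n / n`!%:R)); last by rewrite exprS; ring.
rewrite ler_wpM2r ?divr_ge0 ?exprn_ge0//.
by rewrite -natrX ler_nat ltnW// ltn_expl.
Qed.

End CountingIntegral.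

(** * The Mellin integral up to 1 as a series *)

Section HeadSeries.
Variable R : realType.
Local Notation mu := (@lebesgue_measure R).
Local Notation nu := (@counting nat R).
Implicit Types (q : R) (a : R[i]).
Local Notation h := (2^-1 : R).

Definition sine_coeff n : R[i] := (sin_coeff' (2 * pi : R) n)%:C.

Lemma factorial_decay_sine_coeff : factorial_decay sine_coeff.
Proof.
have [x x0 xE] : exists2 x : R, 0 <= x & 2 * pi = x by exists (2 * pi) => //; rewrite mulr_ge0// pi_ge0.
exists x, (x ^+ 2); split; rewrite ?sqr_ge0// => n.
rewrite /sine_coeff normc_real /sin_coeff' xE /exp_coeff/=.
rewrite normrM normrM normrX normrN1 expr1n mul1r !ger0_norm ?exprn_ge0//.
rewrite [x ^+ _.+1]exprS -mul2n exprM -mulrA ler_wpM2l// ler_wpM2l ?exprn_ge0 ?sqr_ge0//.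
rewrite lef_pV2 ?posrE ?ltr0n ?fact_gt0// ler_nat.
rewrite (@fact_split (2 * n).+1 n); last by rewrite mul2n -addnn -addnS leq_addr.
by rewrite leq_pmulr// big_nat prodn_cond_gt0// => i /andP[/(leq_trans _)->].
Qed.

Let K a q n : R[i] := sine_coeff n * cpow q (n%:R + a - 1).

(** Termwise, the power series of the sine at [2 pi sqrt q]. *)
Let K_expand a q : 0 < q -> cint nu setT (K a q) = osc pi a q.
Proof.
move=> q0; pose u n := sin_coeff' (2 * pi : R) n * q ^+ n.
have r0 : 0 < q `^ h by rewrite powR_gt0.
have r2 : (q `^ h) ^+ 2 = q.
  by rewrite -powR_mulrn ?powR_ge0// -powRrM mulVf// powRr1 ?ltW.
have uE n : u n = sin_coeff' (phase pi q) n / q `^ h.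
  rewrite /u /sin_coeff' /phase !exprMn -mul2n !exprS !exprM r2.
  by field; rewrite gt_eqF//= pnatr_eq0 -lt0n fact_gt0.
have ui : nu.-integrable setT (fun n => (u n)%:E).
  have [A [x [A0 x0 cA]]] := factorial_decay_sine_coeff.
  apply: (@integrable_le _ _ R nu _ _ (fun n => A * exp_coeff (x * q) n)) => //.
    by apply: integrable_scale => //; apply: integrable_exp_coeff; rewrite mulr_ge0 ?(ltW q0).
  move=> n _; rewrite normrM [X in _ * X]ger0_norm ?exprn_ge0 ?(ltW q0)//.
  rewrite /exp_coeff/= exprMn mulrAC mulrA ler_wpM2r ?exprn_ge0 ?(ltW q0)//.
  by have := cA n; rewrite normc_real.
have ul : series u @ \oo --> sin (phase pi q) / q `^ h.
  rewrite (_ : series u = (fun n => series (sin_coeff' (phase pi q)) n / q `^ h)).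
    by apply: cvgMl; exact: cvg_sin_coeff'.
  apply/funext => n; rewrite /series/= big_distrl/=.
  by apply: eq_bigr => i _; rewrite uE.
have -> : cint nu setT (K a q) = cint nu setT (fun n => cpow q (a - 1) * (u n)%:C).
  apply: eq_cint => n _; rewrite /K (_ : n%:R + a - 1 = (a - 1) + n%:R); last by ring.
  by rewrite cpowD cpow_nat// rmorphM/= mulrCA.
rewrite cintZ//; last exact: cintegrable_real.
rewrite cint_real (Rintegral_counting ui ul) /osc.
have -> : cpow q (a - h%:C - 1) = cpow q (a - 1) * ((q `^ h)^-1)%:C.
  rewrite (_ : a - h%:C - 1 = (a - 1) + (- h)%:C); last by rewrite rmorphN/=; ring.
  by rewrite [LHS]cpowD cpow_real mulNr expRN /powR gt_eqF.
by rewrite rmorphM/= mulrCA.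
Qed.

Let norm_K_le a q n : Re a = 4^-1 -> 0 < q <= 1 ->
  normc (K a q n) <= q `^ (- (3 / 4)) * normc (sine_coeff n).
Proof.
move=> ha /andP[q0 q1]; rewrite normcM mulrC ler_wpM2r ?normc_ge0//.
rewrite normc_cpowR// !ReImE ha ?Re_natC.
rewrite ger_powR ?q0//.
have : 0 <= n%:R :> R by [].
by lra.
Qed.

Let K_int a n : Re a = 4^-1 -> cint mu `]0, 1] (K a ^~ n) = sine_coeff n / (n%:R + a).
Proof.
move=> ha.
have Rna : Re (n%:R + a) = n%:R + 4^-1 by rewrite !ReImE ha ?Re_natC.
have n0 : 0 <= n%:R :> R by [].
have na : n%:R + a != 0.
  by apply/eqP => E; move: Rna; rewrite E /=; lra.
pose F q := sine_coeff n / (n%:R + a) * cpow q (n%:R + a).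
rewrite (@cint_FTC_01 _ F).
- by rewrite /F /cpow ln1 mulr0 cexp0 mulr1.
- move=> q q0; apply: cderive_eq (cderiveZ _ (cderive_cpow _ q0)).
  by rewrite /K mulrA divfK.
- move=> q q0; eexists; exact: cderiveZ (cderive_cpow _ q0).
- apply: (@cintegrable_le _ _ R mu _ _ (fun q => normc (sine_coeff n) * q `^ (- (3 / 4)))) => //.
  + by apply: cmeasM; [exact: cmeas_cst|exact: cmeas_cpow].
  + by apply: integrable_scale => //; apply: integrable_powR_01; lra.
  + by move=> q /=; rewrite in_itv/= mulrC; exact: norm_K_le.
- apply: (@cvg0_at0 _ _ (normc (sine_coeff n / (n%:R + a))) 4^-1); first by rewrite invr_gt0.
  move=> q /andP[q0 q1]; rewrite normc_ge0 normcM ler_wpM2l ?normc_ge0//=.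
  by rewrite normc_cpowR// Rna ger_powR ?q0// lerDr.
Qed.

(** Integrate the power series of the sine term by term. *)
Lemma cint_osc_01 a : Re a = 4^-1 ->
  cint mu `]0, 1] (osc pi a) = cint nu setT (fun n => sine_coeff n / (n%:R + a)).
Proof.
move=> ha.
transitivity (cint mu `]0, 1] (fun q => cint nu setT (K a q))).
  by apply: eq_cint => q /=; rewrite in_itv/= => /andP[q0 _]; rewrite K_expand.
pose nus : {sigma_finite_measure set nat -> \bar R} := counting.
apply: etrans (@cint_Fubini _ _ _ _ R mu nus _ _ (K a) (fun q => q `^ (- (3 / 4)))
    (fun n => normc (sine_coeff n)) _ _ _ _ _ _) _ => //; last 1 first.
- by apply: eq_cint => n _; rewrite K_int.
- have mK n D : cmeas D (K a ^~ n).
    by apply: cmeasM; [exact: cmeas_cst|exact: cmeas_cpow].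
  split.
    by apply: (@measurable_fun_prod_nat _ (fun q n => Re (K a q n))) => n; have [] := mK n setT.
  by apply: (@measurable_fun_prod_nat _ (fun q n => Im (K a q n))) => n; have [] := mK n setT.
- by apply: integrable_powR_01; lra.
- by apply: integrable_factorial_decay; exact: factorial_decay_sine_coeff.
- by move=> q n /=; rewrite in_itv/= => q1 _; exact: norm_K_le.
Qed.

End HeadSeries.

(** * Smooth series on the circle *)

Section SmoothSeries.
Variable R : realType.
Local Notation nu := (@counting nat R).
Implicit Types (t : R) (v : R[i]) (c : nat -> R[i]) (n k : nat).

Lemma cderiveV (F : R -> R[i]) t (d : R[i]) : F t != 0 -> cderive F t d ->
  cderive (fun x => (F x)^-1) t (- d / F t ^+ 2).
Proof.
move=> F0 [F1 F2].
pose N x := Re (F x) ^+ 2 + Im (F x) ^+ 2.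
have N0 : N t != 0 by rewrite /N -normc_sqr sqrf_eq0 normc_eq0.
have DN : is_derive t (1 : R) N (2 * (Re (F t) * Re d + Im (F t) * Im d)).
  have D := is_derive_addE (is_derive_mulE F1 F1) (is_derive_mulE F2 F2).
  by apply: (is_derive_eq D); ring.
have DV := is_deriveV N0 DN.
have ReV (z : R[i]) : Re z^-1 = Re z / (Re z ^+ 2 + Im z ^+ 2) by case: z.
have ImV (z : R[i]) : Im z^-1 = - (Im z / (Re z ^+ 2 + Im z ^+ 2)) by case: z.
have F2E : - d / F t ^+ 2 = - d * ((F t)^-1 * (F t)^-1) by rewrite expr2 invfM.
rewrite F2E; split.
  under eq_fun do rewrite ReV.
  apply: (is_derive_eq (is_derive_mulE F1 DV)).
  rewrite !(Re_mul, Im_mul, Re_opp, Im_opp, ReV, ImV) /GRing.scale/= /N.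
  by move: N0; rewrite /N; move: (F t) => [p q] /= N0; field.
under eq_fun do rewrite ImV.
apply: (is_derive_eq (is_derive_oppE (is_derive_mulE F2 DV))).
rewrite !(Re_mul, Im_mul, Re_opp, Im_opp, ReV, ImV) /GRing.scale/= /N.
by move: N0; rewrite /N; move: (F t) => [p q] /= N0; field.
Qed.

(** Up to the factor [4 (v - 1)], this is [n + a] in terms of [v]. *)
Definition denom n v : R[i] := (4 * n + 3)%:R * v - ((4 * n)%:R - 1).

(** [(4n + 3) - (4n + 1) = 2] by the triangle inequality. *)
Lemma normc_denom_cis n t : 2 <= normc (denom n (cis t)).
Proof.
apply: le_trans (ler_normcD_sub _ _).
rewrite normcM normc_cis normc_nat normcNC mulr1.
rewrite lerBrDr (le_trans (lerD (lexx _) (normcB _ _)))// !normc_nat (normc_nat _ 1).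
by rewrite -!natrD ler_nat addnCA addnC -!addnA.
Qed.

Lemma denom_cis_neq0 n t : denom n (cis t) != 0.
Proof. by rewrite -normc_gt0 (lt_le_trans _ (normc_denom_cis n t)). Qed.

(** Writing [(4n + 3) cis t] as [denom + (4n - 1)] makes the derivative a
    combination of powers of the same inverse. *)
Lemma cderive_denomV n k t : cderive (fun x => (denom n (cis x))^-1 ^+ k) t
  (- k%:R * 'i * (denom n (cis t))^-1 ^+ k
   + - k%:R * 'i * ((4 * n)%:R - 1) * (denom n (cis t))^-1 ^+ k.+1).
Proof.
have D1 : cderive (fun x => (denom n (cis x))^-1) t
    (- 'i * (denom n (cis t))^-1 - 'i * ((4 * n)%:R - 1) * (denom n (cis t))^-1 ^+ 2).
  have D := cderiveD (cderiveZ (4 * n + 3)%:R (cderive_cis t)) (cderive_cst (- ((4 * n)%:R - 1)) t).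
  apply: cderive_eq (cderiveV (denom_cis_neq0 n t) D).
  have := denom_cis_neq0 n t; rewrite /denom; move: (cis t) => v v0.
  by field; move: v0; rewrite natrD !natrM; apply.
elim: k => [|k IH].
  rewrite (_ : (fun x => _) = fun=> 1); last by apply/funext => x; rewrite expr0.
  by apply: cderive_eq (cderive_cst _ t); rewrite oppr0 !mul0r addr0.
rewrite (_ : (fun x => _) = fun x => (denom n (cis x))^-1 * (denom n (cis x))^-1 ^+ k); last first.
  by apply/funext => x; rewrite exprS.
apply: cderive_eq (cderiveM D1 IH).
by rewrite !exprS; move: (_^-1) => E; ring.
Qed.

Lemma normc_denomV_le1 n k t : normc ((denom n (cis t))^-1 ^+ k) <= 1.
Proof.
rewrite normcX normcV exprn_ile1 ?invr_ge0 ?normc_ge0//.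
by rewrite invf_le1 ?normc_gt0 ?denom_cis_neq0// (le_trans _ (normc_denom_cis n t))// ler1n.
Qed.

Definition denom_series c k t : R[i] :=
  cint nu setT (fun n => c n * (denom n (cis t))^-1 ^+ k).

Lemma cintegrable_denom_series c k t : factorial_decay c ->
  cintegrable nu setT (fun n => c n * (denom n (cis t))^-1 ^+ k).
Proof.
move=> cd; apply: (@cintegrable_le _ _ R nu _ _ (fun n => normc (c n))) => //.
  exact: integrable_factorial_decay.
by move=> n _; rewrite normcM ler_piMr ?normc_ge0// normc_denomV_le1.
Qed.

Lemma factorial_decay_derived c k : factorial_decay c ->
  factorial_decay (fun n => - k%:R * 'i * c n) /\
  factorial_decay (fun n => - k%:R * 'i * ((4 * n)%:R - 1) * c n).
Proof.
move=> cd.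
have n_i : normc ('i : R[i]) = 1 by rewrite /normc expr0n expr1n/= add0r sqrtr1.
split.
  apply: (factorial_decay_le cd (B := k%:R)) => // n.
  rewrite !normcM normcNC normc_nat n_i.
  by rewrite mulr1 ler_wpM2l// ler_peMl ?normc_ge0// ler1n.
apply: (factorial_decay_le cd (B := k%:R * 4)) => [|n]; first by rewrite mulr_ge0.
rewrite !normcM normcNC normc_nat n_i mulr1 -!mulrA ler_wpM2l// !mulrA ler_wpM2r ?normc_ge0//.
rewrite (le_trans (normcB _ _))// normc_nat (normc_nat _ 1) -natrM -natrD ler_nat.
by rewrite mulnS addnC leq_add2r.
Qed.

(** Termwise differentiation; the new coefficients are those of
    [cderive_denomV] times the old ones, again of factorial decay. *)
Lemma cderive_denom_series c k t : factorial_decay c ->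
  cderive (denom_series c k) t
    (denom_series (fun n => - k%:R * 'i * c n) k t +
     denom_series (fun n => - k%:R * 'i * ((4 * n)%:R - 1) * c n) k.+1 t).
Proof.
move=> cd.
have [d1 d2] := factorial_decay_derived k cd.
pose df n x := (- k%:R * 'i * c n) * (denom n (cis x))^-1 ^+ k
   + (- k%:R * 'i * ((4 * n)%:R - 1) * c n) * (denom n (cis x))^-1 ^+ k.+1.
have D n x : cderive (fun x => c n * (denom n (cis x))^-1 ^+ k) x (df n x).
  apply: cderive_eq (cderiveZ (c n) (cderive_denomV n k x)).
  by rewrite /df; move: (_^-1) => E; ring.
pose b n := normc (- k%:R * 'i * c n) + normc (- k%:R * 'i * ((4 * n)%:R - 1) * c n).
have ib : nu.-integrable setT (fun n => (b n)%:E).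
  by apply: integrable_add => //; exact: integrable_factorial_decay.
have dfb n x : normc (df n x) <= b n.
  rewrite (le_trans (normcD _ _))// lerD// normcM ler_piMr ?normc_ge0//; exact: normc_denomV_le1.
rewrite -cintD//; try exact: cintegrable_denom_series.
split.
  apply: (@is_derive_under_integral _ _ R nu setT (fun x n => Re (c n * (denom n (cis x))^-1 ^+ k))
    (fun x n => Re (df n x)) b) => //.
  - by move=> x; have [] := cintegrable_denom_series k x cd.
  - by move=> x n _; have [] := D n x.
  - by move=> x n _; rewrite (le_trans (Re_le_normc _)).
apply: (@is_derive_under_integral _ _ R nu setT (fun x n => Im (c n * (denom n (cis x))^-1 ^+ k))
  (fun x n => Im (df n x)) b) => //.
- by move=> x; have [] := cintegrable_denom_series k x cd.
- by move=> x n _; have [] := D n x.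
- by move=> x n _; rewrite (le_trans (Im_le_normc _)).
Qed.

(** A class of functions stable under differentiation, to which
    [real_smooth_closed] applies. *)
Inductive denom_sum : (R -> R[i]) -> Prop :=
| denom_sum1 c k : factorial_decay c -> denom_sum (denom_series c k)
| denom_sumD F G : denom_sum F -> denom_sum G -> denom_sum (fun t => F t + G t).

Lemma denom_sum_cderive F : denom_sum F ->
  exists2 F', denom_sum F' & forall t, cderive F t (F' t).
Proof.
elim=> [c k cd|{}F G _ [F' sF' dF] _ [G' sG' dG]]; last first.
  exists (fun t => F' t + G' t); first exact: denom_sumD.
  by move=> t; exact: cderiveD.
eexists; last by move=> t; exact: cderive_denom_series.
have [d1 d2] := factorial_decay_derived k cd.
by apply: denom_sumD; exact: denom_sum1.
Qed.

Lemma real_smooth_closed (S : set (R -> R)) :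
  (forall u, S u -> exists2 u', S u' & forall t, is_derive t (1 : R) u (u' t)) ->
  forall u, S u -> real_smooth u.
Proof.
move=> SD u Su n; suff [w Sw wE] : exists2 w, S w & derive1n n u = w.
  by have [w' _ dw] := SD _ Sw; rewrite wE => t; have H := dw t; exact: ex_derive.
elim: n => [|n [w Sw wE]]; first by exists u.
have [w' Sw' dw] := SD _ Sw; exists w' => //.
rewrite derive1nS wE; apply/funext => t; rewrite derive1E.
by have H := dw t; exact: derive_val.
Qed.

Lemma denom_sum_smooth F : denom_sum F ->
  real_smooth (fun t => Re (F t)) /\ real_smooth (fun t => Im (F t)).
Proof.
move=> sF; split.
  apply: (@real_smooth_closed [set u | exists2 G, denom_sum G & u = fun t => Re (G t)]); last by exists F.
  move=> _ [G sG ->]; have [G' sG' dG] := denom_sum_cderive sG.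
  by exists (fun t => Re (G' t)); [exists G'|move=> t; have [] := dG t].
apply: (@real_smooth_closed [set u | exists2 G, denom_sum G & u = fun t => Im (G t)]); last by exists F.
move=> _ [G sG ->]; have [G' sG' dG] := denom_sum_cderive sG.
by exists (fun t => Im (G' t)); [exists G'|move=> t; have [] := dG t].
Qed.

End SmoothSeries.

(** * Measure and continuity on the circle *)

Section CircleTopology.
Variable R : realType.
Local Notation mu := (@lebesgue_measure R).
Implicit Types (t : R) (f : R -> R).

Lemma cis_eq1 t : (cis t == 1 :> R[i]) = (cos t == 1).
Proof.
apply/eqP/eqP => [[]//|c1]; apply: complex_ext => //=.
by apply/eqP; rewrite -sqrf_eq0 sin2cos2 c1 expr1n subrr.
Qed.

(** Reduce [t] modulo [2 pi]; on a half period the cosine takes the value 1 only once. *)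
Lemma countable_cis1 : countable [set t : R | cis t = 1].
Proof.
have [P P0 PE] : exists2 P : R, 0 < P & P = 2 * pi.
  by exists (2 * pi) => //; rewrite mulr_gt0// pi_gt0.
have cosDn (k : nat) (x : R) : cos (x + P *+ k) = cos x.
  by rewrite PE mulr_natl; exact: (periodicn (@cosD2pi R)).
have S : [set t : R | cis t = 1] `<=` (fun k : int => k%:~R * P) @` [set: int].
  move=> t /eqP; rewrite cis_eq1 => /eqP c1.
  pose k := Num.floor (t / P); exists k => //.
  have [s sE] : exists s, s = t - k%:~R * P by eexists.
  have [s0 s1] : 0 <= s /\ s < P.
    have := floor_itv (t / P); rewrite -/k => /andP[].
    rewrite ler_pdivlMr// ltr_pdivrMr// intrD mulrDl mul1r sE.
    by move=> H1 H2; rewrite subr_ge0 H1 ltrBlDr addrC.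
  have cs : cos s = 1.
    rewrite -c1 sE; case: (k) => n.
      by rewrite -(cosDn n) -mulr_natl subrK.
    by rewrite NegzE mulrNz mulNr opprK mulrC -pmulrn mulr_natr cosDn.
  have [pp0 P2] : 0 <= pi :> R /\ P = pi + pi by rewrite pi_ge0 PE mulr2n mulrDl mul1r.
  suff E0 : s = 0 by apply/eqP; rewrite eq_sym -subr_eq0 -sE E0.
  have [sp|sp] := leP s pi.
    by apply: cos_inj; rewrite ?cos0// in_itv/= ?s0// lexx pp0.
  have E1 : P - s = 0.
    apply: cos_inj; rewrite ?cos0 ?in_itv/= ?lexx ?pp0//.
      by apply/andP; split; lra.
    by rewrite -cs addrC -[P]mulr1n cosDn cosN.
  by move: s1; rewrite -subr_gt0 E1 ltxx.
apply: sub_countable (subset_card_le S) _.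
apply: sub_countable (card_image_le _ _) _.
exact: countableP.
Qed.

Lemma ae_cis_neq1 (P : R -> Prop) : (forall t, cis t != 1 -> P t) -> {ae mu, forall t, P t}.
Proof.
move=> HP; apply: (@negligibleS _ _ _ mu [set t | cis t = 1]).
  by move=> t /= nP; apply: contrapT => /eqP/HP.
apply/negligibleP; last by apply: countable_lebesgue_measure0; exact: countable_cis1.
by apply: countable_measurable; [|exact: countable_cis1].
Qed.

Lemma bounded_Lfun f (B : R) : measurable_fun setT f -> (forall t, `|f t| <= B) ->
  f \in Lfun mu +oo%E.
Proof.
move=> mf fB; rewrite inE; apply/andP; split; first by rewrite inE.
rewrite inE /= /finite_norm unlock; case: ifPn => // _.
apply: le_lt_trans (ltry B); apply/ess_supP; apply: aeW => t /=.
by rewrite lee_fin.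
Qed.

Lemma open_cis_neq1 : open [set t : R | cis t != 1].
Proof.
have -> : [set t : R | cis t != 1] = cos @^-1` [set x | x != 1].
  by apply/seteqP; split=> t /=; rewrite cis_eq1.
apply: open_comp; first by move=> t _; exact: continuous_cos.
exact: open_neq.
Qed.

(** The functions at hand are continuous off the point 1 of the circle only. *)
Lemma measurable_cis_neq1 f g : (forall t, cis t != 1 -> {for t, continuous g}) ->
  (forall t, cis t != 1 -> f t = g t) -> (forall t, cis t = 1 -> f t = f 0) ->
  measurable_fun setT f.
Proof.
move=> cg fg f0; rewrite (_ : setT = [set t : R | cis t != 1] `|` ~` [set t : R | cis t != 1]).
  have mE := open_measurable open_cis_neq1.
  apply/measurable_funU => //; first exact: measurableC.
  split.
    apply: (@eq_measurable_fun _ _ _ _ _ g) => [t|]; first by rewrite inE => /fg.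
    by apply: open_continuous_measurable_fun => [|t]; [exact: open_cis_neq1|rewrite inE => /cg].
  apply: (@eq_measurable_fun _ _ _ _ _ (fun=> f 0)); last exact: measurable_cst.
  by move=> t; rewrite inE /= => /negP; rewrite negbK => /eqP/f0.
by rewrite setUv.
Qed.

Lemma cvg_complexP {T : Type} (B : set_system T) {FB : Filter B} (F : T -> R[i]) (l : R[i]) :
  (F x : R[i]^o) @[x --> B] --> (l : R[i]^o) <->
  (Re (F x) @[x --> B] --> Re l) /\ (Im (F x) @[x --> B] --> Im l).
Proof.
split=> [H|[/cvgrPdist_lt H1 /cvgrPdist_lt H2]].
  have {}H (e : R) : 0 < e -> \forall x \near B, normc (l - F x) < e.
    move=> e0; have e0' : 0 < e%:C :> R[i] by rewrite ltcR.
    have := (@cvgrPdist_lt R[i] R[i]^o _ B FB F l).1 H _ e0'.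
    by move=> Hn; apply: (@filterS _ B FB _ _ _ Hn) => x; rewrite normcE' ltcR.
  split; apply/cvgrPdist_lt => e /H Hn; apply: (@filterS _ B FB _ _ _ Hn) => x; apply: le_lt_trans.
    by rewrite -Re_sub Re_le_normc.
  by rewrite -Im_sub Im_le_normc.
apply: (@cvgrPdist_lt R[i] R[i]^o _ B FB F l).2 => e e0.
have [e1 e2] : Im e = 0 /\ 0 < Re e.
  by move: e0; rewrite ltcE => /andP[/eqP -> /= ].
have e3 : 0 < Re e / 2 by rewrite divr_gt0.
apply: (@filterS2 _ B FB _ _ _ _ (H1 _ e3) (H2 _ e3)) => x x1 x2.
rewrite normcE' ltcE/= e1 eqxx/= (le_lt_trans (normc_le_ReIm _))// Re_sub Im_sub.
by rewrite [ltRHS]splitr ltrD.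
Qed.

End CircleTopology.

(** * The Gamma ratio on the critical line *)

Section GammaRatio.
Variable R : realType.
Local Notation mu := (@lebesgue_measure R).
Local Notation nu := (@counting nat R).
Implicit Types (a v : R[i]) (t : R).
Local Notation h := (2^-1 : R).

Definition Gamma_ratio a : R[i] :=
  (cpow pi (- a) * Gamma_integral a) /
  (cpow pi (- (h%:C - a)) * Gamma_integral (h%:C - a)).

(** Half the argument of [rho_infty] in the definition of [kappa]. *)
Definition half_plane v : R[i] := 4^-1 + (v + 1) / (v - 1) / 2.

Lemma Gamma_Gamma_integral a : 0 < Re a -> Gamma a = Gamma_integral a.
Proof. by move=> a0; rewrite /Gamma /Gamma_shift a0 big_ord0 addr0 divr1. Qed.

Lemma half_planeE v : v != 1 -> half_plane v = 3 / 4 + (v - 1)^-1.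
Proof. by rewrite -subr_eq0 /half_plane => v1; field. Qed.

Lemma Re_inv z : Re (z^-1 : R[i]) = Re z / (Re z ^+ 2 + Im z ^+ 2).
Proof. by case: z. Qed.

Let Re_34 : Re (3 / 4 : R[i]) = 3 / 4.
Proof. by rewrite -[3 / 4 : R[i]](_ : (3 / 4)%:C = _)// fmorph_div !rmorph_nat. Qed.

Let Re_14 : Re (4^-1 : R[i]) = 4^-1.
Proof. by rewrite -[4^-1 : R[i]](_ : (4^-1)%:C = _)// fmorphV rmorph_nat. Qed.

Lemma Re_half_plane_cis t : Re (half_plane (cis t)) = 4^-1.
Proof.
have [->|v1] := eqVneq (cis t) 1; first by rewrite /half_plane subrr invr0 mulr0 mul0r addr0.
rewrite half_planeE// Re_add Re_34 Re_inv Re_sub Im_sub /= subr0.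
have c1 : cos t - 1 != 0 by rewrite subr_eq0 -cis_eq1.
have -> : (cos t - 1) ^+ 2 + sin t ^+ 2 = - 2 * (cos t - 1).
  by rewrite sin2cos2; ring.
by field.
Qed.

Lemma Re_half_plane_disk v : normc v < 1 -> Re (half_plane v) <= 4^-1.
Proof.
move=> v1; have vN1 : v != 1.
  by apply: contraTneq v1 => ->; rewrite normc1 ltxx.
rewrite half_planeE// Re_add Re_34 Re_inv.
have D0 : 0 < Re (v - 1) ^+ 2 + Im (v - 1) ^+ 2.
  by rewrite -normc_sqr exprn_gt0// normc_gt0 subr_eq0.
suff H : Re (v - 1) / (Re (v - 1) ^+ 2 + Im (v - 1) ^+ 2) <= - (1 / 2) by lra.
rewrite ler_pdivrMr//; move: v1; rewrite -(@ltr_pXn2r _ 2) ?nnegrE ?normc_ge0// expr1n normc_sqr.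
by rewrite Re_sub Im_sub /=; lra.
Qed.

Lemma kappa_Gamma_ratio v : Re (half_plane v) = 4^-1 -> kappa v = Gamma_ratio (half_plane v).
Proof.
move=> ha; rewrite /kappa /rho_infty /Gamma_ratio.
have -> : (1 / 2 + (v + 1) / (v - 1)) / 2 = half_plane v.
  by rewrite /half_plane; move: ((v + 1) / _) => w; field.
have -> : (1 - (1 / 2 + (v + 1) / (v - 1))) / 2 = h%:C - half_plane v.
  by rewrite /half_plane fmorphV rmorph_nat; move: ((v + 1) / _) => w; field.
have a0 : 0 < Re (half_plane v) by rewrite ha invr_gt0.
have b0 : 0 < Re (h%:C - half_plane v) by rewrite Re_sub ha Re_realC; lra.
by rewrite !Gamma_Gamma_integral.
Qed.

Let conj_line a : Re a = 4^-1 -> h%:C - a = a^*.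
Proof.
by move: a => [x y] /= ->; congr Complex; [lra|rewrite sub0r].
Qed.

Lemma Gamma_integral_conj a : 0 < Re a -> Gamma_integral (a^*) = (Gamma_integral a)^*.
Proof.
move=> a0; have [_ i2] := cintegrable_Gamma a0.
have E t : Gamma_integrand (a^*) t = (Gamma_integrand a t)^*.
  rewrite /Gamma_integrand rmorphM/= (_ : a^* - 1 = (a - 1)^*); last by rewrite rmorphB rmorph1.
  by rewrite cpow_conj; congr (_ * _); apply: complex_ext => /=; rewrite ?oppr0.
have ReC (z : R[i]) : Re (z^*) = Re z by case: z.
have ImC (z : R[i]) : Im (z^*) = - Im z by case: z.
apply: complex_ext.
  rewrite ReC -[LHS]/(\int[mu]_(t in `]0, +oo[) Re (Gamma_integrand (a^*) t)).
  by apply: eq_Rintegral => t _; rewrite E ReC.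
rewrite ImC -[LHS]/(\int[mu]_(t in `]0, +oo[) Im (Gamma_integrand (a^*) t)).
rewrite -[X in - X]/(\int[mu]_(t in `]0, +oo[) Im (Gamma_integrand a t)).
rewrite -mulN1r -RintegralZl//; apply: eq_Rintegral => t _.
by rewrite E ImC mulN1r.
Qed.

(** On the line [h - a] is the conjugate of [a], so numerator and denominator are
    conjugate to each other. *)
Lemma normc_Gamma_ratio a : Re a = 4^-1 -> normc (Gamma_ratio a) = 1.
Proof.
move=> ha; have a0 : 0 < Re a by rewrite ha invr_gt0.
rewrite /Gamma_ratio conj_line// Gamma_integral_conj// -rmorphN cpow_conj -rmorphM.
set z := _ * Gamma_integral a.
have z0 : z != 0 by rewrite mulf_neq0 ?cpow_neq0// Gamma_integral_neq0.
rewrite normcM normcV (_ : normc z^* = normc z); last by case: (z) => x y ; rewrite /normc /= sqrrN.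
by rewrite divff// gt_eqF// normc_gt0.
Qed.

Definition ratio_cst : R[i] := cpow pi (- h%:C) / (GammaR h)%:C.

(** Divide [mellin_sine_Gamma] by [Gamma(h - a)] and collect the powers of [pi]. *)
Lemma Gamma_ratio_mellin_sine a : Re a = 4^-1 ->
  Gamma_ratio a = ratio_cst * ((h%:C - a) * mellin_sine a).
Proof.
move=> ha; have M := mellin_sine_Gamma ha.
have a0 : 0 < Re a by rewrite ha invr_gt0.
have b0 : 0 < Re (h%:C - a) by rewrite !ReImE ha; lra.
have G0 : (GammaR h)%:C != 0 :> R[i].
  by rewrite -normc_gt0 normc_real normr_gt0 gt_eqF// GammaR_gt0// invr_gt0.
have := Gamma_integral_neq0 b0; rewrite /Gamma_ratio /ratio_cst.
have P : cpow pi (- a) = cpow pi (- h%:C) * cpow pi (h%:C - a).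
  by rewrite -cpowD; congr cpow; ring.
rewrite P cpowN [cpow pi (- (h%:C - a))]cpowN.
move: M; rewrite expr2 cpow_mul ?pi_gt0//.
have := cpow_neq0 pi (h%:C - a); have := cpow_neq0 pi h%:C.
move: (cpow pi h%:C) (cpow pi (h%:C - a)) => p w p0 w0.
move: (GammaR h)%:C G0 (Gamma_integral a) (Gamma_integral (h%:C - a)) (mellin_sine a) => G G0 Ga Gb Ms.
move: (h%:C - a) => d M Gb0.
have -> : d * Ms = w * w * G * Ga / Gb by rewrite -M mulfK.
by field; rewrite Gb0 G0 p0 w0.
Qed.

End GammaRatio.

(** * The decomposition *)

Opaque ratio_cst.

Section Assembly.
Variable R : realType.
Local Notation mu := (@lebesgue_measure R).
Local Notation nu := (@counting nat R).
Implicit Types (a v : R[i]) (t : R).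
Local Notation h := (2^-1 : R).
Local Notation lam := (@ratio_cst R).

Definition tail_part a : R[i] := (lam * h%:C + - lam * a) * tail a.

Lemma tail_partE a : tail_part a = lam * ((h%:C - a) * tail a).
Proof. by rewrite /tail_part; ring. Qed.

Definition head_part a : R[i] :=
  lam * ((h%:C - a) * cint mu `]0, 1] (osc pi a)).

Lemma Gamma_ratio_split a : Re a = 4^-1 -> Gamma_ratio a = head_part a + tail_part a.
Proof.
move=> ha; rewrite Gamma_ratio_mellin_sine// tail_partE -mulrDr -mulrDr; congr (_ * (_ * _)).
rewrite /mellin_sine itv0y_split cint_setU//.
  by rewrite -itv0y_split; apply: cintegrable_osc => //; exact: pi_gt0.
apply/disj_setPS => q /= []; rewrite !in_itv/= => /andP[_ q1]; rewrite andbT => /lt_le_trans/(_ q1).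
by rewrite ltxx.
Qed.

Let Re_na a n : Re (n%:R + a) = n%:R + Re a. Proof. by rewrite Re_add Re_natC. Qed.

Let na_neq0 a n : Re a = 4^-1 -> n%:R + a != 0.
Proof.
move=> ha; apply/eqP => E; have := Re_na a n; rewrite E ha /=.
have : 0 <= n%:R :> R by [].
by move=> H; lra.
Qed.

(** On the line the imaginary parts agree up to sign, and [Re (h - a) = 1/4]. *)
Let le_na a n : Re a = 4^-1 -> normc (h%:C - a) <= normc (n%:R + a).
Proof.
move=> ha; rewrite -(@ler_pXn2r _ 2) ?nnegrE ?normc_ge0// !normc_sqr.
rewrite Re_sub Im_sub Re_na Im_add Im_natC ha /= sub0r add0r sqrrN lerD2r.
have n0 : 0 <= n%:R :> R by [].
by rewrite ler_pXn2r ?nnegrE//; lra.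
Qed.

Let term a n : R[i] := lam * ((h%:C - a) / (n%:R + a)) * sine_coeff R n.

Let cintegrable_head a : Re a = 4^-1 ->
  cintegrable nu setT (fun n => sine_coeff R n / (n%:R + a)).
Proof.
move=> ha; apply: (@cintegrable_le _ _ R nu _ _ (fun n => 4 * normc (sine_coeff R n))) => //.
  by apply: integrable_scale => //; apply: integrable_factorial_decay; exact: factorial_decay_sine_coeff.
move=> n _; rewrite normcM normcV mulrC ler_wpM2r ?normc_ge0//.
have n4 : 4^-1 <= normc (n%:R + a).
  rewrite (le_trans _ (Re_le_normc _))// Re_na ha (le_trans _ (ler_norm _))// lerDr.
  by [].
by rewrite -[4]invrK lef_pV2 ?posrE ?(lt_le_trans _ n4) ?invr_gt0.
Qed.

Lemma head_partE a : Re a = 4^-1 -> head_part a = cint nu setT (term a).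
Proof.
move=> ha; rewrite /head_part cint_osc_01// mulrA -cintZ//; last exact: cintegrable_head.
by apply: eq_cint => n _; rewrite /term mulrA mulrA; ring.
Qed.

Let Bhead := 2 * \int[nu]_n (normc lam * normc (sine_coeff R n)).

Lemma head_part_le a : Re a = 4^-1 -> normc (head_part a) <= Bhead.
Proof.
move=> ha; rewrite head_partE//.
have ig : nu.-integrable setT (fun n => (normc lam * normc (sine_coeff R n))%:E).
  by apply: integrable_scale => //; apply: integrable_factorial_decay; exact: factorial_decay_sine_coeff.
have tle n : normc (term a n) <= normc lam * normc (sine_coeff R n).
  rewrite /term normcM ler_wpM2r ?normc_ge0// normcM ler_piMr ?normc_ge0// normcM normcV.
  by rewrite ler_pdivrMr ?normc_gt0 ?na_neq0// mul1r le_na.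
apply: normc_cint_le => //.
by apply: (@cintegrable_le _ _ R nu _ _ (fun n => normc lam * normc (sine_coeff R n))).
Qed.

Lemma taylor2_tail_part a : Re a <= 4^-1 -> taylor2 tail_part a.
Proof. by move=> ha; apply: taylor2M; [exact: taylor2_affine|exact: taylor2_tail]. Qed.

(** The growth bound for [phragmen_lindelof] comes from [tail_bounded], the bound
    on the line from the splitting of the Gamma ratio of modulus 1. *)
Lemma tail_part_bounded : exists M : R, forall a, Re a <= 4^-1 -> normc (tail_part a) <= M.
Proof.
have [B B0 HB] := @tail_bounded R.
have Bh0 : 0 <= Bhead.
  by rewrite mulr_ge0// Rintegral_ge0// => n _; rewrite mulr_ge0 ?normc_ge0.
exists (1 + Bhead).
apply: (@phragmen_lindelof R tail_part 4^-1 (1 + Bhead) (normc lam * B)).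
- by rewrite ltr_pwDl.
- by rewrite mulr_ge0 ?normc_ge0.
- exact: taylor2_tail_part.
- move=> a ha.
  have -> : tail_part a = Gamma_ratio a - head_part a by rewrite Gamma_ratio_split//; ring.
  by rewrite (le_trans (normcB _ _))// lerD ?head_part_le ?normc_Gamma_ratio.
- move=> a ha; rewrite tail_partE; move: (lam) => l; rewrite !normcM -mulrA ler_wpM2l ?normc_ge0//.
  rewrite mulrC ler_pM ?normc_ge0 ?HB//.
  have -> : h%:C - a = (4^-1)%:C + ((4^-1)%:C - a).
    by rewrite addrA -rmorphD/=; congr (_%:C - _); field.
  rewrite (le_trans (normcD _ _))// lerD2r normc_real ger0_norm ?invr_ge0//.
  by rewrite invf_le1// ler1n.
Qed.

(** Up to the factor [lam * sine_coeff R n], the coefficients in the partial fractions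
    [(h - a) / (n + a) = - 1/(4n + 3) - (16n + 8)/(4n + 3) / denom n v]. *)
Let c0 n : R[i] := - lam / (4 * n + 3)%:R * sine_coeff R n.
Let c1 n : R[i] := - lam * (16 * n + 8)%:R / (4 * n + 3)%:R * sine_coeff R n.

Let c0_decay : factorial_decay c0.
Proof.
apply: (factorial_decay_le (factorial_decay_sine_coeff R) (B := normc lam)) => [|n]; first exact: normc_ge0.
rewrite /c0; move: (lam) => l; rewrite !normcM normcV normcNC normc_nat -mulrA ler_wpM2l ?normc_ge0//.
rewrite ler_wpM2r ?normc_ge0// (@le_trans _ _ 1)//; last by rewrite ler1n.
by rewrite invf_le1 ?ltr0n ?addn_gt0 ?orbT// ler1n addn_gt0 orbT.
Qed.

Let c1_decay : factorial_decay c1.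
Proof.
apply: (factorial_decay_le (factorial_decay_sine_coeff R) (B := normc lam * 4)) => [|n].
  by rewrite mulr_ge0 ?normc_ge0.
rewrite /c1; move: (lam) => l; rewrite !normcM normcV normcNC !normc_nat -!mulrA ler_wpM2l ?normc_ge0// !mulrA.
rewrite ler_wpM2r ?normc_ge0// ler_pdivrMr ?ltr0n ?addn_gt0 ?orbT//.
rewrite -!natrM ler_nat (@leq_trans (4 * (4 * n + 3)))//.
  by rewrite mulnDr mulnA leq_add2l.
by rewrite leq_mul2r leq_pmulr// orbT.
Qed.

Definition smooth_part v : R[i] :=
  cint nu setT (fun n => c0 n * (denom n v)^-1 ^+ 0) +
  cint nu setT (fun n => c1 n * (denom n v)^-1 ^+ 1).

Lemma denom_sum_smooth_part : denom_sum (fun t => smooth_part (cis t)).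
Proof. exact: (denom_sumD (denom_sum1 0 c0_decay) (denom_sum1 1 c1_decay)). Qed.

Lemma smooth_part_head t : cis t != 1 -> smooth_part (cis t) = head_part (half_plane (cis t)).
Proof.
move=> v1; have ha := Re_half_plane_cis t.
rewrite head_partE// /smooth_part -cintD//; try exact: cintegrable_denom_series.
apply: eq_cint => n _; rewrite expr0 expr1 mulr1 /c0 /c1 /term.
rewrite [X in _ + X]mulrAC -mulrDl; congr (_ * _); move: (lam) => l.
have := na_neq0 n ha; have := denom_cis_neq0 n t.
have n3 : (4 * n + 3)%:R != 0 :> R[i] by rewrite pnatr_eq0 addn_eq0 andbF.
rewrite half_planeE// fmorphV rmorph_nat /denom.
move: v1; rewrite -subr_eq0; move: (cis t) => v v1 D0 a0.
have E : n%:R + (3 / 4 + (v - 1)^-1) = ((4 * n + 3)%:R * v - ((4 * n)%:R - 1)) / (4 * (v - 1)).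
  by rewrite natrD natrM; field.
have [N3 N4] : (4 * n + 3)%:R = 4 * n%:R + 3 :> R[i] /\ (4 * n)%:R = 4 * n%:R :> R[i] by rewrite natrD natrM.
rewrite E; move: D0 n3; rewrite N3 N4 => D0 n3; field.
by rewrite v1 D0 n3.
Qed.

End Assembly.

Section Decomposition.
Variable R : realType.
Implicit Types (v z : R[i]) (t : R).

(** The argument is [half_plane v] in a form that exhibits it as a Mobius map. *)
Definition hol_part v : R[i] := tail_part (3 / 4 + (v - 1)^-1).

Lemma derivable_hol_part v : v != 1 -> Re (half_plane v) <= 4^-1 ->
  derivable (hol_part : R[i]^o -> R[i]^o) v 1.
Proof.
move=> v1 hv; pose m v : R[i] := 3 / 4 + (v - 1)^-1.
have dm : derivable (m : R[i]^o -> R[i]^o) v 1.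
  apply: derivableD; first exact: derivable_cst.
  rewrite (_ : (fun v => (v - 1)^-1) = fun v => (-1 + 1 * v)^-1); last first.
    by apply/funext => w; rewrite mul1r addrC.
  by apply/taylor2_derivable/taylor2_affineV; rewrite mul1r addrC subr_eq0.
have dt : derivable (@tail_part R : R[i]^o -> R[i]^o) (m v) 1.
  by apply/taylor2_derivable/taylor2_tail_part; rewrite /m -half_planeE.
have Dm := (@derivable1_diffP _ _ _ _).1 dm.
have Dt := (@derivable1_diffP _ _ _ _).1 dt.
apply/derivable1_diffP.
exact: (differentiable_comp Dm Dt).
Qed.

(** Covers the radial limits and the continuity along the circle. *)
Lemma cvg_hol_part {T : Type} (B : set_system T) {FB : Filter B} (F : T -> R[i]) t :
  cis t != 1 -> Re (F x) @[x --> B] --> cos t -> Im (F x) @[x --> B] --> sin t ->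
  (hol_part (F x) : R[i]^o) @[x --> B] --> (hol_part (cis t) : R[i]^o).
Proof.
move=> t1 F1 F2.
have F0 : (F x : R[i]^o) @[x --> B] --> (cis t : R[i]^o) by apply/cvg_complexP.
have hv : Re (half_plane (cis t)) <= 4^-1 by rewrite Re_half_plane_cis.
have D := derivable_hol_part t1 hv.
have C := differentiable_continuous ((@derivable1_diffP _ _ _ _).1 D).
exact: (@cvg_comp T R[i]^o R[i]^o F hol_part B (nbhs (cis t : R[i]^o)) (nbhs (hol_part (cis t) : R[i]^o)) F0 C).
Qed.

(** On the circle this agrees with [hol_part], except possibly at the point 1, the
    pole of the Mobius map. *)
Definition bdry_part v : R[i] := kappa v - smooth_part v.

Lemma bdry_part_cis t : cis t != 1 -> bdry_part (cis t) = hol_part (cis t).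
Proof.
move=> t1; have ha := Re_half_plane_cis t.
rewrite /bdry_part kappa_Gamma_ratio// Gamma_ratio_split// smooth_part_head// /hol_part -half_planeE//.
by rewrite addrAC subrr add0r.
Qed.

Lemma circle_Linfty_bounded (f : R[i] -> R[i]) (B : R) :
  measurable_fun setT (fun t => Re (f (cis t))) -> measurable_fun setT (fun t => Im (f (cis t))) ->
  (forall t, normc (f (cis t)) <= B) -> circle_Linfty f.
Proof.
move=> m1 m2 fB; split; apply: (@bounded_Lfun _ _ B) => // t; apply: le_trans (fB t).
  exact: Re_le_normc.
exact: Im_le_normc.
Qed.

Lemma measurable_bdry_part :
  measurable_fun setT (fun t => Re (bdry_part (cis t))) /\
  measurable_fun setT (fun t => Im (bdry_part (cis t))).
Proof.
have C t : cis t != 1 -> (hol_part (cis x) : R[i]^o) @[x --> t] --> (hol_part (cis t) : R[i]^o).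
  by move=> t1; apply: cvg_hol_part => //; [exact: continuous_cos|exact: continuous_sin].
split.
  apply: (@measurable_cis_neq1 _ _ (fun t => Re (hol_part (cis t)))) => t t1.
  - by have /cvg_complexP[] := C t t1.
  - by rewrite bdry_part_cis.
  - by rewrite t1 cis0.
apply: (@measurable_cis_neq1 _ _ (fun t => Im (hol_part (cis t)))) => t t1.
- by have /cvg_complexP[] := C t t1.
- by rewrite bdry_part_cis.
- by rewrite t1 cis0.
Qed.

Lemma measurable_smooth (u : R -> R) : real_smooth u -> measurable_fun setT u.
Proof.
move=> us; apply: continuous_measurable_fun => t.
by apply/differentiable_continuous/derivable1_diffP; exact: (us 0%N).
Qed.

End Decomposition.

Theorem proposition2p4 (R : realType) : in_smooth_add_Hinfty (@kappa R).
Proof.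
have [M HM] := @tail_part_bounded R.
have S : circle_smooth (@smooth_part R) := denom_sum_smooth (denom_sum_smooth_part R).
have [mb1 mb2] := measurable_bdry_part R.
split.
  have kE t : kappa (cis t) = bdry_part (cis t) + smooth_part (cis t) :> R[i] by rewrite subrK.
  apply: (@circle_Linfty_bounded _ _ 1) => [||t].
  - under eq_fun do rewrite kE Re_add.
    by apply: measurable_funD => //; apply: measurable_smooth; exact: S.1.
  - under eq_fun do rewrite kE Im_add.
    by apply: measurable_funD => //; apply: measurable_smooth; exact: S.2.
  - have ha := Re_half_plane_cis t.
    by rewrite kappa_Gamma_ratio// normc_Gamma_ratio.
exists (@smooth_part R), (@hol_part R), (@bdry_part R); split => //.
- have disk z : `|z| < 1 -> z != 1 /\ Re (half_plane z) <= 4^-1 :> R.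
    rewrite normcE' -[1]/(1%:C) ltcR => z1; split; last exact: Re_half_plane_disk.
    by apply: contraTneq z1 => ->; rewrite normc1 ltxx.
  split; first by move=> z /disk[z1 ha]; exact: derivable_hol_part.
  exists M => z /disk[z1 ha]; rewrite normcE' lecR /hol_part -half_planeE//.
  exact: HM.
- split.
    apply: (@circle_Linfty_bounded _ _ (Num.max M (normc (bdry_part (1 : R[i]))))) => // t.
    rewrite le_max; have [->|t1] := eqVneq (cis t) 1; first by rewrite lexx orbT.
    by rewrite bdry_part_cis// /hol_part -half_planeE// HM// Re_half_plane_cis.
  apply: ae_cis_neq1 => t t1; rewrite bdry_part_cis//.
  have C1 : (r : R) @[r --> (1 : R)^'-] --> (1 : R) by exact: cvg_at_left_filter.
  apply: cvg_hol_part => //.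
    rewrite (_ : (fun r => _) = fun r => r * cos t); last first.
      by apply/funext => r; rewrite Re_mul /= mul0r subr0.
    by have := cvgM C1 (cvg_cst (cos t)); rewrite mul1r; apply.
  rewrite (_ : (fun r => _) = fun r => r * sin t); last first.
    by apply/funext => r; rewrite Im_mul /= mul0r addr0.
  by have := cvgM C1 (cvg_cst (sin t)); rewrite mul1r; apply.
- by apply: aeW => t /=; rewrite /bdry_part addrC subrK.
Qed.
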